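(* Let $n\geq 2$ be an integer, $\rho>1$, and let $(p_r)_{r\geq1}$ satisfy $p_r>0$, $\sum_{r\geq1}p_r=1$ and $C_1\rho^{-r}\leq p_r\leq C_2\rho^{-r}$ for some constants $C_1,C_2>0$. Assume the spectral dimension $\mathrm{d}=2\frac{\log n}{\log\rho}$ satisfies $\mathrm{d}<1$. Let $e\in\mathbb{R}$ be such that $\eta(e)>0$ and such that for every $z\in\mathbb{C}$ with $\mathrm{Im}\, z>0$, $$\lim_{\varepsilon\downarrow0}\int_{\mathbb{R}}\mathrm{Im}\,(t-e-\varepsilon z)^{-1}\eta(t)\,dt=\pi\eta(e).$$ Then the rescaled eigenvalue point process $\xi_k^{\omega,e}=\sum_{i=1}^{|B_k|}\delta\big(|B_k|(e_i^{\omega,k}-e)\big)$ converges, as $k\to\infty$, to a Poisson point process on $\mathbb{R}$ with intensity $\eta(e)\mathcal{L}$, where $\mathcal{L}$ is Lebesgue measure. That is, for any disjoint bounded Borel sets $A_1,\dots,A_m\subset\mathbb{R}$ and any $r_1,\dots,r_m\in\{0,1,2,\dots\}$, $$\lim_{k\to\infty}\mathbb{P}\{\xi_k^{\omega,e}(A_1)=r_1,\dots,\xi_k^{\omega,e}(A_m)=r_m\}=\prod_{s=1}^m e^{-\eta(e)\mathcal{L}(A_s)}\frac{(\eta(e)\mathcal{L}(A_s))^{r_s}}{r_s!}.$$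
   Context: Hierarchical Anderson model. Let $\mathbb{X}=\{0,1,2,\dots\}$. For $x\in\mathbb{X}$ and $r\geq0$ let $q(x,n^r)$ be the quotient of the division of $x$ by $n^r$, and define the metric $d(x,y)=\min\{r: q(x,n^r)=q(y,n^r)\}$; closed balls are $B(x,r)=\{y: d(x,y)\leq r\}$ (each has $n^r$ points). For $r\geq1$ let $E_r$ be the operator on $\ell^2(\mathbb{X})$ given by $(E_r\psi)(x)=n^{-r}\sum_{d(y,x)\leq r}\psi(y)$ (orthogonal projection onto functions constant on balls of radius $r$). The hierarchical Laplacian is $\Delta=\sum_{r\geq1}p_rE_r$. Let $(\omega(x))_{x\in\mathbb{X}}$ be i.i.d. real random variables with a bounded probability density $\gamma$, on the product probability space $(\Omega,\mathcal{F},\mathbb{P})$, and let $V_\omega$ be multiplication by $\omega(x)$. Set $H_\omega=\Delta+V_\omega$ (self-adjoint on $\{\psi:\sum_x|\psi(x)|^2(1+|\omega(x)|^2)<\infty\}$). Fix $x_0\in\mathbb{X}$, let $B_k=B(x_0,k)$, so $|B_k|=n^k$, and let $H_k^\omega=\sum_{s=1}^kp_sE_s+V_\omega$; the subspace $\ell^2(B_k)$ of functions vanishing outside $B_k$ is invariant under $H_k^\omega$, and $e_1^{\omega,k}\leq\dots\leq e^{\omega,k}_{|B_k|}$ denote the eigenvalues of $H_k^\omega$ restricted to $\ell^2(B_k)$. The averaged spectral measure $\mu^{av}$ is the Borel probability measure with $\int f\,d\mu^{av}=\mathbb{E}\langle\delta_{x_0},f(H_\omega)\delta_{x_0}\rangle$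 for continuous $f$ vanishing at infinity; it is absolutely continuous with respect to Lebesgue measure with a bounded density $\eta$ ($\|\eta\|_\infty\leq\|\gamma\|_\infty$). *)

(* Defs.v *)
From HB Require Import structures.
From mathcomp Require Import all_boot all_order all_algebra.
From mathcomp Require Import all_classical all_reals all_analysis.
Set Implicit Arguments. Unset Strict Implicit. Unset Printing Implicit Defensive.
Import Order.TTheory GRing.Theory Num.Theory.
Import numFieldNormedType.Exports.
Local Open Scope classical_set_scope.
Local Open Scope ring_scope.

Section Defs.
Variable R : realType.

(** Averaging operator E_r on functions on X = nat (base n):
    (E_r psi)(x) = n^{-r} sum_{d(y,x) <= r} psi y, and the ball of radius r
    around x is { q(x,n^r) * n^r + i | i < n^r }. *)
Definition Eavg (n r : nat) (psi : nat -> R) (x : nat) : R :=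
  ((n ^ r)%:R)^-1 * \sum_(i < n ^ r) psi ((x %/ n ^ r) * n ^ r + i)%N.

Definition hlap (n : nat) (p : nat -> R) (psi : nat -> R) (x : nat) : R :=
  \big[+%R/0%R]_(1 <= r <oo) (p r * Eavg n r psi x).

(** psi = u + i v lies in the domain of H_omega:
    sum_x |psi x|^2 (1 + |omega x|^2) < oo *)
Definition in_dom (w : nat -> R) (u v : nat -> R) : Prop :=
  cvgn (series (fun x => (u x ^+ 2 + v x ^+ 2) * (1 + w x ^+ 2))).

(** u + i v = (H_omega - (a + i b))^{-1} delta_{x0}, i.e. u + i v is in the
    domain of H_omega and (H_omega - a - i b)(u + i v) = delta_{x0},
    written out in real and imaginary parts. *)
Definition resolvent_sol (n : nat) (p : nat -> R) (w : nat -> R) (x0 : nat)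
    (a b : R) (u v : nat -> R) : Prop :=
  in_dom w u v /\
  forall x, hlap n p u x + (w x - a) * u x + b * v x = (x == x0)%:R
         /\ hlap n p v x + (w x - a) * v x - b * u x = 0.

Definition ball_pt (n k x0 : nat) (i : 'I_(n ^ k)) : nat :=
  ((x0 %/ n ^ k) * n ^ k + i)%N.

(** Matrix of H_k^omega = sum_{s=1}^k p_s E_s + V_omega restricted to l^2(B_k),
    in the basis (delta_y)_{y in B_k}. *)
Definition Hk_mx (n : nat) (p : nat -> R) (w : nat -> R) (x0 k : nat) :
    'M[R]_(n ^ k) :=
  \matrix_(i, j)
    ((\sum_(1 <= s < k.+1)
        p s * ((n ^ s)%:R)^-1 *
        ((ball_pt x0 i %/ n ^ s == ball_pt x0 j %/ n ^ s)%N)%:R)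
     + (i == j)%:R * w (ball_pt x0 i)).

Definition eigenvalue_list (N : nat) (M : 'M[R]_N) (s : seq R) : Prop :=
  char_poly M = \prod_(l <- s) ('X - l%:P).

Definition mutually_independent (d : measure_display) (Omega : measurableType d)
    (P : probability Omega R) (X : nat -> Omega -> R) : Prop :=
  forall (S : seq nat) (A : nat -> set R),
    uniq S -> (forall i, measurable (A i)) ->
    P (\big[setI/setT]_(i <- S) (X i @^-1` A i)) =
    (\prod_(i <- S) P (X i @^-1` A i))%E.

End Defs.

(* Main.v *)
Require Import Defs.
From HB Require Import structures.
From mathcomp Require Import all_boot all_order all_algebra.
From mathcomp Require Import all_classical all_reals all_analysis.
From mathcomp Require Import measurable_realfun ring lra zify.
From mathcomp Require complex.
Import Order.TTheory GRing.Theory Num.Theory.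
Import numFieldNormedType.Exports.
Set Implicit Arguments. Unset Strict Implicit. Unset Printing Implicit Defensive.
Local Open Scope classical_set_scope.
Local Open Scope ring_scope.

(** Cut the box [B_k] into [L = n^(k - J)] blocks of size [n^J], [J] about [k / 2],
by dropping the levels [J < s <= k] of the Laplacian.  The dropped part has norm
of order [rho^-J], and [d < 1] means [n^2 < rho], so that this is much smaller than
the eigenvalue spacing [n^-k]: by the Wegner estimate no eigenvalue crosses a given
threshold at the scale [n^-k], with probability tending to one.

The truncated matrix is a direct sum of [L] independent blocks.  By the Minami
estimate a block puts two eigenvalues in a window of size [n^-k] with probability
[O(L^-2)], so that the counts are those of [L] independent trials with few
successes.  Their mean measure is dominated by Lebesgue measure; by homogeneity of
the hierarchical structure its Poisson transform is the averaged imaginary part of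
the resolvent of the block at [x0], which at the scale [n^-k] agrees with that of
the infinite operator up to a factor tending to one, and so tends to [pi * eta e].
Hence the mean measure tends to [eta e] times Lebesgue measure, and the multinomial
probabilities tend to the Poisson ones. *)

(** The comparison of resolvents has to be relative. The width b of the kernel shrinks like n^-k, so
    a bound on the difference of two diagonal entries by t / b^2, with t the norm of the dropped
    part, would be lost. But b times the squared norm of a resolvent column is the imaginary part of
    its diagonal entry; this turns a comparison of columns in norm into the factor (1 + t / b)^2,
    for which t n^k -> 0 is enough. The choice of J meets two demands: t n^k is at most a constant
    times (n^2 / rho)^J as soon as k <= 2 J, and the number n^(k - J) of blocks still grows. The
    density [eta] is given only through resolvents of the infinite operator, so a resolvent column
    has to be constructed, as the limit of finite columns extended by zero; complex equations are
    written as pairs of real ones. Both the mean measure and the effect of the truncation are first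
    controlled on intervals. Uniform domination by Lebesgue measure, a form of the Wegner estimate,
    carries this to Borel sets. The probability takes place on the space of real sequences, where
    one site can be resampled and sites can be permuted. *)

(** * Orthogonal diagonalisation of real symmetric matrices *)

Section SpectralTheorem.
Context {R : realType}.

Lemma dotmx_ge0 N (v : 'rV[R]_N) : 0 <= (v *m v^T) 0 0.
Proof. by rewrite mxE sumr_ge0// => i _; rewrite mxE -expr2 sqr_ge0. Qed.

Lemma dotmx_eq0 N (v : 'rV[R]_N) : (v *m v^T) 0 0 = 0 -> v = 0.
Proof.
move=> /eqP; rewrite mxE psumr_eq0; last by move=> i _; rewrite mxE -expr2 sqr_ge0.
move=> /allP h; apply/rowP => i; move: (h i (mem_index_enum _)).
by rewrite !mxE /= -expr2 sqrf_eq0 => /eqP.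
Qed.

Lemma dotmx_gt0 N (v : 'rV[R]_N) : v != 0 -> 0 < (v *m v^T) 0 0.
Proof.
move=> v0; rewrite lt_neqAle dotmx_ge0 andbT eq_sym.
by apply: contra v0 => /eqP/dotmx_eq0 ->.
Qed.

Import complex.

(** The complexified matrix is hermitian, so its spectral diagonal is real; an eigenvalue lying in
    [R] is already one over [R], and this gives a real eigenvector to normalise. *)
Lemma sym_eigenvector N (M : 'M[R]_N.+1) : M^T = M ->
  exists a (v : 'rV_N.+1), v *m M = a *: v /\ v *m v^T = 1%:M.
Proof.
move=> Ms; pose f := real_complex R : {rmorphism R -> R[i]%C}.
pose A := map_mx f M.
have Aherm : A \is hermsymmx.
  apply: realsym_hermsym.
    by apply/is_hermitianmxP; rewrite expr0 scale1r map_mx_id//; apply/matrixP => i j; rewrite !mxE -[in LHS]Ms mxE.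
  by apply/mxOverP => i j; rewrite mxE complex_real.
have := hermitian_normalmx Aherm => /orthomx_spectralP.
have Pu := spectral_unit A.
move: (hermitian_spectral_diag_real Aherm) Pu.
set P := spectralmx A; set D := spectral_diag A => /mxOverP /(_ 0 0) Dr Pu AE.
have PA : P *m A = diag_mx D *m P by rewrite AE !mulmxA mulmxV// mul1mx.
have eA : eigenvalue A (D 0 0).
  apply/eigenvalueP; exists (row 0 P).
    by rewrite -row_mul PA row_mul row_diag_mx -scalemxAl -rowE.
  apply/eqP => r0; have := row_mul 0 P (invmx P).
  rewrite mulmxV// r0 mul0mx => /rowP /(_ 0); rewrite !mxE eqxx => /eqP.
  by rewrite oner_eq0.
have DE : D 0 0 = f (complex.Re (D 0 0)).
  by move/Creal_ImP : Dr => /=; case: (D 0 0) => x y /= /eqP; rewrite -complexIm /= => /eqP [->].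
move: eA; rewrite DE eigenvalue_map => /eigenvalueP [v vM v0].
have vv := dotmx_gt0 v0; set c := (v *m v^T) 0 0 in vv.
exists (complex.Re (D 0 0)), ((Num.sqrt c)^-1 *: v); split.
  by rewrite -scalemxAl vM scalerA mulrC -scalerA.
rewrite linearZ /= -scalemxAl -scalemxAr scalerA [v *m v^T]mx11_scalar -/c.
rewrite scale_scalar_mx -expr2 exprVn sqr_sqrtr ?mulVf ?gt_eqF//.
exact: ltW.
Qed.


(** The reflection along [u], the difference of [v] and the first basis vector, exchanges these two
    unit vectors. It degenerates when [u] is zero, which is treated apart. *)
Lemma householder N (v : 'rV[R]_N.+1) : v *m v^T = 1%:M ->
  exists H : 'M[R]_N.+1, H *m H^T = 1%:M /\ row 0 H = v.
Proof.
move=> vv; have [->|v0] := eqVneq v (delta_mx 0 0).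
  by exists 1%:M; rewrite trmx1 mulmx1 row1.
pose u := v - delta_mx 0 0; pose c := (u *m u^T) 0 0.
have c0 : c != 0 by rewrite gt_eqF// dotmx_gt0// subr_eq0.
have cE : c = 2 - 2 * v 0 0.
  rewrite /c /u linearB /= mulmxBl !mulmxBr vv trmx_delta mul_delta_mx.
  rewrite -[delta_mx 0 0 *m v^T]trmxK trmx_mul trmxK trmx_delta.
  by rewrite -colE !mxE /=; ring.
have uu : u *m u^T = c%:M by rewrite [LHS]mx11_scalar.
exists (1%:M - (2 / c) *: (u^T *m u)).
have -> : (1%:M - (2 / c) *: (u^T *m u))^T = 1%:M - (2 / c) *: (u^T *m u).
  by rewrite linearB /= linearZ /= trmx_mul trmxK trmx1.
split.
  have X2 : (u^T *m u) *m (u^T *m u) = c *: (u^T *m u).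
    by rewrite -mulmxA (mulmxA u) uu mul_scalar_mx -scalemxAr.
  move: X2; set X := u^T *m u => X2.
  rewrite mulmxBl !mulmxBr !mulmx1 !mul1mx -scalemxAl -scalemxAr X2 !scalerA.
  have -> : 2 / c * (2 / c) * c = 2 / c + 2 / c by field.
  by rewrite scalerDl opprB addrK subrK.
rewrite linearB /= row1 linearZ /= row_mul.
have -> : row 0 u^T = (v 0 0 - 1)%:M.
  by rewrite [LHS]mx11_scalar; congr (_%:M); rewrite !mxE.
rewrite mul_scalar_mx scalerA (_ : _ * _ = -1); last by move: c0; rewrite cE => c0; field.
by rewrite scaleN1r opprK addrC subrK.
Qed.

(** Deflation: in an orthonormal basis starting with an eigenvector, the first row is a multiple of
    the first basis vector, by symmetry so is the first column, and induction applies to the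
    remaining block. The rows of [P] are the eigenvectors. *)
Lemma real_spectral N (M : 'M[R]_N) : M^T = M ->
  exists (P : 'M[R]_N) (d : 'rV[R]_N), P *m P^T = 1%:M /\ P *m M = diag_mx d *m P.
Proof.
elim: N M => [|N IH] M Ms.
  by exists 0, 0; split; apply/matrixP => -[].
have [a [v [vM vv]]] := sym_eigenvector Ms.
have [H [HH H0]] := householder vv.
have HtH : H^T *m H = 1%:M by apply: mulmx1C.
have [M' M'def] : exists M' : 'M[R]_(1 + N), M' = H *m M *m H^T by eexists.
have M's : M'^T = M' by rewrite M'def !trmx_mul trmxK Ms mulmxA.
have M'0 j : M' (lshift N 0) j = a *+ (j == lshift N 0).
  have /rowP/(_ j) : row (lshift N 0) M' = a *: delta_mx 0 (lshift N 0).
    have l0 : lshift N (0 : 'I_1) = 0 :> 'I_N.+1 by apply: val_inj.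
    by rewrite M'def l0 row_mul row_mul H0 vM -scalemxAl -H0 -row_mul HH row1.
  by rewrite !mxE eqxx mulr_natr => ->.
have M'E : M' = block_mx a%:M 0 0 (drsubmx M').
  rewrite -[LHS]submxK; congr block_mx; apply/matrixP => i j; rewrite !ord1 !mxE.
  - by rewrite M'0 eqxx.
  - by rewrite M'0 eq_rlshift.
  - by rewrite -M's mxE M'0 eq_rlshift.
have [|P [d [PP PD]]] := IH (drsubmx M').
  by rewrite trmx_drsub M's.
pose B : 'M[R]_(1 + N) := block_mx 1%:M 0 0 P.
have BB : B *m B^T = 1%:M.
  rewrite /B tr_block_mx !trmx0 trmx1.
  by rewrite mulmx_block !mul0mx !mulmx0 !mulmx1 PP !addr0 add0r -scalar_mx_block.
have BM : B *m M' = diag_mx (row_mx a%:M d) *m B.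
  rewrite M'E diag_mx_row !mulmx_block !mul0mx !mulmx0 !mulmx1 !mul1mx !addr0 !add0r PD.
  by congr block_mx; apply/matrixP => i j; rewrite !ord1 !mxE.
exists ((B : 'M[R]_N.+1) *m H), (row_mx a%:M d); split.
  by rewrite trmx_mul mulmxA -(mulmxA _ H) HH mulmx1; exact: BB.
have HM : H *m M = M' *m H by rewrite M'def -[LHS]mulmx1 -HtH; exact: mulmxA.
by rewrite -mulmxA HM !mulmxA; congr (_ *m H); exact: BM.
Qed.

End SpectralTheorem.

(** * Sorted eigenvalue lists and their counting functions *)

Section EigenvalueLists.
Context {R : realType}.

(** Sorting makes the spectrum a function of the matrix, so that the i-th eigenvalue can be a random
    variable. By [evsP] the default value is never reached for symmetric [M]. *)
Definition evs N (M : 'M[R]_N) : seq R :=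
  xget [::] [set l | eigenvalue_list M l /\ sorted <=%R l].

Lemma char_poly_spectral N (M P : 'M[R]_N) (d : 'rV_N) :
  P *m P^T = 1%:M -> P *m M = diag_mx d *m P ->
  char_poly M = \prod_(i < N) ('X - (d 0 i)%:P).
Proof.
move=> PP PM.
have PpP : map_mx polyC P *m char_poly_mx M = char_poly_mx (diag_mx d) *m map_mx polyC P.
  rewrite /char_poly_mx mulmxBr mulmxBl -!map_mxM PM.
  by rewrite scalar_mxC.
have detP : \det (map_mx polyC P) != 0.
  rewrite det_map_mx polyC_eq0 -unitfE -/(P \in unitmx).
  by case: (mulmx1_unit PP).
have := congr1 determinant PpP; rewrite !det_mulmx [RHS]mulrC => /(mulfI detP).
rewrite -!/(char_poly _) => ->.
rewrite char_poly_trig ?diag_mx_is_trig//.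
by apply: eq_bigr => i _; rewrite mxE eqxx.
Qed.

Lemma eigenvalue_list_perm N (M : 'M[R]_N) l l' :
  eigenvalue_list M l -> eigenvalue_list M l' -> perm_eq l l'.
Proof. by move=> h h'; apply: prod_XsubC_eq; rewrite -h -h'. Qed.

Lemma evsP N (M : 'M[R]_N) : M^T = M ->
  eigenvalue_list M (evs M) /\ sorted <=%R (evs M).
Proof.
move=> Ms; rewrite /evs; case: xgetP => //= h.
have [P [d [PP PM]]] := real_spectral Ms.
exfalso; apply: (h (sort <=%R [seq d 0 i | i <- enum 'I_N])); split.
  rewrite /eigenvalue_list (char_poly_spectral PP PM).
  rewrite (perm_big [seq d 0 i | i <- enum 'I_N]) /=; last by rewrite perm_sort.
  by rewrite big_map enumT.
exact: sort_le_sorted.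
Qed.

Lemma eigenvalue_list_evs N (M : 'M[R]_N) l : M^T = M ->
  eigenvalue_list M l -> perm_eq (evs M) l.
Proof. by move=> /evsP[h _]; exact: eigenvalue_list_perm. Qed.

Lemma evs_spectral N (M P : 'M[R]_N) (d : 'rV_N) : M^T = M ->
  P *m P^T = 1%:M -> P *m M = diag_mx d *m P ->
  perm_eq (evs M) [seq d 0 i | i <- enum 'I_N].
Proof.
move=> Ms PP PM; apply: eigenvalue_list_evs => //.
by rewrite /eigenvalue_list (char_poly_spectral PP PM) big_map enumT.
Qed.

Lemma size_evs N (M : 'M[R]_N) : M^T = M -> size (evs M) = N.
Proof.
move=> Ms; have [P [d [PP PM]]] := real_spectral Ms.
by rewrite (perm_size (evs_spectral Ms PP PM)) size_map size_enum_ord.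
Qed.

Lemma count_evs_spectral N (M P : 'M[R]_N) (d : 'rV_N) (p : pred R) : M^T = M ->
  P *m P^T = 1%:M -> P *m M = diag_mx d *m P ->
  count p (evs M) = #|[set i | p (d 0 i)]%SET|.
Proof.
move=> Ms PP PM; have /permP -> := evs_spectral Ms PP PM.
rewrite count_map -size_filter cardE; congr size.
by rewrite !enumT; apply: eq_filter => i; rewrite /= inE.
Qed.

End EigenvalueLists.

Section CountingFunction.
Context {R : realType}.

(** The selected rows of [P] are orthonormal eigenvectors, so in the coordinates [y] on their span
    the form is diagonal and the norm Euclidean. *)
Lemma quad_rowsub N m (M P : 'M[R]_N) (d : 'rV_N) (f : 'I_m -> 'I_N) (y : 'rV_m) :
  injective f -> P *m P^T = 1%:M -> P *m M = diag_mx d *m P ->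
  let x := y *m rowsub f P in
  (x *m M *m x^T) 0 0 = \sum_k d 0 (f k) * y 0 k ^+ 2 /\
  (x *m x^T) 0 0 = \sum_k y 0 k ^+ 2.
Proof.
move=> fi PP PM x.
have BB : rowsub f P *m (rowsub f P)^T = 1%:M.
  apply/matrixP => i j; have /matrixP/(_ (f i) (f j)) := PP; rewrite !mxE (inj_eq fi) => <-.
  by apply: eq_bigr => k _; rewrite !mxE.
have BM : rowsub f P *m M = diag_mx (\row_k d 0 (f k)) *m rowsub f P.
  rewrite mul_rowsub_mx PM; apply/matrixP => i j.
  by rewrite mul_diag_mx mxE mul_diag_mx !mxE.
split.
  rewrite /x trmx_mul -(mulmxA y) BM !mulmxA -(mulmxA _ _ (rowsub f P)^T) BB mulmx1.
  rewrite mxE; apply: eq_bigr => k _; rewrite mul_mx_diag !mxE; ring.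
rewrite /x trmx_mul mulmxA -(mulmxA y) BB mulmx1 mxE.
by apply: eq_bigr => k _; rewrite mxE expr2.
Qed.

Lemma rowsub_rank N m (P : 'M[R]_N) (f : 'I_m -> 'I_N) :
  injective f -> P *m P^T = 1%:M -> \rank (rowsub f P) = m.
Proof.
move=> fi PP; apply/eqP; rewrite -/(row_free _); apply/row_freeP.
exists (rowsub f P)^T; apply/matrixP => i j.
have /matrixP/(_ (f i) (f j)) := PP; rewrite !mxE (inj_eq fi) => <-.
by apply: eq_bigr => k _; rewrite !mxE.
Qed.

(* Courant-Fischer in counting form: if [M2 <= M1] as quadratic forms on a
   subspace [W] of codimension at most [r], then the span of the eigenvectors of
   [M1] below [lam], that of the eigenvectors of [M2] from [lam] on, and [W] meet
   trivially. *)
Lemma count_lt_le N (M1 M2 W : 'M[R]_N) (r : nat) (lam : R) :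
  M1^T = M1 -> M2^T = M2 -> (N <= \rank W + r)%N ->
  (forall x : 'rV_N, (x <= W)%MS -> (x *m M2 *m x^T) 0 0 <= (x *m M1 *m x^T) 0 0) ->
  (count (fun t => t < lam)%R (evs M1) <= count (fun t => t < lam)%R (evs M2) + r)%N.
Proof.
move=> M1s M2s Wr WM.
have [P1 [d1 [PP1 PM1]]] := real_spectral M1s.
have [P2 [d2 [PP2 PM2]]] := real_spectral M2s.
rewrite (count_evs_spectral _ M1s PP1 PM1) (count_evs_spectral _ M2s PP2 PM2).
set S1 := [set i | _]%SET; set S2 := [set i | _]%SET.
have inj1 : injective (@enum_val _ (mem S1)) := @enum_val_inj _ _.
have inj2 : injective (@enum_val _ (mem (~: S2)%SET)) := @enum_val_inj _ _.
set f1 := @enum_val _ (mem S1) in inj1; set f2 := @enum_val _ (mem (~: S2)%SET) in inj2.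
pose V1 := rowsub f1 P1; pose V2 := rowsub f2 P2.
have r1 : \rank V1 = #|S1| by apply: rowsub_rank.
have r2 : \rank V2 = #|(~: S2)%SET| by apply: rowsub_rank.
(* For a common vector, lam |x|^2 <= <M2 x, x> <= <M1 x, x>, while the eigenvalues of [M1] on [V1]
   are strictly below [lam]; all coordinates of [x] must vanish. *)
have cap0 : ((V1 :&: V2) :&: W)%MS = 0.
  apply/eqP; rewrite -submx0; apply/row_subP => i.
  set x := row i _.
  have xin : (x <= (V1 :&: V2) :&: W)%MS by rewrite row_sub.
  have xW : (x <= W)%MS by apply: submx_trans xin (capmxSr _ _).
  have x1 : (x <= V1)%MS by apply: submx_trans xin (submx_trans (capmxSl _ _) (capmxSl _ _)).
  have x2 : (x <= V2)%MS by apply: submx_trans xin (submx_trans (capmxSl _ _) (capmxSr _ _)).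
  have [y1 xE1] := submxP x1; have [y2 xE2] := submxP x2.
  have [q1 n1] := quad_rowsub y1 inj1 PP1 PM1.
  have [q2 n2] := quad_rowsub y2 inj2 PP2 PM2.
  move: (WM x xW) q1 n1 q2 n2; rewrite -/V1 -/V2 -xE1 -xE2 => le q1 n1 q2 n2.
  have low : lam * (x *m x^T) 0 0 <= (x *m M2 *m x^T) 0 0.
    rewrite q2 n2 mulr_sumr; apply: ler_sum => k _; apply: ler_wpM2r; first exact: sqr_ge0.
    have := enum_valP k; by rewrite -/(f2 k) !finset.inE -leNgt.
  have high : \sum_k (lam - d1 0 (f1 k)) * y1 0 k ^+ 2 <= 0.
    under eq_bigr do rewrite mulrBl.
    by rewrite sumrB -mulr_sumr -n1 -q1 subr_le0 (le_trans low).
  have pos k : 0 <= (lam - d1 0 (f1 k)) * y1 0 k ^+ 2.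
    rewrite mulr_ge0 ?sqr_ge0// subr_ge0 ltW//.
    by have := enum_valP k; rewrite -/(f1 k) finset.inE.
  have y10 : y1 = 0.
    have : \sum_k (lam - d1 0 (f1 k)) * y1 0 k ^+ 2 == 0.
      by rewrite eq_le high sumr_ge0.
    rewrite psumr_eq0// => /allP h; apply/rowP => k; rewrite mxE.
    have := h k (mem_index_enum _); rewrite /= mulf_eq0 sqrf_eq0 subr_eq0 => /orP[|/eqP//].
    have : d1 0 (f1 k) < lam by have := enum_valP k; rewrite -/(f1 k) finset.inE.
    by move=> /lt_eqF; rewrite eq_sym => ->.
  by rewrite xE1 y10 mul0mx sub0mx.
(* Dimension count: a trivial intersection forces #|S1| + (N - #|S2|) + rank W <= 2 N. *)
have := mxrank_sum_cap (V1 :&: V2)%MS W; rewrite cap0 mxrank0 addn0.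
have := mxrank_sum_cap V1 V2; rewrite r1 r2.
have l1 := rank_leq_col (V1 + V2)%MS; have l2 := rank_leq_col ((V1 :&: V2) + W)%MS.
have := cardsC S2; rewrite card_ord.
lia.
Qed.

End CountingFunction.

(** * Finite resolvents in real form *)

Section Resolvent.
Context {R : realType}.

Definition cnorm2 N (u : 'cV[R]_N) : R := \sum_i u i 0 ^+ 2.
Definition cdot N (u v : 'cV[R]_N) : R := \sum_i u i 0 * v i 0.

Lemma cdotDr N (u v w : 'cV[R]_N) : cdot u (v + w) = cdot u v + cdot u w.
Proof. by rewrite -big_split; apply: eq_bigr => i _; rewrite mxE mulrDr. Qed.

Lemma cdotZr N (u v : 'cV[R]_N) c : cdot u (c *: v) = c * cdot u v.
Proof. by rewrite mulr_sumr; apply: eq_bigr => i _; rewrite mxE mulrCA. Qed.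

Lemma cdotN N (u : 'cV[R]_N) : cdot u u = cnorm2 u.
Proof. by apply: eq_bigr => i _; rewrite expr2. Qed.

Lemma cdot_sym N (M : 'M[R]_N) (u v : 'cV[R]_N) : M^T = M ->
  cdot u (M *m v) = cdot v (M *m u).
Proof.
move=> Ms; rewrite /cdot.
under eq_bigr do rewrite mxE mulr_sumr.
rewrite exchange_big /=; apply: eq_bigr => j _; rewrite mxE mulr_sumr.
by apply: eq_bigr => i _; rewrite -[in LHS]Ms mxE; ring.
Qed.

Lemma cnorm2_ge0 N (u : 'cV[R]_N) : 0 <= cnorm2 u.
Proof. by rewrite sumr_ge0// => i _; rewrite sqr_ge0. Qed.

Lemma cnorm2_eq0 N (u : 'cV[R]_N) : cnorm2 u <= 0 -> u = 0.
Proof.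
move=> u0; have /eqP : cnorm2 u == 0 by rewrite eq_le u0 cnorm2_ge0.
move=> /eqP; rewrite psumr_eq0 => [/allP h|i _]; last exact: sqr_ge0.
apply/colP => i; have := h i (mem_index_enum _).
by rewrite mxE /= sqrf_eq0 => /eqP.
Qed.

(** Real and imaginary parts of (M - a - ib)(u + iv) = f + ig. *)
Definition res_pair N (M : 'M[R]_N) (a b : R) (f g u v : 'cV[R]_N) :=
  (M - a%:M) *m u + b *: v = f /\ (M - a%:M) *m v - b *: u = g.

Section Pair.
Variables (N : nat) (M : 'M[R]_N) (a b : R).
Hypotheses (Ms : M^T = M) (b0 : 0 < b).

Let Mas : (M - a%:M)^T = M - a%:M.
Proof. by rewrite linearB /= tr_scalar_mx Ms. Qed.

(** Pairing the first equation with [v] and the second with [u], the symmetric part cancels. For f =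
    delta_x and g = 0 this is the Ward identity Im G(x,x) = b |G delta_x|^2. *)
Lemma res_pair_energy f g u v : res_pair M a b f g u v ->
  b * (cnorm2 u + cnorm2 v) = cdot v f - cdot u g.
Proof.
move=> [<- <-]; rewrite -scaleNr !cdotDr !cdotZr !cdotN (cdot_sym v u Mas); ring.
Qed.

(** The resolvent has norm at most 1 / b. By the energy identity the gap between the two sides is
    exactly |b v - f|^2 + |b u + g|^2. *)
Lemma res_pair_bound f g u v : res_pair M a b f g u v ->
  b ^+ 2 * (cnorm2 u + cnorm2 v) <= cnorm2 f + cnorm2 g.
Proof.
move=> /res_pair_energy E.
have : 0 <= \sum_i ((b * v i 0 - f i 0) ^+ 2 + (b * u i 0 + g i 0) ^+ 2).
  by apply: sumr_ge0 => i _; rewrite addr_ge0 ?sqr_ge0.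
suff -> : \sum_i ((b * v i 0 - f i 0) ^+ 2 + (b * u i 0 + g i 0) ^+ 2) =
   cnorm2 f + cnorm2 g - b ^+ 2 * (cnorm2 u + cnorm2 v) by rewrite subr_ge0.
transitivity (b ^+ 2 * (cnorm2 u + cnorm2 v) + (cnorm2 f + cnorm2 g)
  - 2 * b * (cdot v f - cdot u g)).
  rewrite mulrDr !mulr_sumr -!big_split/= -sumrB mulr_sumr -sumrB.
  by apply: eq_bigr => i _; ring.
by rewrite -E; ring.
Qed.

Lemma res_pair_unique f g u v u' v' :
  res_pair M a b f g u v -> res_pair M a b f g u' v' -> u = u' /\ v = v'.
Proof.
move=> [h1 h2] [h1' h2'].
have /res_pair_bound : res_pair M a b 0 0 (u - u') (v - v').
  split; rewrite !(mulmxBr, scalerBr).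
    by rewrite -(subrr f) -{1}h1 -h1' opprD addrACA.
  rewrite -(subrr g) -{1}h2 -h2'; apply/colP => i; rewrite !mxE; ring.
have -> : cnorm2 (0 : 'cV[R]_N) = 0 by apply: big1 => i _; rewrite mxE expr0n.
rewrite addr0 pmulr_rle0 ?exprn_gt0// => le0.
have nu := cnorm2_ge0 (u - u'); have nv := cnorm2_ge0 (v - v').
split; apply/eqP; rewrite -subr_eq0; apply/eqP/cnorm2_eq0; lra.
Qed.

(** This is (M - z)(M - conj z) for z = a + ib. Hence the resolvent at z is (M - a + ib) [Kmx]^-1,
    and b [Kmx]^-1 is its imaginary part. *)
Definition Kmx : 'M[R]_N := (M - a%:M) *m (M - a%:M) + (b ^+ 2)%:M.

Lemma Kmx_unit : Kmx \in unitmx.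
Proof.
rewrite -row_free_unit -kermx_eq0.
apply/eqP/row_matrixP => i; rewrite row0; set x := row i _.
have xK : x *m Kmx = 0.
  by apply/sub_kermxP; rewrite row_sub.
have : ((x *m (M - a%:M)) *m (x *m (M - a%:M))^T) 0 0 + b ^+ 2 * (x *m x^T) 0 0 = 0.
  rewrite trmx_mul Mas.
  have := congr1 (fun y => (y *m x^T) 0 0) xK.
  rewrite /Kmx mulmxDr mulmxDl mul0mx !mulmxA mul_mx_scalar -scalemxAl.
  by rewrite mxE [X in _ + X]mxE => ->; rewrite mxE.
move=> h; apply: dotmx_eq0.
have h1 := dotmx_ge0 (x *m (M - a%:M)); have h2 := dotmx_ge0 x.
have h3 : 0 < b ^+ 2 by rewrite exprn_gt0.
nra.
Qed.

Definition imG (x : 'I_N) : R := b * invmx Kmx x x.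

Definition resu (x : 'I_N) : 'cV[R]_N := (M - a%:M) *m (invmx Kmx *m delta_mx x 0).
Definition resv (x : 'I_N) : 'cV[R]_N := b *: (invmx Kmx *m delta_mx x 0).

Lemma res_pairP x : res_pair M a b (delta_mx x 0) 0 (resu x) (resv x).
Proof.
split; rewrite /resu /resv; last by rewrite -scalemxAr subrr.
rewrite mulmxA scalerA -expr2 -mul_scalar_mx -mulmxDl -/Kmx mulmxA mulmxV ?mul1mx//.
exact: Kmx_unit.
Qed.

Lemma resvE x : resv x x 0 = imG x.
Proof. by rewrite /resv /imG mxE -colE mxE. Qed.

Lemma imG_energy x : b * (cnorm2 (resu x) + cnorm2 (resv x)) = imG x.
Proof.
rewrite (res_pair_energy (res_pairP x)) -resvE /cdot (bigD1 x)//= big1 => [|i ix].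
  rewrite [delta_mx _ _ _ _]mxE !eqxx mulr1 addr0 [X in _ - X]big1 ?subr0// => i _.
  by rewrite [X in _ * X]mxE mulr0.
by rewrite [delta_mx _ _ _ _]mxE (negbTE ix) mulr0.
Qed.

Lemma imG_gt0 x : 0 < imG x.
Proof.
rewrite -imG_energy pmulr_rgt0// lt_neqAle addr_ge0 ?cnorm2_ge0// andbT eq_sym.
apply/eqP => h; have nu := cnorm2_ge0 (resu x); have nv := cnorm2_ge0 (resv x).
have u0 : resu x = 0 by apply: cnorm2_eq0; lra.
have v0 : resv x = 0 by apply: cnorm2_eq0; lra.
have [] := res_pairP x; rewrite u0 v0 mulmx0 scaler0 addr0 => /colP/(_ x).
by rewrite !mxE !eqxx => /eqP; rewrite eq_sym oner_eq0.
Qed.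

End Pair.

(** Im 1 / (t - a - ib), the Poisson kernel without the factor 1 / pi; its total mass is [pi]. *)
Definition pk (a b t : R) : R := b / ((t - a) ^+ 2 + b ^+ 2).

Lemma pk_ge0 a b t : 0 < b -> 0 <= pk a b t.
Proof.
by move=> b0; apply: divr_ge0; [exact: ltW|rewrite addr_ge0 ?sqr_ge0].
Qed.

Lemma pk_den a b t : 0 < b -> 0 < (t - a) ^+ 2 + b ^+ 2 :> R.
Proof. by move=> b0; rewrite ltr_wpDl ?sqr_ge0 ?exprn_gt0. Qed.

Lemma sum_imG N (M : 'M[R]_N) a b : M^T = M -> 0 < b ->
  \sum_x imG M a b x = \sum_(t <- evs M) pk a b t.
Proof.
move=> Ms b0; have [P [d [PP PM]]] := real_spectral Ms.
rewrite (perm_big _ (evs_spectral Ms PP PM)) big_map big_enum /=.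
have PtP : P^T *m P = 1%:M by apply: mulmx1C.
have PMa : P *m (M - a%:M) = diag_mx (\row_i (d 0 i - a)) *m P.
  rewrite mulmxBr PM scalar_mxC -mulmxBl; congr (_ *m P).
  by apply/matrixP => i j; rewrite !mxE; case: eqP => [->|]; rewrite ?mulr1n ?mulr0n ?subr0.
have PK : P *m Kmx M a b = diag_mx (\row_i ((d 0 i - a) ^+ 2 + b ^+ 2)) *m P.
  rewrite /Kmx mulmxDr mulmxA PMa -mulmxA PMa mulmxA scalar_mxC -mulmxDl; congr (_ *m P).
  rewrite mulmx_diag; apply/matrixP => i j; rewrite !mxE.
  by case: eqP => [->|]; rewrite ?mulr1n ?mulr0n ?addr0// expr2.
have KI : invmx (Kmx M a b) = P^T *m diag_mx (\row_i ((d 0 i - a) ^+ 2 + b ^+ 2)^-1) *m P.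
  rewrite -[RHS]mulmx1 -(mulmxV (Kmx_unit a Ms b0)) !mulmxA.
  rewrite -(mulmxA _ P) PK mulmxA -(mulmxA P^T) mulmx_diag.
  suff -> : diag_mx (\row_i ((\row_i ((d 0 i - a) ^+ 2 + b ^+ 2)^-1) 0 i *
      (\row_i ((d 0 i - a) ^+ 2 + b ^+ 2)) 0 i)) = 1%:M :> 'M[R]_N.
    by rewrite mulmx1 PtP mul1mx.
  apply/matrixP => i j; rewrite !mxE mulVf// gt_eqF// pk_den//.
rewrite /imG -mulr_sumr -/(\tr _) KI mxtrace_mulC mulmxA PP mul1mx mxtrace_diag.
rewrite mulr_sumr; apply: eq_bigr => i _; by rewrite mxE.
Qed.

(** Rank-one perturbation: with G0 = u0 + i v0 the entry at t = 0, the entry at t is 1 / (t + 1 /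
    G0), whose imaginary part is a Poisson kernel in t. Its integral over t therefore does not
    depend on the rest of the matrix. *)
Lemma imG_rank1 N (M : 'M[R]_N) a b x : M^T = M -> 0 < b ->
  exists c1 c2, 0 < c2 /\
   forall t, imG (M + t *: delta_mx x x) a b x = pk c1 c2 t.
Proof.
move=> Ms b0.
set u := resu M a b x; set v := resv M a b x.
have uv : res_pair M a b (delta_mx x 0) 0 u v by exact: res_pairP.
pose u0 := u x 0; pose v0 := v x 0.
have v0p : 0 < v0 by rewrite /v0 resvE imG_gt0.
clearbody u v.
have g0 : 0 < u0 ^+ 2 + v0 ^+ 2 by rewrite ltr_wpDl ?sqr_ge0 ?exprn_gt0.
exists (- u0 / (u0 ^+ 2 + v0 ^+ 2)), (v0 / (u0 ^+ 2 + v0 ^+ 2)); split.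
  by rewrite divr_gt0.
move=> t; pose s := (1 + t * u0) ^+ 2 + (t * v0) ^+ 2.
have s0 : 0 < s.
  rewrite lt_neqAle addr_ge0 ?sqr_ge0// andbT eq_sym paddr_eq0 ?sqr_ge0//.
  apply/negP; rewrite !sqrf_eq0 mulf_eq0 (gt_eqF v0p) orbF => /andP[+ /eqP t0].
  by rewrite t0 mul0r addr0 oner_eq0.
have Mts : (M + t *: delta_mx x x)^T = M + t *: delta_mx x x.
  by rewrite linearD /= linearZ /= trmx_delta Ms.
(* Real and imaginary parts of (u + iv) / (1 + t (u0 + i v0)); [s] is the squared modulus of the
   denominator. *)
pose u' := s^-1 *: ((1 + t * u0) *: u + (t * v0) *: v).
pose v' := s^-1 *: ((1 + t * u0) *: v - (t * v0) *: u).
have dx (y : 'cV[R]_N) : (t *: delta_mx x x) *m y = (t * y x 0) *: delta_mx x 0.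
  apply/colP => i; rewrite -scalemxAl !mxE (bigD1 x)//= big1 => [|j jx].
    by rewrite !mxE eqxx /= andbT addr0; ring.
  by rewrite mxE (negbTE jx) andbF mul0r.
have uv' : res_pair (M + t *: delta_mx x x) a b (delta_mx x 0) 0 u' v'.
  case: uv => h1 h2.
  split; rewrite [M + _ - _]addrAC mulmxDl dx.
    transitivity (s^-1 *: ((1 + t * u0) *: ((M - a%:M) *m u + b *: v) +
       (t * v0) *: ((M - a%:M) *m v - b *: u)) + (t * u' x 0) *: delta_mx x 0).
      rewrite -scalemxAr mulmxDr -!scalemxAr; apply/colP => i; rewrite !mxE; ring.
    rewrite h1 h2; apply/colP => i; rewrite /u' !mxE -/u0 -/v0 /s.
    have := s0; rewrite /s => s0'.
    case: (i == x) => /=; last by rewrite !mulr0 !addr0 mulr0 ?addr0.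
    by field; rewrite gt_eqF.
  transitivity (s^-1 *: ((1 + t * u0) *: ((M - a%:M) *m v - b *: u) -
       (t * v0) *: ((M - a%:M) *m u + b *: v)) + (t * v' x 0) *: delta_mx x 0).
    rewrite -scalemxAr mulmxBr -!scalemxAr; apply/colP => i; rewrite !mxE; ring.
  rewrite h1 h2; apply/colP => i; rewrite /v' !mxE -/u0 -/v0 /s.
  have := s0; rewrite /s => s0'.
  case: (i == x) => /=; last by ring.
  by field; rewrite gt_eqF.
have [_ vE] := res_pair_unique Mts b0 (res_pairP a Mts b0 x) uv'.
rewrite -resvE vE /v' !mxE -/u0 -/v0 /pk /s.
have := s0; rewrite /s => s0'.
by field; rewrite !gt_eqF// ?pk_den// ?divr_gt0//=; nra.
Qed.

(** Second resolvent identity: the difference of the solutions solves the system of [M] with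
    right-hand side -(M' - M) applied to the solution of [M']. *)
Lemma res_pair_compare N (M M' : 'M[R]_N) a b (f u v u' v' : 'cV[R]_N) :
  M^T = M -> 0 < b ->
  res_pair M a b f 0 u v -> res_pair M' a b f 0 u' v' ->
  b ^+ 2 * (cnorm2 (u' - u) + cnorm2 (v' - v)) <=
    cnorm2 ((M' - M) *m u') + cnorm2 ((M' - M) *m v').
Proof.
move=> Ms b0 [h1 h2] [h1' h2'].
have nN (y : 'cV[R]_N) : cnorm2 (- y) = cnorm2 y.
  by apply: eq_bigr => i _; rewrite mxE sqrrN.
rewrite -[X in _ <= X + _]nN -[X in _ <= _ + X]nN.
apply: (@res_pair_bound _ M a b Ms).
split.
  transitivity (((M' - a%:M) *m u' + b *: v' - ((M - a%:M) *m u + b *: v))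
     - (M' - M) *m u'); last by rewrite h1 h1' subrr sub0r.
  rewrite !(mulmxBl, mulmxBr, scalerBr); apply/colP => i; rewrite !mxE; ring.
transitivity (((M' - a%:M) *m v' - b *: u' - ((M - a%:M) *m v - b *: u))
     - (M' - M) *m v'); last by rewrite h2 h2' subrr sub0r.
rewrite !(mulmxBl, mulmxBr, scalerBr); apply/colP => i; rewrite !mxE; ring.
Qed.

End Resolvent.

(** * Independent sites on the space of real sequences *)

Section Cylinders.
Context {R : realType}.

Definition cyl (S : seq nat) (A : nat -> set R) : set (nat -> R) :=
  [set w | forall i, i \in S -> A i (w i)].

Definition cylinders : set (set (nat -> R)) :=
  [set X | exists S A, (forall i, measurable (A i)) /\ X = cyl S A].

Definition seqR : measurableType cylinders.-sigma := g_sigma_algebraType cylinders.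

Lemma cylinders_setI : setI_closed cylinders.
Proof.
move=> X Y [S [A [mA ->]]] [S' [A' [mA' ->]]].
exists (S ++ S'), (fun i => (if i \in S then A i else setT) `&`
                     (if i \in S' then A' i else setT)); split.
  by move=> i; apply: measurableI; case: ifP => // _; exact: measurableT.
apply/seteqP; split => w /=.
  by move=> [h h'] i _; split; case: ifP => // iS; [exact: h|exact: h'].
move=> h; split => i iS; have := h i; rewrite mem_cat iS ?orbT => /(_ isT) [h1 h2] //.
Qed.

Lemma measurable_seqRE : (@measurable _ seqR) = <<s cylinders >>.
Proof. by []. Qed.

Lemma measurable_cyl S (A : nat -> set R) : (forall i, measurable (A i)) ->
  measurable (cyl S A : set seqR).
Proof.
by move=> mA; rewrite measurable_seqRE; apply: sub_sigma_algebra; exists S, A.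
Qed.

Lemma measurable_coord i : measurable_fun setT (fun w : seqR => w i).
Proof.
move=> _ A mA; rewrite setTI.
rewrite (_ : _ @^-1` _ = cyl [:: i] (fun=> A)); first exact: measurable_cyl.
apply/seteqP; split => w /= h; first by move=> j; rewrite inE => /eqP ->.
by apply: h; rewrite inE.
Qed.

Lemma measurable_fun_seqR d (T : measurableType d) (f : T -> seqR) :
  (forall i, measurable_fun setT (fun x => f x i)) -> measurable_fun setT f.
Proof.
move=> mf; apply: (@measurability _ _ T seqR setT f cylinders erefl).
move=> _ [X [S [A [mA ->]]] <-]; rewrite setTI.
rewrite (_ : _ @^-1` _ = \big[setI/setT]_(i <- S) ((fun x => f x i) @^-1` A i)).
  apply: bigsetI_measurable => i _.
  by rewrite -[X in measurable X]setTI; apply: mf => //; exact: mA.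
rewrite -bigcap_seq; apply/seteqP; split => w /= h i; exact: h.
Qed.

(** The infinite product measure described by its values on cylinders. These form a pi-system, so
    they determine a probability with this property. *)
Definition iid_law (mu : set R -> \bar R) (Q : set seqR -> \bar R) : Prop :=
  forall S (A : nat -> set R), uniq S -> (forall i, measurable (A i)) ->
    Q (cyl S A) = (\prod_(i <- S) mu (A i))%E.

Definition splice (p : pred nat) (w w' : nat -> R) : nat -> R :=
  fun i => if p i then w i else w' i.

Lemma cyl_undup S A : cyl (undup S) A = cyl S A.
Proof. by apply/seteqP; split => w h i iS; apply: h; rewrite ?mem_undup// -mem_undup. Qed.

Section Law.
Variables (mu : set R -> \bar R) (Q : probability seqR R).
Hypotheses (muT : mu setT = 1%E) (HQ : iid_law mu Q).

Lemma iid_law_unique (Q' : {measure set seqR -> \bar R}) :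
  iid_law mu Q' -> forall X, measurable X -> Q X = Q' X.
Proof.
move=> HQ'; apply: (@measure_unique _ R seqR cylinders (fun=> setT)) => //.
- exact: cylinders_setI.
- move=> _; exists [::], (fun=> setT); split=> //.
  by apply/seteqP; split.
- by rewrite bigcup_const//; exists 0%N.
- move=> X [S [A [mA ->]]]; rewrite -cyl_undup.
  by apply: etrans (HQ (undup_uniq _) mA) _; apply: esym; exact: HQ' (undup_uniq _) mA.
- by move=> k; apply: le_lt_trans (probability_le1 Q measurableT) _; rewrite ltry.
Qed.

Lemma measurable_splice p :
  measurable_fun setT (fun z : seqR * seqR => splice p z.1 z.2 : seqR).
Proof.
apply: measurable_fun_seqR => i; rewrite /splice; case: (p i).
  exact: (measurableT_comp (measurable_coord i) measurable_fst).
exact: (measurableT_comp (measurable_coord i) measurable_snd).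
Qed.

(** Resampling the coordinates outside [p] from an independent copy preserves the law. This stands
    in for Fubini on the infinite product: it suffices to check cylinders, which split into a part
    on [p] and a part off [p]. *)
Lemma iid_law_splice p X : measurable (X : set seqR) ->
  Q X = (Q \x Q)%E ((fun z : seqR * seqR => splice p z.1 z.2) @^-1` X).
Proof.
move=> mX.
apply: (iid_law_unique (Q' := pushforward (Q \x Q)%E (fun z : seqR * seqR => splice p z.1 z.2 : seqR))) => //.
  exact: measurable_splice.
move=> mm S A uS mA; rewrite /pushforward /=.
pose A1 i := if p i then A i else setT; pose A2 i := if p i then setT else A i.
have mA1 i : measurable (A1 i) by rewrite /A1; case: ifP => // _; exact: measurableT.
have mA2 i : measurable (A2 i) by rewrite /A2; case: ifP => // _; exact: measurableT.
have E : (fun z : seqR * seqR => splice p z.1 z.2 : seqR) @^-1` cyl S A = cyl S A1 `*` cyl S A2.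
  apply/seteqP; split => -[w w'] /=; rewrite /cyl /splice /=.
    by move=> h; split=> i iS; have := h i iS; rewrite /A1 /A2; case: ifP.
  by move=> [h1 h2] i iS; have := h1 i iS; have := h2 i iS; rewrite /A1 /A2; case: ifP.
transitivity ((Q \x Q)%E (cyl S A1 `*` cyl S A2)); first by rewrite -E.
apply: etrans (product_measure1E Q Q (measurable_cyl S mA1) (measurable_cyl S mA2)) _.
rewrite [X in (X * _)%E](HQ uS mA1) [X in (_ * X)%E](HQ uS mA2) -big_split /=.
by apply: eq_bigr => i _; rewrite /A1 /A2; case: ifP => _; rewrite muT ?mule1 ?mul1e.
Qed.

Lemma measurable_reindex (s : nat -> nat) :
  measurable_fun setT (fun w : seqR => w \o s : seqR).
Proof. by apply: measurable_fun_seqR => i; exact: measurable_coord. Qed.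

Lemma iid_law_reindex (s : nat -> nat) X : injective s -> measurable (X : set seqR) ->
  Q X = Q ((fun w : seqR => w \o s : seqR) @^-1` X).
Proof.
move=> si mX.
apply: (iid_law_unique (Q' := pushforward Q (fun w : seqR => w \o s : seqR))) => //.
  exact: measurable_reindex.
move=> mm S A uS mA; rewrite /pushforward /=.
(* [s] is inverted only on the image of [S], by looking up positions; elsewhere the value of [A']
   does not matter. *)
pose A' j := A (nth 0%N S (index j (map s S))).
have A's i : i \in S -> A' (s i) = A i.
  by move=> iS; rewrite /A' index_map// nth_index.
have E : (fun w : seqR => w \o s : seqR) @^-1` cyl S A = cyl (map s S) A'.
  apply/seteqP; split => w; rewrite /cyl /=.
    by move=> h _ /mapP[i iS ->]; rewrite A's//; exact: h.
  by move=> h i iS; have := h (s i); rewrite A's// map_f//; exact.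
transitivity (Q (cyl (map s S) A')); first by rewrite -E.
rewrite [LHS]HQ ?map_inj_uniq//; last by move=> j; exact: mA.
by rewrite big_map big_seq [RHS]big_seq; apply: eq_bigr => i iS; rewrite A's.
Qed.

Lemma iid_law_coord i (A : set R) : measurable A ->
  Q ((fun w : seqR => w i) @^-1` A) = mu A.
Proof.
move=> mA; rewrite (_ : _ @^-1` _ = cyl [:: i] (fun=> A)).
  by rewrite [LHS]HQ// big_seq1.
apply/seteqP; split => w /= h; first by move=> j; rewrite inE => /eqP ->.
by apply: h; rewrite inE.
Qed.

Lemma iid_integral_reindex (s : nat -> nat) (f : seqR -> \bar R) : injective s ->
  measurable_fun [set: seqR] f -> (forall w, 0 <= f w)%E ->
  (\int[Q]_w f w = \int[Q]_w f (w \o s))%E.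
Proof.
move=> si mf f0.
have mm := measurable_reindex s.
transitivity (\int[pushforward Q (fun w : seqR => w \o s : seqR)]_w f w)%E.
  by apply: eq_measure_integral => A mA _; exact: iid_law_reindex.
by rewrite ge0_integral_pushforward.
Qed.

Lemma iid_integral_splice p (f : seqR -> \bar R) :
  measurable_fun [set: seqR] f -> (forall w, 0 <= f w)%E ->
  (\int[Q]_w f w = \int[Q]_w \int[Q]_w' f (splice p w w'))%E.
Proof.
move=> mf f0.
have mm := measurable_splice p.
transitivity (\int[pushforward (Q \x Q) (fun z : seqR * seqR => splice p z.1 z.2 : seqR)]_w f w)%E.
  by apply: eq_measure_integral => A mA _; exact: iid_law_splice.
rewrite ge0_integral_pushforward// preimage_setT fubini_tonelli1//.
  exact: (measurableT_comp mf mm).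
by move=> z; exact: f0.
Qed.

(* Events depending on disjoint sets of coordinates are independent. *)
Lemma iid_indep (p : pred nat) (X Y : set seqR) :
  measurable X -> measurable Y ->
  (forall w w', (forall i, p i -> w i = w' i) -> X w -> X w') ->
  (forall w w', (forall i, ~~ p i -> w i = w' i) -> Y w -> Y w') ->
  Q (X `&` Y) = (Q X * Q Y)%E.
Proof.
move=> mX mY hX hY.
rewrite (iid_law_splice p (measurableI _ _ mX mY)) -product_measure1E//; congr (_ _).
apply/seteqP; split => -[w w'] /= [h1 h2]; split.
- by apply: hX h1 => i pi; rewrite /splice pi.
- by apply: hY h2 => i pi; rewrite /splice (negbTE pi).
- by apply: hX h1 => i pi; rewrite /splice pi.
- by apply: hY h2 => i pi; rewrite /splice (negbTE pi).
Qed.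

Definition upd (w : nat -> R) (x : nat) (t : R) : nat -> R :=
  fun i => if i == x then t else w i.

Variable M : R.
Hypothesis muM : forall A, measurable A -> (mu A <= M%:E * lebesgue_measure A)%E.
Hypothesis M0 : 0 <= M.

(* Averaging over one coordinate costs at most the sup of the density. *)
Lemma iid_resample_le x (f : seqR -> \bar R) (g : seqR -> \bar R) (C : \bar R) :
  measurable_fun [set: seqR] f -> (forall w, 0 <= f w)%E ->
  measurable_fun [set: seqR] g -> (forall w, 0 <= g w)%E ->
  (forall w, \int[lebesgue_measure]_t f (upd w x t) <= C)%E ->
  (\int[Q]_w \int[Q]_w' (g w * f (splice (predC1 x) w w'))
     <= M%:E * C * \int[Q]_w g w)%E.
Proof.
move=> mf f0 mg g0 fC.
have C0 : (0 <= C)%E by apply: le_trans (fC point); exact: integral_ge0.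
have mupd w : measurable_fun setT (fun t : R => upd w x t : seqR).
  by apply: measurable_fun_seqR => i; rewrite /upd; case: (i == x).
rewrite -(ge0_integralZl Q measurableT mg)//; last by rewrite mule_ge0// lee_fin.
have mmw w : measurable_fun setT (fun w' : seqR => f (splice (predC1 x) w w')).
  apply: (measurableT_comp mf); apply: measurable_fun_seqR => i.
  by rewrite /splice; case: (predC1 x i) => //; exact: measurable_coord.
apply: ge0_le_integral => //.
- by move=> w _; apply: integral_ge0 => w' _; exact: mule_ge0.
- apply: (@measurable_fun_fubini_tonelli_F _ _ _ _ _ _ (fun z : seqR * seqR => (g z.1 * f (splice (predC1 x) z.1 z.2))%E)); last by move=> z; exact: mule_ge0.
  apply: emeasurable_funM.
    exact: (measurableT_comp mg measurable_fst).
  exact: (measurableT_comp mf (measurable_splice _)).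
- exact: measurable_funeM.
move=> w _; rewrite (ge0_integralZl Q measurableT (mmw w))//.
rewrite muleC; apply: lee_wpmul2r => //.
have mc := measurable_coord x.
(* With [w] frozen, only coordinate [x] of [w'] enters, so its one-dimensional law can be replaced
   by [M] times Lebesgue measure. *)
have -> : (\int[Q]_w' f (splice (predC1 x) w w') =
   \int[pushforward Q (fun w : seqR => w x : measurableTypeR R)]_t f (upd w x t))%E.
  rewrite ge0_integral_pushforward//; last exact: measurableT_comp mf (mupd w).
  rewrite preimage_setT; apply: eq_integral => w' _ /=; congr f.
  by apply/funext => i; rewrite /splice /upd /=; case: eqP => // ->.
apply: (@le_trans _ _ (\int[mscale (NngNum M0) lebesgue_measure]_t f (upd w x t))%E).
  apply: ge0_le_measure_integral => //.
    move=> A mA; rewrite /pushforward [X in (X <= _)%E](iid_law_coord x mA).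
    exact: muM.
  exact: measurableT_comp mf (mupd w).
rewrite ge0_integral_mscale//; last exact: measurableT_comp mf (mupd w).
by apply: lee_wpmul2l => //; rewrite lee_fin.
Qed.

End Law.
End Cylinders.

(** * The Poisson kernel; passing from intervals to Borel sets *)

Section PoissonKernel.
Context {R : realType}.
Notation leb := (@lebesgue_measure R).

Lemma pkC (a b t : R) : pk a b t = pk t b a.
Proof. by rewrite /pk -[(t - a)]opprB sqrrN. Qed.

Lemma continuous_pk (a b : R) : 0 < b -> continuous (pk a b).
Proof.
move=> b0 t; rewrite /pk; apply: cvgM; first exact: cvg_cst.
apply: cvgV; first by rewrite gt_eqF// pk_den.
apply: cvgD; last exact: cvg_cst.
apply: (@cvgM _ _ _ _ (fun t => t - a) (fun t => t - a)); apply: cvgB => //; exact: cvg_cst.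
Qed.

Lemma measurable_pk (a b : R) : 0 < b -> measurable_fun setT (pk a b).
Proof. by move=> b0; apply: continuous_measurable_fun; exact: continuous_pk. Qed.

Lemma measurable_pk2 (b : R) : 0 < b ->
  measurable_fun setT (fun z : measurableTypeR R * measurableTypeR R => pk z.2 b z.1).
Proof.
move=> b0; rewrite (_ : (fun z => _) = (pk 0 b) \o (fun z : measurableTypeR R * measurableTypeR R => z.1 - z.2)).
  apply: measurableT_comp; first exact: measurable_pk.
  apply: measurable_funB; [exact: measurable_fst|exact: measurable_snd].
by apply/funext => z /=; rewrite /pk subr0.
Qed.

Lemma integral_pk (a b : R) : 0 < b -> (\int[leb]_t (pk a b t)%:E = pi%:E)%E.
Proof.
move=> b0; have b0' : b != 0 by rewrite gt_eqF.
pose G := fun x : R => (oneDsqr x)^-1.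
have G0 x : 0 <= G x by rewrite invr_ge0.
have cG : continuous G by exact: continuous_oneDsqrV.
have intG : (\int[leb]_t (G t)%:E = pi%:E)%E.
  rewrite ge0_symfun_integralT//; last by move=> x; rewrite /G /oneDsqr /= sqrrN.
  rewrite (_ : [set x | 0 <= x] = `[0, +oo[%classic); last first.
    by apply/seteqP; split => x /=; rewrite in_itv/= andbT.
  by rewrite integral0y_oneDsqr -EFinM mulrC divfK.
pose F := fun x : R => b^-1 * (x - a).
have dF (x : R) : is_derive x 1 F b^-1.
  rewrite /F; apply: is_derive_eq.
  by rewrite subr0 scaler1 ?scale1r ?mulr1 /GRing.scale /= ?mulr1.
have F' : derive1 F = cst b^-1.
  by apply/funext => x; rewrite derive1E; apply: derive_val.
rewrite -intG (@increasing_ge0_integration_by_substitutionT _ F G)//.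
- apply: eq_integral => t _; congr EFin; rewrite F' /= /G /F /pk /oneDsqr /=.
  rewrite -[RHS]/((1 + (b^-1 * (t - a)) ^+ 2)^-1 * b^-1).
  by have h := pk_den a t b0; field; rewrite b0' addrC gt_eqF.
- by move=> x y xy; rewrite /F ltr_pM2l ?invr_gt0// ltrD2r.
- by rewrite F' => x; exact: cst_continuous.
- by rewrite F'; exact: is_cvg_cst.
- by rewrite F'; exact: is_cvg_cst.
- rewrite /F; apply/cvgrNyPle => A; near=> x.
  rewrite mulrC ler_pdivrMr// lerBlDr; near: x; apply: nbhs_ninfty_le; exact: num_real.
- rewrite /F; apply/cvgryPge => A; near=> x.
  rewrite mulrC ler_pdivlMr// lerBrDr; near: x; apply: nbhs_pinfty_ge; exact: num_real.
Unshelve. all: by end_near. Qed.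

(* Domination by Lebesgue measure only has to be checked on closed intervals. *)
Lemma measure_le_lebesgue (nu : {measure set (measurableTypeR R) -> \bar R}) (C : R) :
  0 < C ->
  (forall u v : R, u < v -> (nu `[u, v]%classic <= (C * (v - u))%:E)%E) ->
  forall A, measurable A -> (nu A <= C%:E * leb A)%E.
Proof.
move=> C0 h A mA.
rewrite -lee_pdivrMl//.
apply: le_ereal_inf_tmp => _ [F [mF AF] <-].
rewrite lee_pdivrMl//.
apply: (@le_trans _ _ (\sum_(0 <= k <oo) nu (F k))%E).
  apply: measure_sigma_subadditive => // k.
  exact: sub_sigma_algebra.
rewrite -nneseriesZl//.
apply: lee_nneseries => // k _.
have [[u v] /= _ <-] := mF k.
have [uv|vu] := ltP u v; last first.
  by rewrite set_itv_ge ?measure0 ?wlength0 ?mule0// -leNgt bnd_simp.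
rewrite (wlength_itv_bnd _ _ _ (ltW uv)) /= -EFinM.
apply: le_trans _ (h _ _ uv); apply: le_measure; rewrite ?inE//.
by apply: subset_itv; rewrite bnd_simp.
Qed.

(** A pi-lambda argument for set functions that are only subadditive. The Lebesgue bound, uniform in
    [k], makes the tail of a disjoint union small for all [k] at once, so only finitely many pieces
    have to tend to zero. It serves both the deviation from the limit intensity and the probability
    that two counts differ. *)
Lemma dynkin_vanish (K C : R) (g : nat -> set R -> R) :
  let W := `]- K, K]%classic in
  (forall k A, measurable A -> 0 <= g k A <= C * fine (leb (A `&` W))) ->
  (forall k A, measurable A -> g k (~` A) <= g k A + g k setT) ->
  (forall k A B, measurable A -> measurable B -> A `&` B = set0 ->
     g k (A `|` B) <= g k A + g k B) ->
  (forall X, ocitv X -> g k X @[k --> \oo] --> 0) ->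
  g k setT @[k --> \oo] --> 0 ->
  forall A, measurable A -> g k A @[k --> \oo] --> 0.
Proof.
move=> W gC gN gU gO gT A mA.
have mW : measurable W by exact: measurable_itv.
have fW (B : set R) : measurable B -> leb (B `&` W) \is a fin_num.
  move=> mB; rewrite ge0_fin_numE//; apply: (@le_lt_trans _ _ (leb W)).
    by apply: le_measure; rewrite ?inE; [exact: measurableI mB (measurable_itv _)|exact: measurable_itv|exact: subIsetr].
  by rewrite lebesgue_measure_itv /=; case: ifP => _; rewrite ?ltry// -EFinB ltry.
have g0 k B : measurable B -> 0 <= g k B by move=> mB; have /andP[] := gC k B mB.
have sq B (f : nat -> R) : measurable B -> (forall k, g k B <= f k) ->
    f k @[k --> \oo] --> 0 -> g k B @[k --> \oo] --> 0.
  move=> mB gf f0; apply: (squeeze_cvgr (f := cst 0) (h := f)) => //; last exact: cvg_cst.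
  by near=> k; rewrite g0//= gf.
apply: (@dynkin_induction _ _ (@ocitv R) (fun B => g k B @[k --> \oo] --> 0)) => //.
- exact: ocitvI.
- move=> B mB gB; apply: (sq _ (fun k => g k B + g k setT)) => //.
  + exact: measurableC.
  + by move=> k; exact: gN.
  + by rewrite -[0]addr0; exact: cvgD.
move=> F mF tF gF.
have mU : measurable (\bigcup_k F k) by exact: bigcupT_measurable.
pose T N := \bigcup_(i in [set i | (N <= i)%N]) F i.
have mT N : measurable (T N) by apply: bigcup_measurable.
(* By disjointness the tails decrease to the empty set, and [W] has finite measure. *)
have Tlim : leb (T N `&` W) @[N --> \oo] --> 0%E.
  have : leb (T N `&` W) @[N --> \oo] --> leb (\bigcap_N (T N `&` W)).
    apply: nonincreasing_cvg_mu => //.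
    - by rewrite -ge0_fin_numE//; exact: fW.
    - by move=> N; exact: measurableI (mT N) mW.
    - by apply: bigcapT_measurable => N; exact: measurableI (mT N) mW.
    - move=> m n mn; apply/subsetPset; apply: setSI => x [i /= ni Fi].
      by exists i => //=; exact: leq_trans mn ni.
  rewrite (_ : \bigcap_N _ = set0) ?measure0//.
  apply/seteqP; split => // x h; have [[i _ Fi] _] := h 0%N I.
  have [[j /= ij Fj] _] := h i.+1 I.
  have /trivIsetP/(_ i j I I) := tF; rewrite neq_ltn ij => /(_ isT).
  by move=> /seteqP[/(_ x) h' _]; apply: h'; split.
have key N k : g k (\bigcup_i F i) <= \sum_(i < N) g k (F i) + C * fine (leb (T N `&` W)).
  have /andP[_ hT] := gC k (T N) (mT N).
  apply: le_trans (lerD (lexx _) hT).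
  elim: N {hT} => [|N IH].
    rewrite big_ord0 add0r (_ : T 0%N = \bigcup_i F i)//.
    by apply/seteqP; split => x [i _ Fi]; exists i.
  apply: le_trans IH _; rewrite big_ord_recr /= -addrA lerD2l.
  rewrite (_ : T N = F N `|` T N.+1); last first.
    apply/seteqP; split => x.
      move=> [i /= Ni Fi]; have [iN|iN] := eqVneq i N; first by left; rewrite -iN.
      by right; exists i => //=; rewrite ltn_neqAle eq_sym iN.
    by move=> [Fx|[i /= Ni Fi]]; [exists N => /=|exists i => //=; exact: ltnW].
  apply: gU => //; apply/seteqP; split => // x [FN [j /= Nj Fj]].
  have /trivIsetP/(_ N j I I) := tF; rewrite neq_ltn Nj => /(_ isT).
  by move=> /seteqP[/(_ x) h' _]; apply: h'; split.
apply/cvgrPdist_lt => e e0.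
have C1 : 0 < `|C| + 1 by rewrite ltr_wpDl.
have fTlim : fine (leb (T N `&` W)) @[N --> \oo] --> 0.
  by have /fine_cvgP[] := Tlim.
have [N _ hN] : \forall N \near \oo, fine (leb (T N `&` W)) < e / 2 / (`|C| + 1).
  move/cvgrPdist_lt: fTlim => /(_ _ (divr_gt0 (divr_gt0 e0 (ltr0Sn _ 1)) C1)).
  by apply: filterS => N; rewrite sub0r normrN; apply: le_lt_trans; exact: ler_norm.
have sumlim : \sum_(i < N) g k (F i) @[k --> \oo] --> 0.
  elim: N {hN} => [|N IH]; first by under eq_fun do rewrite big_ord0; exact: cvg_cst.
  under eq_fun do rewrite big_ord_recr /=.
  by have := cvgD IH (gF N); rewrite addr0; exact.
move/cvgrPdist_lt: sumlim => /(_ _ (divr_gt0 e0 (ltr0Sn _ 1))).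
apply: filterS => k; rewrite !sub0r !normrN => hk.
rewrite ger0_norm ?g0//; apply: le_lt_trans (key N k) _.
rewrite [e]splitr; apply: ltr_leD; first exact: le_lt_trans (ler_norm _) hk.
have hh := hN N (leqnn N).
have f0 : 0 <= fine (leb (T N `&` W)) by exact: fine_ge0.
apply: (@le_trans _ _ ((`|C| + 1) * fine (leb (T N `&` W)))).
  by apply: ler_wpM2r => //; rewrite (le_trans (ler_norm _))// lerDl.
by rewrite mulrC -ler_pdivlMr// ltW.
Unshelve. all: by end_near. Qed.

End PoissonKernel.

(** * Measurability of resolvent entries and eigenvalues *)

Section EigenvalueMeasurability.
Context {R : realType}.

(** The inverse is written as [f] times a real power of the nonnegative [f ^+ 2]; where [f] vanishes
    both sides are 0. *)
Lemma measurable_fun_invr d (T : measurableType d) (f : T -> R) :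
  measurable_fun setT f -> measurable_fun setT (fun x => (f x)^-1).
Proof.
move=> mf; rewrite (_ : (fun x => _) = (fun x => f x * (f x ^+ 2) `^ (-1))).
  apply: measurable_funM => //.
  apply: (measurableT_comp (measurable_powR (-1))); exact: measurable_funX.
apply/funext => x; rewrite powR_inv1 ?sqr_ge0//.
have [->|f0] := eqVneq (f x) 0; first by rewrite invr0 mul0r.
by field.
Qed.

Lemma measurable_det d (T : measurableType d) m (F : T -> 'M[R]_m) :
  (forall i j, measurable_fun setT (fun z => F z i j)) ->
  measurable_fun setT (fun z => \det (F z)).
Proof.
move=> mF; rewrite /determinant; apply: measurable_sum => s.
apply: measurable_funM => //; apply: measurable_prod => i _; exact: mF.
Qed.

Section Family.
Variables (N : nat) (A0 : 'M[R]_N).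
Hypothesis A0s : A0^T = A0.

(** The potential is a whole sequence of which [N] entries are read, so that matrices of all sizes
    live on one probability space. *)
Definition Hw (w : nat -> R) : 'M[R]_N := A0 + diag_mx (\row_(i < N) w i).

Lemma Hw_sym w : (Hw w)^T = Hw w.
Proof. by rewrite /Hw linearD /= tr_diag_mx A0s. Qed.

Lemma Hw_upd w (x : 'I_N) t : Hw (upd w x t) = Hw (upd w x 0) + t *: delta_mx x x.
Proof.
apply/matrixP => i j; rewrite !mxE /upd -addrA; congr (_ + _).
have [->|ij] := eqVneq i j; last first.
  by rewrite !mulr0n add0r; have [xi|_] := eqVneq i x; rewrite ?mulr0//= -xi eq_sym (negbTE ij) mulr0.
rewrite !mulr1n; have -> : (j == x :> nat) = (j == x) by [].
by case: eqP => _; rewrite /= ?mulr1 ?mulr0 ?addr0 ?add0r.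
Qed.

Lemma quad_Hw w (x : 'rV_N) : (x *m Hw w *m x^T) 0 0 =
  (x *m A0 *m x^T) 0 0 + \sum_(i < N) w i * x 0 i ^+ 2.
Proof.
rewrite /Hw mulmxDr mulmxDl mxE; congr (_ + _).
rewrite mul_mx_diag mxE; apply: eq_bigr => i _; rewrite !mxE; ring.
Qed.

Lemma measurable_Hw i j : measurable_fun setT (fun w : seqR => Hw w i j).
Proof.
rewrite /Hw; under eq_fun do rewrite !mxE.
apply: measurable_funD => //; case: (i == j); last first.
  by under eq_fun do rewrite mulr0n; exact: measurable_cst.
by under eq_fun do rewrite mulr1n; exact: measurable_coord.
Qed.

Lemma measurable_imG a b x : 0 < b ->
  measurable_fun setT (fun w : seqR => imG (Hw w) a b x).
Proof.
move=> b0.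
have mK i j : measurable_fun setT (fun w : seqR => Kmx (Hw w) a b i j).
  rewrite /Kmx; under eq_fun do rewrite mxE mxE.
  apply: measurable_funD => //; apply: measurable_sum => k.
  have E w i' j' : (Hw w - a%:M) i' j' = Hw w i' j' - a *+ (i' == j') by rewrite !mxE.
  by apply: measurable_funM; under eq_fun do rewrite E; apply: measurable_funB => //; exact: measurable_Hw.
(* Cramer's rule makes the entry a rational function of the potential. *)
rewrite (_ : (fun w => _) = (fun w : seqR => b * ((\det (Kmx (Hw w) a b))^-1 *
    \adj (Kmx (Hw w) a b) x x))); last first.
  by apply/funext => w; rewrite /imG /invmx Kmx_unit ?Hw_sym// mxE.
apply: measurable_funM => //; apply: measurable_funM.
  by apply: measurable_fun_invr; exact: measurable_det.
under eq_fun do rewrite mxE /cofactor.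
apply: measurable_funM; first exact: measurable_cst.
apply: (@measurable_det _ seqR _ (fun w => row' x (col' x (Kmx (Hw w) a b)))) => i j.
by under eq_fun do rewrite mxE mxE; exact: mK.
Qed.

Definition cntb (lam : R) (w : nat -> R) := count (fun t => t < lam) (evs (Hw w)).

End Family.

Lemma count_lt_shift N (M : 'M[R]_N) (eps lam : R) : M^T = M ->
  count (fun t => t < lam) (evs (M + eps%:M)) = count (fun t => t < lam - eps) (evs M).
Proof.
move=> Ms; have [P [d [PP PM]]] := real_spectral Ms.
have Ms' : (M + eps%:M)^T = M + eps%:M by rewrite linearD /= tr_scalar_mx Ms.
have PM' : P *m (M + eps%:M) = diag_mx (\row_i (d 0 i + eps)) *m P.
  rewrite mulmxDr PM scalar_mxC -mulmxDl; congr (_ *m _).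
  by apply/matrixP => i j; rewrite !mxE; case: eqP => [->|]; rewrite ?mulr1n ?mulr0n ?addr0.
rewrite (count_evs_spectral _ Ms PP PM) (count_evs_spectral _ Ms' PP PM').
by apply: eq_card => i; rewrite !finset.inE mxE ltrBrDr.
Qed.

Lemma count_lt_le_shift N (M1 M2 : 'M[R]_N) (eps lam : R) :
  M1^T = M1 -> M2^T = M2 ->
  (forall x : 'rV_N, (x *m M2 *m x^T) 0 0 <= (x *m M1 *m x^T) 0 0 + eps * (x *m x^T) 0 0) ->
  (count (fun t => t < lam - eps)%R (evs M1) <= count (fun t => t < lam)%R (evs M2))%N.
Proof.
move=> s1 s2 h; rewrite -count_lt_shift// -[leqRHS]addn0.
apply: (@count_lt_le _ _ _ _ 1%:M) => //.
- by rewrite linearD /= tr_scalar_mx s1.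
- by rewrite mxrank1 addn0.
move=> x _; rewrite mulmxDr mulmxDl mul_mx_scalar -scalemxAl.
by rewrite [X in _ <= X]mxE [X in _ <= _ + X]mxE.
Qed.

Lemma nth_lt_count (l : seq R) (lam : R) i : sorted <=%R l -> (i < size l)%N ->
  (nth 0 l i < lam) = (i < count (fun t => t < lam)%R l)%N.
Proof.
elim: l i => [|x l IH] i //= xl; have sl := path_sorted xl.
have [xlam|xlam] := ltP x lam; first by case: i => [|i] //= il; rewrite IH.
have all0 : all (>= x) l by apply: order_path_min => //; exact: le_trans.
have -> : count (fun t => t < lam) l = 0%N.
  apply/eqP; rewrite -leqn0 leqNgt -has_count -all_predC; apply/allP => y /(allP all0) /= xy.
  by rewrite -leNgt (le_trans xlam).
case: i => [|i] /= il; first by rewrite ltNge xlam.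
by rewrite ltNge (le_trans xlam)// (allP all0)// mem_nth.
Qed.

(** The strict counting function is left-continuous with integer values, so it is constant just to
    the left of [lam]. This leaves room for rational approximation. *)
Lemma count_lt_left (l : seq R) (lam : R) :
  exists2 eta, 0 < eta & count (fun t => t < lam - eta) l = count (fun t => t < lam) l.
Proof.
elim: l => [|x l [eta e0 IH]]; first by exists 1.
have [xlam|xlam] := ltP x lam.
  exists (Num.min eta ((lam - x) / 2)); first by rewrite lt_min e0 divr_gt0// subr_gt0.
  rewrite /= xlam; congr (_ + _)%N.
    have : Num.min eta ((lam - x) / 2) <= (lam - x) / 2 by rewrite ge_min lexx orbT.
    by move=> h; have -> : x < lam - Num.min eta ((lam - x) / 2) by lra.
  apply/eqP; rewrite eqn_leq; apply/andP; split.
    apply: sub_count => t /= /lt_le_trans; apply; rewrite lerBlDr lerDl le_min ltW//=.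
    lra.
  rewrite -IH; apply: sub_count => t /= /lt_le_trans; apply.
  by rewrite lerD2l lerN2 ge_min lexx.
exists eta => //=; rewrite IH.
have -> : (x < lam - eta) = false by apply/negbTE; rewrite -leNgt; lra.
by rewrite ltNge xlam.
Qed.

Section Measurability.
Variables (N : nat) (A0 : 'M[R]_N).
Hypothesis A0s : A0^T = A0.

Lemma cntb_near lam eps (w q : nat -> R) : (forall i, (i < N)%N -> `|w i - q i| <= eps) ->
  (cntb A0 (lam - eps) q <= cntb A0 lam w)%N.
Proof.
move=> h; apply: count_lt_le_shift; [exact: Hw_sym..|move=> x].
rewrite !quad_Hw -addrA lerD2l [X in _ * X]mxE mulr_sumr -big_split /=.
apply: ler_sum => i _; rewrite mxE -expr2 -mulrDl ler_wpM2r ?sqr_ge0//.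
have := h i (ltn_ord i); rewrite ler_norml => /andP[_]; lra.
Qed.

(** The event is open in the first [N] coordinates, hence a countable union of boxes with rational
    centre and radius. [F] keeps the boxes whose centre satisfies the inequality with a threshold
    lowered by the radius, and by [cntb_near] these lie in the event. *)
Lemma measurable_cntb_gt i lam : measurable [set w : seqR | (i < cntb A0 lam w)%N].
Proof.
pose qf (q : seq rat) : nat -> R := fun x => ratr (nth 0 q x).
pose F (z : seq rat * rat) : set seqR :=
  if (0 < z.2) && (i < cntb A0 (lam - ratr z.2) (qf z.1))%N
  then cyl (iota 0 N) (fun j => [set y | `|y - qf z.1 j| < ratr z.2]) else set0.
rewrite (_ : [set _ | _] = \bigcup_z F z).
  apply: countable_bigcupT_measurable => [|z]; first exact: countableP.
  rewrite /F; case: ifP => // _; apply: measurable_cyl => j.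
  rewrite (_ : [set _ | _] = ball (qf z.1 j) (ratr z.2)); first exact: measurable_ball.
  by apply/seteqP; split => y; rewrite /ball /= distrC.
apply/seteqP; split => w /=.
  move=> iw; have [eta e0 etaE] := count_lt_left (evs (Hw A0 w)) lam.
  (* The radius is below [eta / 2] since the threshold is lowered twice by it: once in [F] and once
     for moving the potential. *)
  have [r] := rat_in_itvoo (divr_gt0 e0 (ltr0n _ 2)); rewrite in_itv /= => /andP[r0 rh].
  have qex j : exists q : rat, `|w j - ratr q| < ratr r :> R.
    have [q] := @rat_in_itvoo R (w j - ratr r) (w j + ratr r) ltac:(lra).
    by rewrite in_itv/= => /andP[q1 q2]; exists q; rewrite ltr_norml; apply/andP; split; lra.
  have [qc qcP] := choice qex.
  exists (mkseq qc N, r) => //; rewrite /F /=.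
  have r0' : 0 < r by rewrite -(ltr_rat R) rmorph0.
  have qfE j : (j < N)%N -> qf (mkseq qc N) j = ratr (qc j) by move=> jN; rewrite /qf nth_mkseq.
  rewrite r0' /=; have -> : (i < cntb A0 (lam - ratr r) (qf (mkseq qc N)))%N.
    apply: leq_trans iw _.
    rewrite /cntb -etaE.
    apply: (@leq_trans (cntb A0 (lam - ratr r - ratr r) w)).
      by apply: sub_count => t /= /lt_le_trans; apply; lra.
    apply: cntb_near => j jN; rewrite qfE// distrC ltW//; exact: qcP.
  by move=> j; rewrite mem_iota add0n /= => jN; rewrite qfE.
move=> [[q r] _]; rewrite /F /=; case: ifP => // /andP[r0 iq] h.
apply: leq_trans iq (cntb_near _ _) => j jN; apply/ltW/h.
by rewrite mem_iota.
Qed.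

Definition ev (i : nat) (w : nat -> R) : R := nth 0 (evs (Hw A0 w)) i.

Lemma measurable_ev i : (i < N)%N -> measurable_fun setT (ev i : seqR -> R).
Proof.
move=> iN; apply: (measurability _ (RGenInftyO.measurableE R)).
move=> _ [_ [x ->] <-]; rewrite setTI.
rewrite (_ : _ @^-1` _ = [set w : seqR | (i < cntb A0 x w)%N]); first exact: measurable_cntb_gt.
apply/seteqP; split => w /=; rewrite in_itv /= /ev nth_lt_count ?size_evs ?Hw_sym//.
  by have [] := evsP (Hw_sym A0s w).
by have [] := evsP (Hw_sym A0s w).
Qed.

Lemma count_ev (p : pred R) w : count p (evs (Hw A0 w)) = (\sum_(i < N) p (ev i w))%N.
Proof.
rewrite -sum1_count (big_nth 0) big_mkcond size_evs ?Hw_sym// big_mkord.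
by apply: eq_bigr => i _; rewrite /ev; case: (p _).
Qed.

Lemma sum_ev (f : R -> R) w : \sum_(t <- evs (Hw A0 w)) f t = \sum_(i < N) f (ev i w).
Proof. by rewrite (big_nth 0) size_evs ?Hw_sym// big_mkord. Qed.

Lemma measurable_count (p : pred R) : measurable [set t | p t] ->
  measurable_fun setT (fun w : seqR => (count p (evs (Hw A0 w)))%:R : R).
Proof.
move=> mp; under eq_fun do rewrite count_ev natr_sum.
apply: measurable_sum => i.
rewrite (_ : (fun w => _) = (\1_[set t | p t] : R -> R) \o (ev i : seqR -> R)).
  apply: measurableT_comp; first exact: measurable_indic.
  exact: measurable_ev.
apply/funext => w /=; rewrite indicE; congr (_%:R); congr nat_of_bool.
by apply/idP/idP; rewrite inE.
Qed.

End Measurability.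
End EigenvalueMeasurability.

(** * Wegner and Minami estimates *)

Section WegnerMinami.
Context {R : realType}.
Variables (mu : set R -> \bar R) (Q : probability (@seqR R) R) (M : R).
Hypotheses (muT : mu setT = 1%E) (HQ : iid_law mu Q) (M0 : 0 <= M).
Hypothesis muM : forall A, measurable A -> (mu A <= M%:E * lebesgue_measure A)%E.
Variables (N : nat) (A0 : 'M[R]_N).
Hypothesis A0s : A0^T = A0.

Lemma integral_imG_upd a b (x : 'I_N) w : 0 < b ->
  (\int[lebesgue_measure]_t (imG (Hw A0 (upd w x t)) a b x)%:E <= pi%:E)%E.
Proof.
move=> b0; have [c1 [c2 [c0 h]]] := imG_rank1 a x (Hw_sym A0s (upd w x 0)) b0.
rewrite -(integral_pk c1 c0); apply: ge0_le_integral => //.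
- by move=> t _; rewrite lee_fin ltW// imG_gt0// Hw_sym.
- apply/measurable_EFinP; under eq_fun do rewrite Hw_upd h; exact: measurable_pk.
- by apply/measurable_EFinP; exact: measurable_pk.
- by move=> t _; rewrite Hw_upd h.
Qed.

Let mimG a b x (b0 : 0 < b) :
  measurable_fun setT (fun w : seqR => (imG (Hw A0 w) a b x)%:E).
Proof. by apply/measurable_EFinP; exact: measurable_imG. Qed.

Let imG0 a b x (b0 : 0 < b) (w : nat -> R) : (0 <= (imG (Hw A0 w) a b x)%:E)%E.
Proof. by rewrite lee_fin ltW// imG_gt0// Hw_sym. Qed.

(** Resample the site [x] alone: its density is at most [M], and the Lebesgue integral over its
    value is at most [pi] whatever the other sites are. *)
Lemma integral_imG a b (x : 'I_N) : 0 < b ->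
  (\int[Q]_w (imG (Hw A0 w) a b x)%:E <= (M * pi)%:E)%E.
Proof.
move=> b0.
rewrite (iid_integral_splice muT HQ (predC1 (x : nat)) (mimG a x b0) (imG0 a x b0)).
have := iid_resample_le HQ muM M0 (mimG a x b0) (imG0 a x b0)
  (@measurable_cst _ _ _ _ setT 1%E) (fun=> lee01) (fun w => integral_imG_upd a x w b0).
have -> : (\int[Q]_w cst 1 w = 1)%E.
  by rewrite integral_cst//= mul1e; exact: probability_setT.
rewrite mule1; apply: le_trans; rewrite le_eqVlt; apply/orP; left; apply/eqP.
by apply: eq_integral => w _; apply: eq_integral => w' _; rewrite /= mul1e.
Qed.

(* The indicator of an interval of half-length [b] is at most [2 b] times the
   Poisson kernel of width [b] at its centre. *)
Lemma count_le_imG u v w : u < v ->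
  (count (fun t => u <= t <= v) (evs (Hw A0 w)))%:R <=
  (v - u) * \sum_(x < N) imG (Hw A0 w) ((u + v) / 2) ((v - u) / 2) x.
Proof.
move=> uv; have b0 : 0 < (v - u) / 2 by rewrite divr_gt0// subr_gt0.
rewrite sum_imG ?Hw_sym// mulr_sumr -sum1_count natr_sum big_mkcond /=.
apply: ler_sum => t _; case: ifP => [/andP[ut tv]|_]; last first.
  by apply: mulr_ge0; [rewrite subr_ge0 ltW|exact: pk_ge0].
rewrite /pk mulrA ler_pdivlMr ?pk_den// mul1r; nra.
Qed.

Lemma wegner u v : u < v ->
  (\int[Q]_w (count (fun t => u <= t <= v) (evs (Hw A0 w)))%:R%:E <=
   (N%:R * ((v - u) * (M * pi)))%:E)%E.
Proof.
move=> uv; have b0 : 0 < (v - u) / 2 by rewrite divr_gt0// subr_gt0.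
have mitv : measurable [set t : R | u <= t <= v].
  rewrite (_ : [set _ | _] = `[u, v]%classic); first exact: measurable_itv.
    by apply/seteqP; split => t /=; rewrite in_itv.
apply: (@le_trans _ _ (\int[Q]_w (\sum_(x < N) ((v - u)%:E *
   (imG (Hw A0 w) ((u + v) / 2) ((v - u) / 2) x)%:E)))%E).
  apply: ge0_le_integral => //.
  - by apply/measurable_EFinP; exact: measurable_count.
  - apply: emeasurable_sum => x; apply: measurable_funeM; exact: mimG.
  - move=> w _; under eq_bigr do rewrite -EFinM.
    by rewrite sumEFin lee_fin -mulr_sumr; exact: count_le_imG.
have vu0 : (0 <= (v - u)%:E)%E by rewrite lee_fin subr_ge0 ltW.
rewrite ge0_integral_sum//.
- apply: (@le_trans _ _ (\sum_(x < N) ((v - u) * (M * pi))%:E)%E).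
    apply: lee_sum => x _; rewrite ge0_integralZl//; [|exact: mimG|by move=> w _; exact: imG0].
    by rewrite EFinM; apply: lee_wpmul2l => //; exact: integral_imG.
  by rewrite sumEFin lee_fin sumr_const card_ord mulr_natl.
- by move=> x; apply: measurable_funeM; exact: mimG.
- by move=> x w _; apply: mule_ge0 => //; exact: imG0.
Qed.

Lemma count_co u v (l : seq R) : u <= v ->
  (count (fun t => u <= t < v)%R l + count (fun t => t < u)%R l = count (fun t => t < v)%R l)%N.
Proof.
move=> uv; elim: l => //= x l IH; rewrite -IH.
have [xu|xu] := ltP x u; first by rewrite (lt_le_trans xu uv) /=; lia.
by rewrite /=; lia.
Qed.

(** The two quadratic forms agree on the hyperplane where coordinate [x] vanishes, and this has
    codimension at most one. *)
Lemma cntb_upd lam (x : 'I_N) s t (w : nat -> R) :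
  (cntb A0 lam (upd w x s) <= cntb A0 lam (upd w x t) + 1)%N.
Proof.
apply: (@count_lt_le _ _ _ _ (kermx (delta_mx x 0 : 'cV_N))); [exact: Hw_sym..| |].
  by rewrite mxrank_ker mxrank_delta; lia.
move=> y /sub_kermxP /matrixP/(_ 0 0) yx.
have y0 : y 0 x = 0 by move: yx; rewrite -colE !mxE.
rewrite !quad_Hw lerD2l; apply: ler_sum => i _.
rewrite /upd; case: eqP => // /val_inj ->.
by rewrite y0 expr0n !mulr0.
Qed.

Lemma cntb_upd_le lam (x : 'I_N) s t (w : nat -> R) : s <= t ->
  (cntb A0 lam (upd w x t) <= cntb A0 lam (upd w x s))%N.
Proof.
move=> st; rewrite -[leqRHS]addn0.
apply: (@count_lt_le _ _ _ _ 1%:M); [exact: Hw_sym..|by rewrite mxrank1 addn0|].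
move=> y _; rewrite !quad_Hw lerD2l; apply: ler_sum => i _.
by rewrite /upd; case: eqP => // _; rewrite ler_wpM2r ?sqr_ge0.
Qed.

(** The counts below [u] and below [v] move by at most one each, and in the same direction; their
    difference thus changes by at most one, not two. *)
Lemma count_upd u v (x : 'I_N) s t (w : nat -> R) : u <= v ->
  (count (fun t => u <= t < v)%R (evs (Hw A0 (upd w x s))) <=
   count (fun t => u <= t < v)%R (evs (Hw A0 (upd w x t))) + 1)%N.
Proof.
move=> uv.
have := count_co (evs (Hw A0 (upd w x s))) uv; have := count_co (evs (Hw A0 (upd w x t))) uv.
rewrite -!/(cntb _ _ _) => h1 h2.
have a1 := cntb_upd v x s t w; have a2 := cntb_upd u x s t w.
have b1 := cntb_upd v x t s w; have b2 := cntb_upd u x t s w.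
have [st|st] := leP s t.
  have c1 := cntb_upd_le v x w st; have c2 := cntb_upd_le u x w st; lia.
have c1 := cntb_upd_le v x w (ltW st); have c2 := cntb_upd_le u x w (ltW st); lia.
Qed.

(* Combes-Germinet-Klein: moving one site changes the count by at most one, so
   that in [c (c - 1)] the factor [c - 1] may be evaluated at an independent value
   of the site being averaged. *)
Lemma minami u v : u < v ->
  (\int[Q]_w ((count (fun t => u <= t < v) (evs (Hw A0 w)))%:R *
      ((count (fun t => u <= t < v) (evs (Hw A0 w)))%:R - 1))%:E <=
   ((N%:R * ((v - u) * (M * pi))) ^+ 2)%:E)%E.
Proof.
move=> uv; have b0 : 0 < (v - u) / 2 by rewrite divr_gt0// subr_gt0.
set a := (u + v) / 2; set b := (v - u) / 2 in b0 *.
pose c (w : nat -> R) := count (fun t => u <= t < v) (evs (Hw A0 w)).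
rewrite -[X in (X <= _)%E]/(\int[Q]_w ((c w)%:R * ((c w)%:R - 1))%:E)%E.
have mitv : measurable [set t : R | u <= t < v].
  rewrite (_ : [set _ | _] = `[u, v[%classic); first exact: measurable_itv.
    by apply/seteqP; split => t /=; rewrite in_itv.
have mcc : measurable [set t : R | u <= t <= v].
  rewrite (_ : [set _ | _] = `[u, v]%classic); first exact: measurable_itv.
  by apply/seteqP; split => t /=; rewrite in_itv.
have mc : measurable_fun setT (fun w : seqR => (c w)%:R : R) by exact: measurable_count.
have mc1 : measurable_fun setT (fun w : seqR => ((c w).-1%:R : R)).
  rewrite (_ : (fun w => _) = (fun w : seqR => Num.max ((c w)%:R - 1) 0)).
    apply: measurable_maxr => //; exact: measurable_funB.
  apply/funext => w; case: (c w) => [|m] /=; first by rewrite sub0r max_r// oppr_le0.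
  by rewrite -natr1 addrK max_l.
have vu0 : (0 <= (v - u)%:E)%E by rewrite lee_fin subr_ge0 ltW.
(* The truncated predecessor keeps the integrand nonnegative; it differs from c - 1 only at c = 0,
   where the product c (c - 1) vanishes anyway. *)
pose f x (w : nat -> R) : \bar R := ((imG (Hw A0 w) a b x)%:E * ((c w).-1%:R)%:E)%E.
have mf x : measurable_fun setT (f x : seqR -> \bar R).
  by apply: emeasurable_funM; [exact: mimG|exact/measurable_EFinP].
have f0 x w : (0 <= f x w)%E by rewrite mule_ge0 ?imG0.
have Ec : (\int[Q]_w (c w)%:R%:E <= (N%:R * ((v - u) * (M * pi)))%:E)%E.
  apply: le_trans (wegner uv); apply: ge0_le_integral => //.
  - exact/measurable_EFinP.
  - by apply/measurable_EFinP; exact: (measurable_count A0s mcc).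
  - move=> w _; rewrite lee_fin ler_nat; apply: sub_count => t /= /andP[-> /ltW ->]//.
apply: (@le_trans _ _ (\int[Q]_w (\sum_(x < N) ((v - u)%:E * f x w)))%E).
  apply: ge0_le_integral => //.
  - move=> w _; rewrite lee_fin; case: (c w) => [|m]; first by rewrite mul0r.
    by rewrite -natr1 addrK mulr_ge0.
  - apply/measurable_EFinP/measurable_funM => //; exact: measurable_funB.
  - by apply: emeasurable_sum => x; apply: measurable_funeM; exact: mf.
  move=> w _; under eq_bigr do rewrite /f -!EFinM mulrA.
  rewrite sumEFin lee_fin -mulr_suml -mulr_sumr.
  have [c0|c0] := posnP (c w); first by rewrite c0 mul0r mulr0.
  have -> : (c w)%:R - 1 = (c w).-1%:R :> R by rewrite -[in LHS](prednK c0) -natr1 addrK.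
  apply: ler_wpM2r => //; apply: le_trans (count_le_imG w uv).
  by rewrite ler_nat; apply: sub_count => t /= /andP[-> /ltW ->].
rewrite ge0_integral_sum//; last 2 first.
- by move=> x; apply: measurable_funeM; exact: mf.
- by move=> x w _; apply: mule_ge0.
apply: (@le_trans _ _ (\sum_(x < N) ((v - u) * (M * pi) * (N%:R * ((v - u) * (M * pi))))%:E)%E); last first.
  rewrite sumEFin lee_fin sumr_const card_ord -[leLHS]mulr_natl le_eqVlt; apply/orP; left; apply/eqP; ring.
apply: lee_sum => x _; rewrite (ge0_integralZl Q measurableT (mf x))//.
rewrite -mulrA EFinM; apply: lee_wpmul2l => //.
(* Site [x] takes its value from the independent copy [w']. The predecessor of the count is then at
   most [c w], which does not see [w'], and the two averages decouple. *)
rewrite (iid_integral_splice muT HQ (predC1 (x : nat)) (mf x) (f0 x)).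
have mcE : measurable_fun setT (fun w : seqR => ((c w)%:R)%:E : \bar R) by exact/measurable_EFinP.
have := iid_resample_le HQ muM M0 (mimG a x b0) (imG0 a x b0) mcE
  (fun w => (ltac:(by rewrite lee_fin) : (0 <= ((c w)%:R)%:E)%E))
  (fun w => integral_imG_upd a x w b0).
move=> h; apply: (@le_trans _ _ ((M * pi)%:E * \int[Q]_w ((c w)%:R)%:E)%E); last first.
  by rewrite [leRHS]EFinM; apply: lee_wpmul2l => //; rewrite lee_fin mulr_ge0// pi_ge0.
rewrite EFinM; apply: le_trans h; apply: ge0_le_integral => //.
- by move=> w _; apply: integral_ge0.
- apply: (@measurable_fun_fubini_tonelli_F _ _ _ _ _ _ (fun z : seqR * seqR => f x (splice (predC1 (x : nat)) z.1 z.2))) => //.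
  exact: (measurableT_comp (mf x) (measurable_splice _)).
- apply: (@measurable_fun_fubini_tonelli_F _ _ _ _ _ _ (fun z : seqR * seqR => ((c z.1)%:R%:E * (imG (Hw A0 (splice (predC1 (x : nat)) z.1 z.2)) a b x)%:E)%E)).
    apply: emeasurable_funM; first exact: (measurableT_comp mcE measurable_fst).
    exact: (measurableT_comp (mimG a x b0) (measurable_splice _)).
  by move=> z; rewrite mule_ge0 ?imG0.
move=> w _.
have mw : measurable_fun setT (fun w' : seqR => splice (predC1 (x : nat)) w w' : seqR).
  by apply: measurable_fun_seqR => i; rewrite /splice; case: (predC1 _ i) => //; exact: measurable_coord.
apply: ge0_le_integral => //.
- exact: (measurableT_comp (mf x) mw).
- apply: measurable_funeM; exact: (measurableT_comp (mimG a x b0) mw).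
move=> w' _; rewrite /f muleC; apply: lee_wpmul2r; first exact: imG0.
rewrite lee_fin ler_nat.
have wE : w = upd w x (w x) by apply/funext => i; rewrite /upd; case: eqP => // ->.
have mE : splice (predC1 (x : nat)) w w' = upd w x (w' x).
  by apply/funext => i; rewrite /splice /upd /=; case: eqP => // ->.
have := count_upd x (w' x) (w x) w (ltW uv); rewrite -wE -mE -!/(c _).
by case: (c (splice _ _ _)) => // m; rewrite addn1 ltnS.
Qed.

End WegnerMinami.

(** * From Poisson transforms to the limit of measures *)

Section IntensityLimit.
Context {R : realType}.
Notation leb := (@lebesgue_measure R).

(** At distance at least [s] from the centre a narrow kernel is a small multiple of the kernel of
    width 1, which is still integrable in the centre; this controls the tails. *)
Lemma pk_far (al b t s : R) : 0 < s -> 0 < b -> s <= `|t - al| ->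
  pk al b t <= (1 + (s ^+ 2)^-1) * b * pk al 1 t.
Proof.
move=> s0 b0 h.
have s2 : s ^+ 2 <= (t - al) ^+ 2.
  by rewrite -[leRHS]real_normK ?num_real// ler_pXn2r ?nnegrE// ltW.
have s2p : 0 < s ^+ 2 by rewrite exprn_gt0.
rewrite /pk ler_pdivrMr ?pk_den// mulrA mulr1 mulrAC ler_pdivlMr ?pk_den//.
rewrite [_ * b]mulrC -mulrA ler_pM2l// expr1n mulrDl mul1r.
have h1 : 1 <= (s ^+ 2)^-1 * (t - al) ^+ 2 by rewrite mulrC ler_pdivlMr// mul1r.
have h2 : 0 <= (s ^+ 2)^-1 * b ^+ 2 by apply: mulr_ge0; rewrite ?invr_ge0 sqr_ge0.
have h3 := sqr_ge0 b; rewrite mulrDr; lra.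
Qed.

(** In [interval_limit], [th] is both the distance by which an interval of length [l] is widened or
    shrunk at each end and the fraction of kernel mass lost in the tails; the two inequalities say
    that these errors together stay below [e]. *)
Lemma theta_gaps (c l e : R) : 0 <= c -> 0 < l -> 0 < e ->
  exists th, [/\ 0 < th, th <= l / 4, th <= 1 / 2,
    c * (l + 2 * th) < (1 - th) * (c * l + e) &
    c * l - e < (1 - th) * (c * (l - 2 * th))].
Proof.
move=> c0 l0 e0.
pose D := 2 * c + c * l + e.
have cl0 : 0 <= c * l by rewrite mulr_ge0// ltW.
have D0 : 0 < D by rewrite /D; lra.
pose th := Num.min (e / (2 * D)) (Num.min (l / 4) (1 / 2)).
have th0 : 0 < th by rewrite /th !lt_min !divr_gt0// ?mulr_gt0.
have thD : th * D < e.
  apply: (@le_lt_trans _ _ (e / (2 * D) * D)).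
    by rewrite ler_pM2r// ge_min lexx.
  rewrite (_ : e / (2 * D) * D = e / 2); first lra.
  by field; rewrite gt_eqF.
have thl : th <= l / 4 by rewrite /th !ge_min lexx ?orbT.
have thh : th <= 1 / 2 by rewrite /th !ge_min lexx ?orbT.
have cth : 0 <= c * th ^+ 2 by rewrite mulr_ge0 ?sqr_ge0.
by move: thD; rewrite /D => thD; exists th; split => //; nra.
Qed.

Lemma sandwich_arith (P c l e th LU LB L1 xc xo xm : R) : 0 < P -> th <= 1 / 2 ->
  P * (1 - th) * xc <= LU -> LB <= P * xo + th * L1 ->
  - (P * ((1 - th) * (c * l + e) - c * (l + 2 * th))) < P * c * (l + 2 * th) - LU ->
  P * c * (l - 2 * th) - th * (P * c * (l - 2 * th)) - (LB - th * L1) <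
    P * ((1 - th) * (c * (l - 2 * th)) - (c * l - e)) ->
  xo <= xm -> xm <= xc -> `|c * l - xm| < e.
Proof.
move=> P0 thh iU iL hU hL s1 s2.
have up : P * ((1 - th) * xc) < P * ((1 - th) * (c * l + e)) by rewrite mulrA; lra.
have {}up : xc < c * l + e by move: up; rewrite ltr_pM2l// ltr_pM2l//; lra.
have lo : P * (c * l - e) < P * xo by lra.
have {}lo : c * l - e < xo by move: lo; rewrite ltr_pM2l.
by rewrite ltr_norml; apply/andP; split; lra.
Qed.

Lemma scale_measure_indic (m : {measure set (measurableTypeR R) -> \bar R}) (x : R) A :
  0 <= x -> measurable A -> (x%:E * m A = \int[m]_t (x * \1_A t)%:E)%E.
Proof.
move=> x0 mA; under eq_integral do rewrite EFinM.
rewrite ge0_integralZl_EFin//; first by rewrite integral_indic// setIT.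
by apply/measurable_EFinP; exact: measurable_indic.
Qed.

Variables (nu : nat -> {finite_measure set (measurableTypeR R) -> \bar R}) (c C : R).
Hypotheses (c0 : 0 <= c) (C0 : 0 < C).
Hypothesis dom : forall k A, measurable A -> (nu k A <= C%:E * leb A)%E.
Hypothesis lim_pk : forall a b, 0 < b ->
  (fun k => \int[nu k]_t (pk a b t)%:E)%E @ \oo --> (pi * c)%:E.

(** Integrated over the centre in [u, v], the kernel gives [pkF], a smoothed version of [pi] times
    the indicator of [u, v]; [pkL] is its integral against the k-th measure. *)
Definition pkf (u v b : R) (z : measurableTypeR R * measurableTypeR R) : \bar R :=
  (\1_`[u, v]%classic z.2 * pk z.2 b z.1)%:E.
Definition pkF u v b (t : measurableTypeR R) : \bar R := (\int[leb]_al pkf u v b (t, al))%E.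
Definition pkL k u v b : \bar R := (\int[nu k]_t pkF u v b t)%E.

Lemma pkf_ge0 u v b z : 0 < b -> (0 <= pkf u v b z)%E.
Proof. by move=> b0; rewrite lee_fin mulr_ge0// ?pk_ge0// indicE. Qed.

Lemma measurable_pkf u v b : 0 < b -> measurable_fun setT (pkf u v b).
Proof.
move=> b0; apply/measurable_EFinP; apply: measurable_funM; last exact: measurable_pk2.
apply: (measurableT_comp _ measurable_snd); exact: measurable_indic.
Qed.

Lemma measurable_pkF u v b : 0 < b -> measurable_fun setT (pkF u v b).
Proof.
move=> b0; apply: (measurable_fun_fubini_tonelli_F _ (measurable_pkf u v b0)).
by move=> z; exact: pkf_ge0.
Qed.

Lemma pkF_ge0 u v b t : 0 < b -> (0 <= pkF u v b t)%E.
Proof. by move=> b0; apply: integral_ge0 => al _; exact: pkf_ge0. Qed.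

Lemma measurable_pkf1 u v b t : 0 < b -> measurable_fun setT (fun al => pkf u v b (t, al)).
Proof. by move=> b0; exact: measurable_fun_pair2 (measurable_pkf u v b0). Qed.

Lemma measurable_pkE b t : 0 < b -> measurable_fun setT (fun al : measurableTypeR R => (pk al b t)%:E).
Proof.
move=> b0; apply/measurable_EFinP; under eq_fun do rewrite pkC; exact: measurable_pk.
Qed.

Lemma integral_pkC b t : 0 < b -> (\int[leb]_al (pk al b t)%:E = pi%:E)%E.
Proof. by move=> b0; under eq_integral do rewrite pkC; exact: integral_pk. Qed.

(** After Tonelli the centre is the outer variable: the inner integrals converge by [lim_pk] and are
    at most [C * pi] by [dom], so that dominated convergence applies on [u, v]. *)
Lemma pkL_lim (u v b : R) : u <= v -> 0 < b ->
  pkL k u v b @[k --> \oo] --> (pi * c * (v - u))%:E.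
Proof.
move=> uv b0.
pose J k al := (\int[nu k]_t (pk al b t)%:E)%E.
have mI : measurable `[u, v]%classic by exact: measurable_itv.
have J0 k al : (0 <= J k al)%E by apply: integral_ge0 => t _; rewrite lee_fin pk_ge0.
have mJ k : measurable_fun setT (J k).
  apply: (@measurable_fun_fubini_tonelli_G _ _ _ _ _ (nu k) (fun z : measurableTypeR R * measurableTypeR R => (pk z.2 b z.1)%:E)).
    by apply/measurable_EFinP; exact: measurable_pk2.
  by move=> z; rewrite lee_fin pk_ge0.
have LE k : pkL k u v b = (\int[leb]_(al in `[u, v]) J k al)%E.
  rewrite /pkL; transitivity (\int[nu k \x leb]_z pkf u v b z)%E.
    rewrite fubini_tonelli1//; first exact: measurable_pkf.
    by move=> z; exact: pkf_ge0.
  rewrite fubini_tonelli2; [|exact: measurable_pkf|by move=> z; exact: pkf_ge0].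
  rewrite [RHS]integral_mkcond; apply: eq_integral => al _.
  rewrite /fubini_G /pkf /patch /= indicE; case: ifPn => alI.
    by apply: eq_integral => t _ /=; rewrite mul1r.
  by under eq_integral do rewrite mul0r; rewrite integral0.
have JC k al : (J k al <= (C * pi)%:E)%E.
  apply: (@le_trans _ _ (\int[mscale (NngNum (ltW C0)) leb]_t (pk al b t)%:E)%E).
    apply: ge0_le_measure_integral => //.
    - by move=> A mA; exact: dom.
    - by move=> t; rewrite lee_fin pk_ge0.
    - by apply/measurable_EFinP; exact: measurable_pk.
  rewrite ge0_integral_mscale//; last 2 first.
  - by apply/measurable_EFinP; exact: measurable_pk.
  - by move=> t _; rewrite lee_fin pk_ge0.
  by rewrite integral_pk// -EFinM.
have lI : leb `[u, v]%classic = (v - u)%:E.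
  rewrite lebesgue_measure_itv /= lte_fin; case: ltP => // vu.
  by have -> : u = v; [apply/eqP; rewrite eq_le uv vu|rewrite subrr].
have ae1 : \forall x \ae leb, `[u, v]%classic x -> J k x @[k --> \oo] --> (pi * c)%:E.
  by apply: aeW => al _; exact: lim_pk.
have ig : leb.-integrable `[u, v]%classic (fun=> (C * pi)%:E).
  apply/integrableP; split; first exact: measurable_cst.
  under eq_integral do rewrite abse_EFin.
  by rewrite integral_cst//= lI -EFinM ltry.
have ae2 : \forall x \ae leb, forall k, `[u, v]%classic x -> (`|J k x| <= (C * pi)%:E)%E.
  by apply: aeW => al k _; rewrite gee0_abs.
have [_ _] := @dominated_convergence _ _ _ leb `[u, v]%classic mI J
   (fun=> (pi * c)%:E) (fun=> (C * pi)%:E)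
   (fun k => measurable_funTS (mJ k)) (measurable_cst _) ae1 ig ae2.
have -> : (\int[leb]_(x in `[u, v]) (pi * c)%:E = (pi * c * (v - u))%:E)%E.
  by rewrite integral_cst//= lI.
by under [X in _ -> X @ _ --> _]eq_fun do rewrite LE.
Qed.

(** For t in [u, v], the centres outside the interval widened by [s] carry at most the fraction (1 +
    s^-2) b of the mass [pi]. *)
Lemma pk_upper k u v s b : 0 < s -> 0 < b ->
  (1 + (s ^+ 2)^-1) * b <= 1 ->
  ((pi * (1 - (1 + (s ^+ 2)^-1) * b))%:E * nu k `[u, v]%classic <= pkL k (u - s) (v + s) b)%E.
Proof.
move=> s0 b0 kb; set ka := (1 + (s ^+ 2)^-1) * b in kb *.
have mI : measurable `[u, v]%classic by exact: measurable_itv.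
have ka0 : 0 <= ka by rewrite mulr_ge0 ?(ltW b0)// addr_ge0// invr_ge0 sqr_ge0.
have p0 : 0 <= pi * (1 - ka) by rewrite mulr_ge0 ?pi_ge0// subr_ge0.
rewrite (scale_measure_indic (nu k) p0 mI); apply: ge0_le_integral => //.
- by move=> t _; rewrite lee_fin mulr_ge0// indicE.
- apply/measurable_EFinP; apply: measurable_funM => //; exact: measurable_indic.
- exact: measurable_pkF.
move=> t _; rewrite indicE; case: (boolP (t \in _)); last first.
  by rewrite mulr0 => _; exact: pkF_ge0.
rewrite inE /= in_itv /= => /andP[ut tv]; rewrite mulr1 mulrBr mulr1 EFinB leeBlDr//.
rewrite -{1}(integral_pkC t b0).
apply: (@le_trans _ _ (\int[leb]_al (pkf (u - s) (v + s) b (t, al) + ka%:E * (pk al 1 t)%:E))%E).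
  apply: ge0_le_integral => //.
  - by move=> al _; rewrite lee_fin pk_ge0.
  - exact: measurable_pkE.
  - apply: emeasurable_funD; first exact: measurable_pkf1.
    by apply: measurable_funeM; exact: measurable_pkE.
  move=> al _; rewrite /pkf -EFinM -EFinD lee_fin /= indicE.
  have [alI|alI] := boolP (al \in _); first by rewrite mul1r lerDl mulr_ge0// pk_ge0.
  rewrite mul0r add0r; apply: pk_far => //.
  move: alI; rewrite notin_setE /= in_itv /= => /negP; rewrite negb_and -!ltNge => /orP[h|h].
    by apply: le_trans (ler_norm _); lra.
  by rewrite distrC; apply: le_trans (ler_norm _); lra.
rewrite ge0_integralD//; last 4 first.
- by move=> al _; exact: pkf_ge0.
- exact: measurable_pkf1.
- by move=> al _; rewrite -EFinM lee_fin mulr_ge0// pk_ge0.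
- by apply: measurable_funeM; exact: measurable_pkE.
rewrite ge0_integralZl_EFin//; [|by move=> al _; rewrite lee_fin pk_ge0|exact: measurable_pkE].
by rewrite integral_pkC// -EFinM [pi * _]mulrC.
Qed.

(** Outside ]u, v[ the smoothed indicator of the shrunken interval is a small multiple of its
    version of width 1. The error term is stated with width 1 because its integral has a finite
    limit. *)
Lemma pk_lower k u v s b : 0 < s -> 0 < b ->
  (pkL k (u + s) (v - s) b <= pi%:E * nu k `]u, v[%classic +
     ((1 + (s ^+ 2)^-1) * b)%:E * pkL k (u + s) (v - s) 1)%E.
Proof.
move=> s0 b0; set ka := (1 + (s ^+ 2)^-1) * b.
have mI : measurable `]u, v[%classic by exact: measurable_itv.
have ka0 : 0 <= ka by rewrite mulr_ge0 ?(ltW b0)// addr_ge0// invr_ge0 sqr_ge0.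
rewrite (scale_measure_indic (nu k) (pi_ge0 R) mI).
have -> : (ka%:E * pkL k (u + s) (v - s) 1 = \int[nu k]_t (ka%:E * pkF (u + s) (v - s) 1 t))%E.
  by rewrite (ge0_integralZl_EFin (nu k) measurableT (fun t _ => pkF_ge0 _ _ t ltr01) (measurable_pkF _ _ ltr01)).
have mi : measurable_fun setT (fun t : measurableTypeR R => (pi * \1_`]u, v[%classic t : R)%:E).
  apply/measurable_EFinP; apply: measurable_funM => //; exact: measurable_indic.
have mF1 : measurable_fun setT (fun t : measurableTypeR R => (ka%:E * pkF (u + s) (v - s) 1 t)%E).
  by apply: measurable_funeM; exact: measurable_pkF.
have i0 t : (0 <= (pi * \1_`]u, v[%classic t)%:E :> \bar R)%E.
  by rewrite lee_fin mulr_ge0// ?pi_ge0// indicE.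
have F10 t : (0 <= ka%:E * pkF (u + s) (v - s) 1 t)%E by rewrite mule_ge0// pkF_ge0.
rewrite -ge0_integralD//.
apply: ge0_le_integral => //.
- by move=> t _; exact: pkF_ge0.
- exact: measurable_pkF.
- exact: emeasurable_funD.
move=> t _; rewrite indicE; have [tI|tI] := boolP (t \in _).
  rewrite mulr1; apply: (@le_trans _ _ pi%:E); last by rewrite leeDl// mule_ge0// pkF_ge0.
  rewrite -(integral_pkC t b0); apply: ge0_le_integral => //.
  - by move=> al _; exact: pkf_ge0.
  - exact: measurable_pkf1.
  - exact: measurable_pkE.
  - by move=> al _; rewrite lee_fin indicE; case: (al \in _); rewrite ?mul1r// mul0r pk_ge0.
rewrite mulr0 add0e /pkF -ge0_integralZl_EFin//; last 2 first.
- by move=> al _; exact: pkf_ge0.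
- exact: measurable_pkf1.
apply: ge0_le_integral => //.
- by move=> al _; exact: pkf_ge0.
- exact: measurable_pkf1.
- by apply: measurable_funeM; exact: measurable_pkf1.
move=> al _; rewrite /pkf /= indicE -EFinM lee_fin; have [alI|] := boolP (al \in _); last first.
  by rewrite !mul0r mulr0.
rewrite !mul1r; apply: pk_far => //.
move: alI tI; rewrite inE notin_setE /= !in_itv /= => /andP[h1 h2] /negP.
rewrite negb_and -!leNgt => /orP[h|h].
  by rewrite distrC; apply: le_trans (ler_norm _); lra.
by apply: le_trans (ler_norm _); lra.
Qed.

Opaque pkL pkF.

Lemma pkL_real (u v b : R) : u <= v -> 0 < b ->
  (\forall k \near \oo, pkL k u v b \is a fin_num) /\
  fine (pkL k u v b) @[k --> \oo] --> pi * c * (v - u).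
Proof. by move=> uv b0; have /fine_cvgP[] := pkL_lim uv b0. Qed.

Lemma interval_limit (u v : R) : u < v ->
  fine (nu k `]u, v]%classic) @[k --> \oo] --> c * (v - u).
Proof.
move=> uv.
suff main (e : R) : 0 < e ->
    \forall k \near \oo, `|c * (v - u) - fine (nu k `]u, v]%classic)| < e.
  by apply/cvgrPdist_lt => e; exact: main.
move=> e0.
have l0 : 0 < v - u by rewrite subr_gt0.
have [th [th0 thl thh gU gL]] := theta_gaps c0 l0 e0.
have th1 : th <= 1 by lra.
pose kap := 1 + (th ^+ 2)^-1.
have kap0 : 0 < kap by rewrite /kap ltr_pwDl// invr_ge0 sqr_ge0.
(* This width makes the tail fraction of [pk_upper] and [pk_lower] equal to [th]. *)
pose b := th / kap.
have b0 : 0 < b by rewrite divr_gt0.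
have kb : kap * b = th by rewrite /b mulrC divfK// gt_eqF.
have p0 : 0 < pi :> R := pi_gt0 R.
have ou : u - th <= v + th by lra.
have ol : u + th <= v - th by lra.
have [finU limU] := pkL_real ou b0.
have [finL limL] := pkL_real ol b0.
have [finL1 limL1] := pkL_real ol (@ltr01 R).
have gapU : 0 < pi * ((1 - th) * (c * (v - u) + e) - c * (v - u + 2 * th)).
  by rewrite mulr_gt0// subr_gt0.
have gapL : 0 < pi * ((1 - th) * (c * (v - u - 2 * th)) - (c * (v - u) - e)).
  by rewrite mulr_gt0// subr_gt0.
have limL2 : fine (pkL k (u + th) (v - th) b) - th * fine (pkL k (u + th) (v - th) 1)
   @[k --> \oo] --> pi * c * (v - th - (u + th)) - th * (pi * c * (v - th - (u + th))).
  exact: (cvgB limL (cvgM (cvg_cst th) limL1)).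
have fnu k A : measurable A -> nu k A \is a fin_num by move=> mA; exact: fin_num_measure.
move/cvgrPdist_lt : limU => /(_ _ gapU) nU.
move/cvgrPdist_lt : limL2 => /(_ _ gapL) nL.
move: finU finL finL1 nU nL => [K1 _ FU] [K2 _ FL] [K3 _ FL1] [K4 _ NU] [K5 _ NL].
exists (maxn K1 (maxn K2 (maxn K3 (maxn K4 K5)))) => // k /=.
rewrite !geq_max => /and5P[k1 k2 k3 k4 k5].
have fU := FU k k1; have fL := FL k k2; have fL1 := FL1 k k3.
have hU := NU k k4; have hL := NL k k5; rewrite /= in fU fL fL1 hU hL.
have mcc : measurable `[u, v]%classic by exact: measurable_itv.
have moo : measurable `]u, v[%classic by exact: measurable_itv.
have moc : measurable `]u, v]%classic by exact: measurable_itv.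
have := pk_upper k u v th0 b0; rewrite -/kap kb => /(_ th1).
rewrite -(fineK (fnu k _ mcc)) -(fineK fU) -EFinM lee_fin => iU.
have := pk_lower k u v th0 b0; rewrite -/kap kb.
rewrite -(fineK (fnu k _ moo)) -(fineK fL) -(fineK fL1) -!EFinM -EFinD lee_fin => iL.
have s1 : fine (nu k `]u, v[%classic) <= fine (nu k `]u, v]%classic).
  apply: fine_le; rewrite ?fnu//; apply: le_measure; rewrite ?inE//.
  by apply: subset_itv; rewrite bnd_simp.
have s2 : fine (nu k `]u, v]%classic) <= fine (nu k `[u, v]%classic).
  apply: fine_le; rewrite ?fnu//; apply: le_measure; rewrite ?inE//.
  by apply: subset_itv; rewrite bnd_simp.
rewrite ltr_norml in hU; rewrite ltr_norml in hL.
move/andP: hU => [hU _]; move/andP: hL => [_ hL].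
have wU : v + th - (u - th) = v - u + 2 * th by ring.
have wL : v - th - (u + th) = v - u - 2 * th by ring.
rewrite wU in hU; rewrite wL in hL.
exact: (sandwich_arith p0 thh iU iL hU hL s1 s2).
Qed.

Transparent pkL pkF.

Lemma intensity_limit (A : set R) (K : R) : measurable A -> 0 < K ->
  A `<=` `]- K, K]%classic ->
  fine (nu k A) @[k --> \oo] --> c * fine (leb A).
Proof.
move=> mA K0 AK; set W := `]- K, K]%classic.
have mW : measurable W by exact: measurable_itv.
have fW (B : set R) : measurable B -> leb (B `&` W) \is a fin_num.
  move=> mB; rewrite ge0_fin_numE//; apply: (@le_lt_trans _ _ (leb W)).
    by apply: le_measure; rewrite ?inE; [exact: measurableI mB mW|exact: mW|exact: subIsetr].
  by rewrite lebesgue_measure_itv /=; case: ifP => _; rewrite ?ltry// -EFinB ltry.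
have fnu k (B : set R) : measurable B -> nu k (B `&` W) \is a fin_num.
  by move=> mB; apply: fin_num_measure; exact: measurableI mB mW.
pose g k B := `|fine (nu k (B `&` W)) - c * fine (leb (B `&` W))|.
have addn k (B B' : set R) : measurable B -> measurable B' -> B `&` B' = set0 ->
  fine (nu k ((B `|` B') `&` W)) = fine (nu k (B `&` W)) + fine (nu k (B' `&` W)) /\
  fine (leb ((B `|` B') `&` W)) = fine (leb (B `&` W)) + fine (leb (B' `&` W)).
  move=> mB mB' BB'; rewrite setIUl.
  have d : (B `&` W) `&` (B' `&` W) = set0 by rewrite setIACA BB' set0I.
  split.
    rewrite measureU ?fineD ?fnu//; [exact: measurableI mB mW|exact: measurableI mB' mW].
  rewrite measureU ?fineD ?fW//; [exact: measurableI mB mW|exact: measurableI mB' mW].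
have ocl X : ocitv X -> fine (nu k X) - c * fine (leb X) @[k --> \oo] --> 0.
  move=> [[a b] _ <-] /=; have [ab|ba] := ltP a b; last first.
    rewrite set_itv_ge ?bnd_simp -?leNgt//.
    under eq_fun do rewrite !measure0 mulr0 subr0; exact: cvg_cst.
  rewrite lebesgue_measure_itv /= lte_fin ab -EFinB /=.
  rewrite -(subrr (c * (b - a))); apply: cvgB; [exact: interval_limit|exact: cvg_cst].
have := @dynkin_vanish R K (C + c) g.
have g0 : (forall X, measurable X -> g k X @[k --> \oo] --> 0) -> fine (nu k A) @[k --> \oo] --> c * fine (leb A).
  move=> /(_ A mA) h.
  have AW : A `&` W = A by apply: setIidl.
  move: h; rewrite /g AW => /norm_cvg0P h.
  rewrite (_ : (fun k => fine (nu k A)) = (fun k => (fine (nu k A) - c * fine (leb A)) + c * fine (leb A))).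
    by rewrite -[X in _ --> X]add0r; apply: cvgD; [exact: h|exact: cvg_cst].
  by apply/funext => k; rewrite subrK.
move=> dv; apply: g0; apply: dv.
- move=> k B mB; rewrite normr_ge0 /=.
  have n0 : 0 <= fine (nu k (B `&` W)) by exact: fine_ge0.
  have l0 : 0 <= fine (leb (B `&` W)) by exact: fine_ge0.
  have dd : fine (nu k (B `&` W)) <= C * fine (leb (B `&` W)).
    rewrite -lee_fin EFinM !fineK ?fW ?fnu//; apply: dom; exact: measurableI mB mW.
  have cl : 0 <= c * fine (leb (B `&` W)) by rewrite mulr_ge0.
  by rewrite ler_norml mulrDl; apply/andP; split; lra.
- move=> k B mB; have mB' := measurableC mB.
  have [e1 e2] := addn k _ _ mB mB' (setICr B).
  rewrite /g; move: e1 e2; rewrite setUCr => -> ->.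
  set x := fine (nu k (B `&` W)); set y := fine (nu k (~` B `&` W)).
  set x' := fine (leb (B `&` W)); set y' := fine (leb (~` B `&` W)).
  have -> : y - c * y' = (x + y - c * (x' + y')) - (x - c * x') by ring.
  by rewrite [leRHS]addrC; exact: ler_normB.
- move=> k B B' mB mB' BB'; have [e1 e2] := addn k _ _ mB mB' BB'.
  rewrite /g e1 e2 mulrDr opprD addrACA; exact: ler_normD.
- move=> X oX; apply/norm_cvg0P; apply: ocl; apply: ocitvI => //; by exists (- K, K).
- by apply/norm_cvg0P; apply: ocl; rewrite setTI; exists (- K, K).
Qed.

End IntensityLimit.

(** * The Poisson limit of multinomial probabilities *)

Section PoissonCalculus.
Context {R : realType}.

Lemma cvg_near_eq (f g : nat -> R) (l : R) : g k @[k --> \oo] --> l ->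
  (\forall k \near \oo, g k = f k) -> f k @[k --> \oo] --> l.
Proof. by move=> gl gf; apply: cvg_trans gl; exact: near_eq_cvg. Qed.

Lemma bernoulli_le (z : R) L : 0 <= z <= 1 -> 1 - L%:R * z <= (1 - z) ^+ L.
Proof.
move=> /andP[z0 z1]; elim: L => [|L IH]; first by rewrite mul0r subr0 expr0.
rewrite exprS; apply: (@le_trans _ _ ((1 - z) * (1 - L%:R * z))); last first.
  by apply: ler_wpM2l => //; rewrite subr_ge0.
have : 0 <= L%:R * z ^+ 2 by rewrite mulr_ge0 ?sqr_ge0.
by rewrite -natr1; nra.
Qed.

(** With y = 1 - q, squeeze exp(-E y) (1 - E y^2) <= (1 - y)^E <= exp(-E y). The lower bound is (1 -
    y) exp(y) >= 1 - y^2 followed by Bernoulli's inequality; E y^2 tends to 0 because E y converges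
    and y tends to 0. *)
Lemma pow_one_sub_limit (E : nat -> nat) (q : nat -> R) (lam : R) :
  (forall k, 0 <= q k <= 1) -> q k @[k --> \oo] --> (1 : R) ->
  (E k)%:R * (1 - q k) @[k --> \oo] --> lam ->
  q k ^+ E k @[k --> \oo] --> expR (- lam).
Proof.
move=> q01 q1 Eq.
have y0 : (1 - q k) @[k --> \oo] --> 0.
  by rewrite -(subrr 1); apply: cvgB => //; exact: cvg_cst.
have ey : expR (- ((E k)%:R * (1 - q k))) @[k --> \oo] --> expR (- lam).
  apply: (@continuous_cvg _ _ _ _ _ _ (@expR R) (- lam)); first exact: continuous_expR.
  exact: cvgN.
have lo : expR (- ((E k)%:R * (1 - q k))) * (1 - (E k)%:R * (1 - q k) * (1 - q k))
    @[k --> \oo] --> expR (- lam).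
  rewrite -[X in _ --> X]mulr1 -[X in _ * X]subr0 -[X in _ - X](mulr0 lam).
  by apply: cvgM => //; apply: cvgB; [exact: cvg_cst|exact: cvgM].
apply: (squeeze_cvgr _ lo ey); near=> k.
have /andP[qk0 qk1] := q01 k; set y := 1 - q k.
have yE : q k = 1 - y by rewrite /y; ring.
have y01 : 0 <= y <= 1 by rewrite /y; apply/andP; split; lra.
have eE : expR (- ((E k)%:R * y)) = expR (- y) ^+ E k by rewrite -mulrN expRM_natl.
apply/andP; split; last first.
  rewrite eE; apply: lerXn2r; rewrite ?nnegrE ?expR_ge0//.
  by rewrite yE; exact: expR_ge1Dx.
apply: (@le_trans _ _ (expR (- y) ^+ E k * (1 - y ^+ 2) ^+ E k)).
  rewrite eE; apply: ler_wpM2l; first by rewrite exprn_ge0// expR_ge0.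
  rewrite -mulrA -expr2; apply: bernoulli_le; apply/andP; split; first exact: sqr_ge0.
  by nra.
rewrite -exprMn; apply: lerXn2r; rewrite ?nnegrE//.
  by rewrite mulr_ge0 ?expR_ge0//; nra.
rewrite expRN mulrC ler_pdivrMr ?expR_gt0// yE.
have := expR_ge1Dx y; nra.
Unshelve. all: by end_near. Qed.

Lemma ffact_ratio_limit (L : nat -> nat) r : (forall k, (0 < L k)%N) ->
  ((L k)%:R : R)^-1 @[k --> \oo] --> 0 ->
  ((L k) ^_ r)%:R / (L k)%:R ^+ r @[k --> \oo] --> (1 : R).
Proof.
move=> L0 Linv; elim: r => [|r IH].
  rewrite (_ : (fun k => _) = cst 1); first exact: cvg_cst.
  by apply/funext => k; rewrite ffactn0 expr0 divr1.
have h : 1 - r%:R * ((L k)%:R : R)^-1 @[k --> \oo] --> (1 : R).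
  rewrite -[X in _ --> X]subr0 -[X in _ - X](mulr0 r%:R).
  exact: (cvgB (cvg_cst _) (cvgM (cvg_cst _) Linv)).
rewrite -[X in _ --> X]mulr1; apply: cvg_near_eq (cvgM IH h) _; near=> k.
have Lk0 : (L k)%:R != 0 :> R by rewrite pnatr_eq0 -lt0n.
rewrite ffactnSr natrM exprS /=.
have [rL|rL] := leqP r (L k).
  by rewrite natrB//; field; rewrite Lk0 expf_neq0.
by rewrite ffact_small// !mul0r.
Unshelve. all: by end_near. Qed.

Lemma cvg_pow (f : nat -> R) (l : R) j : f k @[k --> \oo] --> l -> f k ^+ j @[k --> \oo] --> l ^+ j.
Proof.
move=> fl; elim: j => [|j IH]; first exact: cvg_cst.
by rewrite exprS; under eq_fun do rewrite exprS; exact: cvgM.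
Qed.

Lemma cvg_bigprod I (s : seq I) (f : nat -> I -> R) (l : I -> R) :
  (forall i, f k i @[k --> \oo] --> l i) ->
  \prod_(i <- s) f k i @[k --> \oo] --> \prod_(i <- s) l i.
Proof.
move=> fl; elim: s => [|i s IH].
  rewrite big_nil (_ : (fun k => _) = cst 1); first exact: cvg_cst.
  by apply/funext => k; rewrite big_nil.
by rewrite big_cons; under eq_fun do rewrite big_cons; exact: cvgM.
Qed.

(** Probability that among [L] independent trials the outcome [Some s] occurs [r s] times and [None]
    in all others. When the [r s] add up to more than [L], the falling factorial vanishes, which
    makes the truncated exponent harmless. *)
Definition multinomial_term m (L : nat) (r : 'I_m -> nat) (q : option 'I_m -> R) : R :=
  (L ^_ (\sum_s r s))%:R * (\prod_s (q (Some s) ^+ r s / (r s)`!%:R)) *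
   q None ^+ (L - \sum_s r s).

(** The limit for [None] is a separate hypothesis because the outcomes need not exhaust the space: a
    block with several eigenvalues in the window has none of them. The powers of L move from the
    falling factorial into the products L q. *)
Lemma poisson_limit m (r : 'I_m -> nat) (L : nat -> nat) (q : nat -> option 'I_m -> R)
    (lam : 'I_m -> R) :
  (forall k, (0 < L k)%N) -> ((L k)%:R : R)^-1 @[k --> \oo] --> 0 ->
  (forall k, 0 <= q k None <= 1) ->
  (forall s, (L k)%:R * q k (Some s) @[k --> \oo] --> lam s) ->
  (L k)%:R * (1 - q k None) @[k --> \oo] --> \sum_s lam s ->
  multinomial_term (L k) r (q k) @[k --> \oo] -->
   \prod_s (expR (- lam s) * lam s ^+ r s / (r s)`!%:R).
Proof.
move=> L0 Linv q01 qs q0.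
set S := (\sum_s r s)%N.
have Lk0 k : (L k)%:R != 0 :> R by rewrite pnatr_eq0 -lt0n.
have -> : \prod_s (expR (- lam s) * lam s ^+ r s / (r s)`!%:R) =
  1 * (\prod_s (lam s ^+ r s / (r s)`!%:R)) * expR (- \sum_s lam s).
  under eq_bigr do rewrite -mulrA.
  rewrite big_split /= mul1r mulrC; congr (_ * _).
  by rewrite -sumrN (big_morph expR (@expRD R) (@expR0 R)).
have y0 : (1 - q k None) @[k --> \oo] --> (0 : R).
  have h := cvgM q0 Linv; rewrite mulr0 in h.
  apply: cvg_near_eq (h _) _; near=> k.
  by rewrite /= mulrAC divff// mul1r.
have q1 : q k None @[k --> \oo] --> (1 : R).
  rewrite (_ : (fun k => q k None) = (fun k => 1 - (1 - q k None))); last first.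
    by apply/funext => k; rewrite subKr.
  by rewrite -[X in _ --> X]subr0; apply: cvgB => //; exact: cvg_cst.
have Lbig : \forall k \near \oo, (S <= L k)%N.
  have S0 : 0 < (S.+1%:R : R)^-1 by rewrite invr_gt0.
  move/cvgrPdist_lt: Linv => /(_ _ S0); apply: filterS => k.
  rewrite sub0r normrN ger0_norm ?invr_ge0// ltf_pV2 ?posrE ?ltr0n//.
  by rewrite ltr_nat => /ltnW/ltnW.
have e0 : q k None ^+ (L k - S) @[k --> \oo] --> expR (- \sum_s lam s).
  apply: pow_one_sub_limit => //.
  have h : (L k)%:R * (1 - q k None) - S%:R * (1 - q k None) @[k --> \oo] --> \sum_s lam s.
    rewrite -[X in _ --> X]subr0 -[X in _ - X](mulr0 S%:R).
    by apply: cvgB => //; apply: cvgM => //; exact: cvg_cst.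
  apply: cvg_near_eq h _; near=> k.
  rewrite /= natrB ?mulrBl//; by near: k.
have pr : \prod_s (((L k)%:R * q k (Some s)) ^+ r s / (r s)`!%:R) @[k --> \oo] -->
    \prod_s (lam s ^+ r s / (r s)`!%:R).
  by apply: cvg_bigprod => s; apply: cvgM; [exact: cvg_pow|exact: cvg_cst].
apply: cvg_near_eq (cvgM (cvgM (ffact_ratio_limit S L0 Linv) pr) e0) _; near=> k; rewrite /= /multinomial_term -/S; congr (_ * _).
have -> : \prod_s (((L k)%:R * q k (Some s)) ^+ r s / (r s)`!%:R) =
   (L k)%:R ^+ S * \prod_s (q k (Some s) ^+ r s / (r s)`!%:R).
  rewrite /S -prodrXr.
  by rewrite -big_split /=; apply: eq_bigr => s _; rewrite exprMn mulrA.
by rewrite mulrA divfK// expf_neq0.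
Unshelve. all: by end_near. Qed.

End PoissonCalculus.

(** * Exact multinomial law for independent blocks *)

Section IidBlocks.
Context {R : realType}.
Variables (mu : set R -> \bar R) (Q : probability (@seqR R) R).
Hypotheses (muT : mu setT = 1%E) (HQ : iid_law mu Q).

Lemma measure_bigU (I : eqType) (s : seq I) (F : I -> set (@seqR R)) : uniq s ->
  (forall i, measurable (F i)) -> (forall i j, i != j -> F i `&` F j = set0) ->
  Q (\big[setU/set0]_(i <- s) F i) = (\sum_(i <- s) Q (F i))%E.
Proof.
move=> us mF dF; elim: s us => [|i s IH] /=; first by rewrite !big_nil measure0.
move=> /andP[is_ us]; rewrite !big_cons measureU//.
- by congr (_ + _)%E; exact: IH.
- by apply: bigsetU_measurable.
- rewrite big_distrr /= big_seq big1// => j js; apply: dF.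
  by apply: contraNneq is_ => ->.
Qed.

Variables (N0 m : nat) (D : option 'I_m -> set (@seqR R)).
Hypotheses (mD : forall o, measurable (D o))
  (dD : forall o o', o != o' -> D o `&` D o' = set0)
  (locD : forall o w w', (forall i, (i < N0)%N -> w i = w' i) -> D o w -> D o w').

Definition sh (l : nat) (w : nat -> R) : nat -> R := fun i => w (l * N0 + i)%N.

Definition rdec (r : 'I_m -> nat) (o : option 'I_m) : 'I_m -> nat :=
  fun s => (r s - (o == Some s))%N.
Definition rok (r : 'I_m -> nat) (o : option 'I_m) : bool :=
  if o is Some s then (0 < r s)%N else true.

Definition states : seq (option 'I_m) := None :: map Some (enum 'I_m).

(** Each of the first [L] blocks is in some state and [Some s] occurs [r s] times. Peeling off the
    last block makes the union over its state disjoint; [rok] excludes the states for which the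
    truncated subtraction in [rdec] would be wrong. *)
Fixpoint pattern (L : nat) (r : 'I_m -> nat) : set (@seqR R) :=
  if L is L'.+1 then
    \big[setU/set0]_(o <- states)
      (if rok r o then pattern L' (rdec r o) `&` (sh L' @^-1` D o) else set0)
  else [set w | forall s, r s = 0%N].

Lemma measurable_sh l : measurable_fun setT (sh l : seqR -> seqR).
Proof. by apply: measurable_fun_seqR => i; exact: measurable_coord. Qed.

Lemma measurable_shD l o : measurable (sh l @^-1` D o : set seqR).
Proof.
by rewrite -[X in measurable X]setTI; apply: (measurable_sh l) => //; exact: mD.
Qed.

Lemma measurable_pattern L r : measurable (pattern L r).
Proof.
elim: L r => [|L IH] r /=.
  have [h|h] := pselect (forall s, r s = 0%N).
    by rewrite (_ : [set _ | _] = setT) //; apply/seteqP; split.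
  by rewrite (_ : [set _ | _] = set0) //; apply/seteqP; split => // w /h.
apply: bigsetU_measurable => o _; case: ifP => // _.
by apply: measurableI; [exact: IH|exact: measurable_shD].
Qed.

Lemma pattern_local L r w w' : (forall i, (i < L * N0)%N -> w i = w' i) ->
  pattern L r w -> pattern L r w'.
Proof.
elim: L r => [|L IH] r //= ww'; rewrite -!bigcup_seq; case=> o os /=.
case: ifP => // ok [p d]; exists o => //=; rewrite ok; split.
  by apply: IH p => i iL; apply: ww'; lia.
by apply: locD d => i iN; apply: ww'; rewrite mulSn; lia.
Qed.

Lemma Q_sh l X : measurable (X : set (@seqR R)) -> Q (sh l @^-1` X) = Q X.
Proof.
move=> mX; rewrite (iid_law_reindex HQ (s := fun i => (l * N0 + i)%N) _ mX)//.
by move=> i j /addnI.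
Qed.

(** Induction on the number of blocks. With S the sum of the [r s], the recursion over the state of
    the last block reduces to (L+1)^_S = L^_S + S L^_(S-1). *)
Lemma Q_pattern L r :
  Q (pattern L r) = (multinomial_term L r (fun o => fine (Q (D o))))%:E.
Proof.
set q := fun o => fine (Q (D o)).
have qE o : Q (D o) = (q o)%:E by rewrite /q fineK// fin_num_measure.
elim: L r => [|L IH] r.
  rewrite /multinomial_term /=.
  have [h|h] := pselect (forall s, r s = 0%N).
    have -> : (\sum_s r s = 0)%N by apply: big1 => s _.
    rewrite (_ : [set _ | _] = setT); last by apply/seteqP; split.
    rewrite ffactn0 expr0 mul1r mulr1 big1 => [|s _]; first exact: probability_setT.
    by rewrite h expr0 fact0 divr1.
  have S0 : (0 < \sum_s r s)%N.
    rewrite lt0n; apply: contra_notN h; rewrite sum_nat_eq0 => /forallP h s.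
    by apply/eqP; have := h s.
  rewrite (_ : [set _ | _] = set0); last by apply/seteqP; split => // w /h.
  by rewrite measure0 ffact_small// !mul0r.
rewrite /= measure_bigU; last 3 first.
- have Si : injective (@Some 'I_m) by move=> ? ? [].
  by rewrite /states /= (map_inj_uniq Si) enum_uniq andbT; apply/negP => /mapP [].
- move=> o; case: ifP => // _.
  by apply: measurableI; [exact: measurable_pattern|exact: measurable_shD].
- move=> o o' oo'; case: ifP => _; rewrite ?set0I//; case: ifP => _; rewrite ?setI0//.
  apply/seteqP; split => // w [[_ h1] [_ h2]].
  by have /seteqP[/(_ (sh L w)) h _] := dD oo'; apply: h.
have step o : Q (if rok r o then pattern L (rdec r o) `&` (sh L @^-1` D o) else set0) =
   (if rok r o then multinomial_term L (rdec r o) q * q o else 0)%:E.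
  case: ifP => // _; rewrite ?measure0//.
  (* The pattern of the first [L] blocks reads the sites below [L * N0], the last block only sites
     from there on. *)
  rewrite (iid_indep muT HQ (p := fun i => (i < L * N0)%N)).
  - by rewrite IH [X in (_ * X)%E]Q_sh// qE -EFinM.
  - exact: measurable_pattern.
  - exact: measurable_shD.
  - by move=> w w' ww'; exact: pattern_local.
  - move=> w w' ww'; apply: locD => i iN; apply: ww'; rewrite -leqNgt; exact: leq_addr.
under eq_bigr do rewrite step.
rewrite sumEFin; congr EFin; rewrite /states big_cons big_map /= big_enum /=.
pose S := (\sum_s r s)%N; pose Pr := \prod_s (q (Some s) ^+ r s / (r s)`!%:R).
have t0 : multinomial_term L (rdec r None) q * q None =
   (L ^_ S)%:R * Pr * q None ^+ (L.+1 - S).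
  have rE : rdec r None = r by apply/funext => s; rewrite /rdec subn0.
  rewrite rE /multinomial_term -/S -/Pr -mulrA -exprSr.
  have [SL|SL] := leqP S L; first by rewrite subSn.
  by rewrite ffact_small// !mul0r.
have ts s : (if (0 < r s)%N then multinomial_term L (rdec r (Some s)) q * q (Some s) else 0) =
   (r s)%:R * ((L ^_ S.-1)%:R * Pr * q None ^+ (L - S.-1)).
  case: posnP => [->|rs]; first by rewrite mul0r.
  have SE : (\sum_s' rdec r (Some s) s' = S.-1)%N.
    rewrite /S (bigD1 s)//= [in RHS](bigD1 s)//= /rdec eqxx.
    rewrite (eq_bigr r) => [|s' ss']; first by lia.
    by rewrite (inj_eq Some_inj) eq_sym (negbTE ss') subn0.
  have PE : \prod_s' (q (Some s') ^+ rdec r (Some s) s' / (rdec r (Some s) s')`!%:R) * q (Some s)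
     = (r s)%:R * Pr.
    rewrite /Pr (bigD1 s)//= [in RHS](bigD1 s)//= /rdec eqxx.
    rewrite (eq_bigr (fun s' => q (Some s') ^+ r s' / (r s')`!%:R)) => [|s' ss']; last first.
      by rewrite (inj_eq Some_inj) eq_sym (negbTE ss') subn0.
    move: rs; case: (r s) => // j _; rewrite subn1 /= factS natrM exprS.
    have f0 : (j`!)%:R != 0 :> R by rewrite pnatr_eq0 -lt0n fact_gt0.
    have j0 : j.+1%:R != 0 :> R by rewrite pnatr_eq0.
    move: (j.+1%:R) j0 (j`!%:R) f0 => x x0 y y0.
    by field; rewrite ?x0 ?y0.
  rewrite /multinomial_term SE mulrAC -[X in X * _ = _]mulrA PE; ring.
under eq_bigr do rewrite ts.
rewrite t0 -mulr_suml -natr_sum -/S /multinomial_term -/S -/Pr.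
clear t0 ts; clearbody S; case: S => [|S] /=; first by rewrite mul0r addr0 !ffactn0.
rewrite subSS [X in _ + X]mulrA [X in _ + X * _]mulrA -mulrDl -mulrDl -natrM -natrD.
congr (_ * _ * _); congr (_%:R).
have [SL|SL] := leqP S L; last by rewrite !ffact_small ?muln0//; lia.
rewrite ffactnSr ffactSS -{2}(subnK SL); nia.
Qed.

End IidBlocks.

(** * Schur test for symmetric nonnegative matrices *)

Section SchurTest.
Context {R : realType}.
Variables (N : nat) (D : 'M[R]_N) (dl : R).
Hypotheses (D0 : forall i j, 0 <= D i j) (Ds : D^T = D)
  (Dr : forall i, \sum_j D i j <= dl).

Let Dij i j : D i j = D j i. Proof. by rewrite -[in LHS]Ds mxE. Qed.

Let weighted (f : 'I_N -> R) : (forall i, 0 <= f i) -> \sum_i \sum_j D i j * f j <= dl * \sum_i f i.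
Proof.
move=> f0; rewrite exchange_big /= mulr_sumr; apply: ler_sum => j _.
rewrite -mulr_suml; apply: ler_wpM2r => //.
by rewrite (eq_bigr (fun i => D j i))// => i _.
Qed.

Lemma schur_quad (x : 'rV_N) : `|(x *m D *m x^T) 0 0| <= dl * (x *m x^T) 0 0.
Proof.
have E : (x *m D *m x^T) 0 0 = \sum_i \sum_j D i j * (x 0 i * x 0 j).
  rewrite mxE [RHS]exchange_big /=; apply: eq_bigr => j _; rewrite mxE mulr_suml.
  by apply: eq_bigr => i _; rewrite mxE; ring.
have -> : (x *m x^T) 0 0 = \sum_i x 0 i ^+ 2.
  by rewrite mxE; apply: eq_bigr => i _; rewrite mxE expr2.
have W := weighted (fun i => sqr_ge0 (x 0 i)).
have W' : \sum_i \sum_j D i j * x 0 i ^+ 2 <= dl * \sum_i x 0 i ^+ 2.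
  apply: le_trans W; rewrite exchange_big /=; apply: ler_sum => j _; apply: ler_sum => i _.
  by rewrite Dij.
rewrite E ler_norml; apply/andP; split.
  rewrite -subr_ge0 opprK.
  apply: (@le_trans _ _ (\sum_i \sum_j D i j * (x 0 i * x 0 j) +
     (\sum_i \sum_j D i j * x 0 j ^+ 2 + \sum_i \sum_j D i j * x 0 i ^+ 2) / 2)); last lra.
  rewrite -big_split mulr_suml -big_split sumr_ge0// => i _.
  rewrite -big_split mulr_suml -big_split sumr_ge0// => j _ /=.
  rewrite (_ : _ + _ = D i j * ((x 0 i + x 0 j) ^+ 2 / 2)); last by field.
  by rewrite mulr_ge0// divr_ge0// sqr_ge0.
rewrite -subr_ge0.
apply: (@le_trans _ _ ((\sum_i \sum_j D i j * x 0 j ^+ 2 + \sum_i \sum_j D i j * x 0 i ^+ 2) / 2 -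
   \sum_i \sum_j D i j * (x 0 i * x 0 j))); last lra.
rewrite -big_split mulr_suml -sumrB sumr_ge0// => i _.
rewrite -big_split mulr_suml -sumrB sumr_ge0// => j _ /=.
rewrite (_ : _ - _ = D i j * ((x 0 i - x 0 j) ^+ 2 / 2)); last by field.
by rewrite mulr_ge0// divr_ge0// sqr_ge0.
Qed.

(** Cauchy-Schwarz in each row with the entries of [D] as weights, its defect written as a double
    sum of squares; the column sums, equal to row sums by symmetry, give the second factor. *)
Lemma schur_norm (u : 'cV_N) : 0 <= dl -> cnorm2 (D *m u) <= dl ^+ 2 * cnorm2 u.
Proof.
move=> dl0; apply: (@le_trans _ _ (\sum_i dl * \sum_j D i j * u j 0 ^+ 2)); last first.
  rewrite -mulr_sumr expr2 -mulrA; apply: ler_wpM2l => //.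
  exact: (weighted (fun i => sqr_ge0 (u i 0))).
apply: ler_sum => i _; rewrite mxE.
apply: (@le_trans _ _ ((\sum_j D i j) * \sum_j D i j * u j 0 ^+ 2)); last first.
  by apply: ler_wpM2r => //; rewrite sumr_ge0// => j _; rewrite mulr_ge0// sqr_ge0.
rewrite -subr_ge0.
suff -> : (\sum_j D i j) * (\sum_j D i j * u j 0 ^+ 2) - (\sum_j D i j * u j 0) ^+ 2 =
   \sum_j \sum_k D i j * D i k * ((u j 0 - u k 0) ^+ 2 / 2).
  apply: sumr_ge0 => j _; apply: sumr_ge0 => k _.
  by apply: mulr_ge0; [exact: mulr_ge0|rewrite divr_ge0// sqr_ge0].
have dbl (f g : 'I_N -> R) : (\sum_j f j) * (\sum_k g k) = \sum_j \sum_k f j * g k.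
  by rewrite mulr_suml; apply: eq_bigr => j _; rewrite mulr_sumr.
have e1 : (\sum_j D i j) * (\sum_j D i j * u j 0 ^+ 2) =
  (\sum_j \sum_k D i j * (D i k * u k 0 ^+ 2) + \sum_j \sum_k (D i j * u j 0 ^+ 2) * D i k) / 2.
  by rewrite -!dbl [X in _ + X]mulrC; field.
rewrite e1 expr2 dbl -big_split mulr_suml -sumrB; apply: eq_bigr => j _ /=.
rewrite -big_split mulr_suml -sumrB; apply: eq_bigr => k _ /=; by field.
Qed.

End SchurTest.

Section RealSequences.
Context {R : realType}.

Lemma cvg_of_tail (f t : nat -> R) (m : nat) : t k @[k --> \oo] --> 0 ->
  (forall j l, (m <= j)%N -> (j <= l)%N -> `|f l - f j| <= t j) ->
  f k @[k --> \oo] --> limn f /\ (forall j, (m <= j)%N -> `|limn f - f j| <= t j).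
Proof.
move=> t0 ft.
have cf : cvgn f.
  apply/cauchy_cvgP; apply: cauchy_exP => e e0.
  move/cvgrPdist_lt : t0 => /(_ e e0) [k _ hk].
  pose K := maxn k m; exists (f K); exists K => // l /= Kl.
  rewrite /ball /= distrC; apply: le_lt_trans (ft _ _ (leq_maxr k m) Kl) _.
  by have := hk K (leq_maxl k m); rewrite sub0r normrN; apply: le_lt_trans; exact: ler_norm.
split => // j mj.
have h : `|f l - f j| @[l --> \oo] --> `|limn f - f j|.
  by apply: cvg_norm; apply: cvgB => //; exact: cvg_cst.
by apply: (cvgr_to_le h); exists j => // l /= jl; exact: ft.
Qed.

Lemma cvg_bigsum I (s : seq I) (f : nat -> I -> R) (l : I -> R) :
  (forall i, f k i @[k --> \oo] --> l i) ->
  \sum_(i <- s) f k i @[k --> \oo] --> \sum_(i <- s) l i.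
Proof.
move=> fl; elim: s => [|i s IH].
  rewrite big_nil (_ : (fun k => _) = cst 0); first exact: cvg_cst.
  by apply/funext => k; rewrite big_nil.
by rewrite big_cons; under eq_fun do rewrite big_cons; exact: cvgD.
Qed.

End RealSequences.

(** * Truncated hierarchical Laplacians and the resolvent in infinite volume *)

Section HierarchicalKernel.
Context {R : realType}.
Variables (n : nat) (p tl : nat -> R).
Hypotheses (n2 : (2 <= n)%N) (p0 : forall r, (1 <= r)%N -> 0 < p r)
  (tlP : forall j l, (j <= l)%N -> \sum_(j.+1 <= s < l.+1) p s <= tl j)
  (tl0 : tl k @[k --> \oo] --> 0).

Definition kap (r i j : nat) : R :=
  \sum_(1 <= s < r.+1) p s * ((n ^ s)%:R)^-1 * ((i %/ n ^ s == j %/ n ^ s)%N)%:R.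

(** The box size [N] and the level [r] are separate: with r = J and N = n^k this is the Laplacian
    truncated at level J on the full box. *)
Definition Amx N r : 'M[R]_N := \matrix_(i, j) kap r i j.

Lemma Amx_sym N r : (Amx N r)^T = Amx N r.
Proof.
by apply/matrixP => i j; rewrite !mxE; apply: eq_bigr => s _; rewrite eq_sym.
Qed.

Lemma tl_ge0 j : 0 <= tl j.
Proof. by apply: le_trans (tlP (leqnn j)); rewrite big_geq. Qed.

Lemma sum_block N d q : (0 < d)%N -> (\sum_(j < N) (j %/ d == q) <= d)%N.
Proof.
(* Strengthened for induction on [N]: the bound has to record how much of the q-th block has been
   passed. *)
move=> d0; suff : (\sum_(j < N) (j %/ d == q) <= minn (N - q * d) d)%N.
  by move=> h; apply: leq_trans h (geq_minr _ _).
elim: N => [|N IH]; first by rewrite big_ord0.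
rewrite big_ord_recr /=.
have -> : ((N %/ d)%N == q) = (q * d <= N)%N && (N < q.+1 * d)%N.
  by rewrite eqn_leq -ltnS ltn_divLR// leq_divRL// andbC.
move: IH; set S := (\sum_(_ < _) _)%N; rewrite mulSn; case: leqP; case: ltnP => /=; lia.
Qed.

Lemma kap_diff j l x y : (j <= l)%N -> kap l x y - kap j x y =
  \sum_(j.+1 <= s < l.+1) p s * ((n ^ s)%:R)^-1 * ((x %/ n ^ s == y %/ n ^ s)%N)%:R.
Proof.
by move=> jl; rewrite /kap (@big_cat_nat _ _ _ j.+1)//= addrAC subrr add0r.
Qed.

Lemma Adiff_ge0 N j l (x y : 'I_N) : (j <= l)%N -> 0 <= (Amx N l - Amx N j) x y.
Proof.
move=> jl; rewrite !mxE kap_diff// big_nat sumr_ge0// => s /andP[js _].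
by rewrite !mulr_ge0// ?invr_ge0// ltW// p0//; lia.
Qed.

(** A ball of radius s has at most n^s sites in the box, so a row of E_s sums to at most 1 and only
    the tail of [p] remains. *)
Lemma Adiff_row N j l (x : 'I_N) : (j <= l)%N -> \sum_y (Amx N l - Amx N j) x y <= tl j.
Proof.
move=> jl; apply: le_trans (tlP jl).
under eq_bigr do rewrite !mxE kap_diff//.
rewrite exchange_big /= big_nat [leRHS]big_nat; apply: ler_sum => s /andP[js _].
have ns0 : (0 < n ^ s)%N by rewrite expn_gt0; lia.
rewrite -mulr_sumr -mulrA ler_piMr ?(ltW (p0 _))//; first by lia.
rewrite mulrC ler_pdivrMr ?ltr0n// mul1r -natr_sum ler_nat.
by under eq_bigr do rewrite eq_sym; exact: sum_block.
Qed.

Lemma Adiff_sym N j l : (Amx N l - Amx N j)^T = Amx N l - Amx N j.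
Proof. by rewrite linearB /= !Amx_sym. Qed.

Lemma kap_out j x i : (i < n ^ j)%N -> (n ^ j <= x)%N -> kap j x i = 0.
Proof.
move=> ij jx; rewrite /kap big_nat big1// => s /andP[s1 sj].
case: eqP => [E|]; last by rewrite mulr0.
have nz k : (0 < n ^ k)%N by rewrite expn_gt0; lia.
have : (x %/ n ^ j = i %/ n ^ j)%N.
  by rewrite -(subnKC (_ : s <= j)%N)// expnD !divnMA E.
rewrite [(i %/ _)%N]divn_small// => x0.
have : (1 <= x %/ n ^ j)%N by rewrite leq_divRL// mul1n.
by rewrite x0.
Qed.

(** Once [x0] lies below n^k, the ball around it is the initial segment of that length. *)
Lemma Hk_mxE w x0 k : (x0 < n ^ k)%N -> Hk_mx n p w x0 k = Hw (Amx (n ^ k) k) w.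
Proof.
move=> xk; apply/matrixP => i j.
rewrite /Hk_mx /Hw !mxE /ball_pt divn_small// mul0n !add0n.
by congr (_ + _); case: (i == j); rewrite ?mul1r ?mul0r ?mulr1n ?mulr0n.
Qed.

Lemma Eavg_block r N (psi : nat -> R) x : (0 < n)%N -> (n ^ r %| N)%N -> (x < N)%N ->
  \sum_(0 <= i < N) ((n ^ r)%:R)^-1 * ((x %/ n ^ r == i %/ n ^ r)%N)%:R * psi i = Eavg n r psi x.
Proof.
move=> n0 dN xN; rewrite /Eavg; set d := (n ^ r)%N in dN *; set q := (x %/ d)%N.
have d0 : (0 < d)%N by rewrite /d expn_gt0 n0.
have qN : (q * d + d <= N)%N.
  have /dvdnP[m mE] := dN; rewrite mE in xN *.
  have : (q < m)%N by rewrite /q ltn_divLR.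
  by move=> qm; rewrite -mulSnr leq_mul2r qm orbT.
rewrite (@big_cat_nat _ _ _ (q * d))//=; last by lia.
rewrite (@big_cat_nat _ _ _ (q * d + d) (q * d))//=; last by lia.
have eqd i : (q == i %/ d)%N = (q * d <= i)%N && (i < q * d + d)%N.
  by rewrite eq_sym eqn_leq -ltnS ltn_divLR// leq_divRL// andbC -mulSnr.
rewrite big_nat big1 => [|i /andP[_ i1]]; last first.
  by rewrite eqd leqNgt i1 /= mulr0 mul0r.
rewrite add0r [X in _ + X]big_nat [X in _ + X]big1 => [|i /andP[i1 _]]; last first.
  by rewrite eqd [(i < _)%N]ltnNge i1 andbF mulr0 mul0r.
rewrite addr0 -{1}[(q * d)%N]add0n big_addn addKn big_mkord mulr_sumr.
apply: eq_bigr => i _; rewrite addnC eqd leq_addr ltn_add2l ltn_ord mulr1 //.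
Qed.

Section Levels.
Variables (w : nat -> R) (a b : R) (x0 : nat).
Hypothesis b0 : 0 < b.

(** The resolvent column at [x0] in the box of level [l], extended by zero so that columns of
    different sizes can be compared. *)
Definition glev (res : forall N, 'M[R]_N -> R -> R -> 'I_N -> 'cV[R]_N) (l x : nat) : R :=
  if insub x is Some i then
    if insub x0 is Some o then res _ (Hw (Amx (n ^ l) l) w) a b o i 0 else 0
  else 0.
Definition gu := glev (@resu R).
Definition gv := glev (@resv R).

Lemma glev_out res l x : (n ^ l <= x)%N -> glev res l x = 0.
Proof. by move=> lx; rewrite /glev insubN// -leqNgt. Qed.

Lemma glev_in res l (h : (x0 < n ^ l)%N) :
  \col_(i < n ^ l) glev res l i = res _ (Hw (Amx (n ^ l) l) w) a b (Ordinal h).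
Proof. by apply/colP => i; rewrite mxE /glev valK insubT. Qed.

Lemma gv_imG l (h : (x0 < n ^ l)%N) : gv l x0 = imG (Hw (Amx (n ^ l) l) w) a b (Ordinal h).
Proof. by rewrite /gv /glev insubT /= resvE. Qed.

Definition fsys (N r : nat) (u v : nat -> R) := forall x, (x < N)%N ->
  \sum_(0 <= i < N) kap r x i * u i + (w x - a) * u x + b * v x = (x == x0)%:R /\
  \sum_(0 <= i < N) kap r x i * v i + (w x - a) * v x - b * u x = 0.

Lemma fsysP N r u v : fsys N r u v <->
  res_pair (Hw (Amx N r) w) a b (\col_(i < N) (i == x0 :> nat)%:R) 0
     (\col_(i < N) u i) (\col_(i < N) v i).
Proof.
have E (f : nat -> R) (x : 'I_N) : ((Hw (Amx N r) w - a%:M) *m \col_(i < N) f i) x 0 =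
    \sum_(0 <= i < N) kap r x i * f i + (w x - a) * f x.
  rewrite mulmxBl mul_scalar_mx /Hw mulmxDl mxE [X in X + _]mxE mul_diag_mx.
  rewrite big_mkord [X in X + _ + _]mxE !mxE mulrBl addrA; congr (_ + _ + _).
  by apply: eq_bigr => i _; rewrite !mxE.
split.
  move=> h; split; apply/colP => x; have [h1 h2] := h x (ltn_ord x).
    by rewrite [LHS]mxE E [X in _ + X]mxE !mxE h1.
  by rewrite [LHS]mxE E [X in _ + X]mxE !mxE h2.
move=> [/colP h1 /colP h2] x xN; have e1 := h1 (Ordinal xN); have e2 := h2 (Ordinal xN).
by rewrite mxE E !mxE /= in e1; rewrite mxE E !mxE /= in e2.
Qed.

Lemma fsys_level l : (x0 < n ^ l)%N -> fsys (n ^ l) l (gu l) (gv l).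
Proof.
move=> h; apply/fsysP; rewrite /gu /gv !(glev_in _ h).
have -> : \col_(i < n ^ l) (i == x0 :> nat)%:R = delta_mx (Ordinal h) 0 :> 'cV[R]_(n ^ l).
  by apply/colP => i; rewrite !mxE eqxx andbT.
by apply: res_pairP => //; apply: Hw_sym; exact: Amx_sym.
Qed.

(** At level [j] the Laplacian does not couple the box of size n^j with its complement, so the
    extension by zero solves the level-j equation on the larger box too. *)
Lemma fsys_extend j l : (j <= l)%N -> (x0 < n ^ j)%N -> fsys (n ^ l) j (gu j) (gv j).
Proof.
move=> jl xj x xl.
have njl : (n ^ j <= n ^ l)%N by rewrite leq_exp2l; lia.
have S (f : nat -> R) : (forall i, (n ^ j <= i)%N -> f i = 0) ->
   \sum_(0 <= i < n ^ l) kap j x i * f i = \sum_(0 <= i < n ^ j) kap j x i * f i.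
  move=> f0; rewrite (@big_cat_nat _ _ _ (n ^ j))//= [X in _ + X]big_nat [X in _ + X]big1 ?addr0// => i /andP[ji _].
  by rewrite f0// mulr0.
rewrite !S; [|exact: glev_out..].
have [xj'|xj'] := ltnP x (n ^ j); first exact: fsys_level.
rewrite /gu /gv !glev_out// !mulr0 !addr0 oppr0 addr0.
have Z (f : nat -> R) : \sum_(0 <= i < n ^ j) kap j x i * f i = 0.
  by rewrite big_nat big1// => i /andP[_ ij]; rewrite kap_out// mul0r.
by rewrite !Z; case: eqP => // E; move: xj'; rewrite E leqNgt xj.
Qed.

Definition S2 (f g : nat -> R) N := \sum_(0 <= x < N) (f x ^+ 2 + g x ^+ 2).

Lemma S2_col (f g : nat -> R) N : cnorm2 (\col_(i < N) f i) + cnorm2 (\col_(i < N) g i) = S2 f g N.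
Proof.
rewrite /S2 big_split /= !big_mkord; congr (_ + _); apply: eq_bigr => i _; by rewrite mxE.
Qed.

Lemma S2_widen j l : (j <= l)%N -> S2 (gu j) (gv j) (n ^ l) = S2 (gu j) (gv j) (n ^ j).
Proof.
move=> jl; have njl : (n ^ j <= n ^ l)%N by rewrite leq_exp2l; lia.
rewrite /S2 (@big_cat_nat _ _ _ (n ^ j))//= [X in _ + X]big_nat [X in _ + X]big1 ?addr0// => i /andP[ji _].
by rewrite /gu /gv !glev_out// expr0n addr0.
Qed.

Lemma level_bound l : (x0 < n ^ l)%N -> b ^+ 2 * S2 (gu l) (gv l) (n ^ l) <= 1.
Proof.
move=> h; have /fsysP/res_pair_bound := fsys_level h; rewrite S2_col.
move=> /(_ (Hw_sym (Amx_sym _ _) w)) /le_trans; apply.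
rewrite /cnorm2 [X in _ + X]big1 => [|i _]; last by rewrite mxE expr0n.
rewrite addr0 (bigD1 (Ordinal h))//= mxE eqxx expr1n big1 ?addr0// => i ih.
by rewrite mxE (_ : (i == x0 :> nat) = false) ?expr0n//; exact: negbTE.
Qed.

Lemma level_energy l : (x0 < n ^ l)%N -> b * S2 (gu l) (gv l) (n ^ l) = gv l x0.
Proof.
move=> h; rewrite -S2_col /gu /gv !(glev_in _ h) (imG_energy _ (Hw_sym (Amx_sym _ _) w))//.
by rewrite -gv_imG.
Qed.

(** The second resolvent identity is read in both directions, so the error is measured against
    either column; the Schur test bounds the dropped levels by [tl j]. *)
Lemma level_compare j l : (j <= l)%N -> (x0 < n ^ j)%N ->
  let T := b ^+ 2 * S2 (fun x => gu l x - gu j x) (fun x => gv l x - gv j x) (n ^ l) in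
  T <= tl j ^+ 2 * S2 (gu l) (gv l) (n ^ l) /\ T <= tl j ^+ 2 * S2 (gu j) (gv j) (n ^ j).
Proof.
move=> jl xj T.
have njl : (n ^ j <= n ^ l)%N by rewrite leq_exp2l; lia.
have /fsysP sj := fsys_extend jl xj; have /fsysP sl := fsys_level (leq_trans xj njl).
have Hs r := Hw_sym (Amx_sym (n ^ l) r) w.
have colB (f g : nat -> R) N : \col_(i < N) f i - \col_(i < N) g i = \col_(i < N) (f i - g i) :> 'cV[R]_N.
  by apply/colP => i; rewrite !mxE.
have nN (y : 'cV[R]_(n ^ l)) : cnorm2 (- y) = cnorm2 y.
  by apply: eq_bigr => i _; rewrite mxE sqrrN.
have HD : Hw (Amx (n ^ l) l) w - Hw (Amx (n ^ l) j) w = Amx (n ^ l) l - Amx (n ^ l) j.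
  by rewrite /Hw opprD addrACA subrr addr0.
have sch u := schur_norm (fun x y => Adiff_ge0 x y jl) (Adiff_sym (n ^ l) j l)
   (fun x => Adiff_row x jl) u (tl_ge0 j).
split.
  have := res_pair_compare (Hs j) b0 sj sl; rewrite !colB.
  rewrite (S2_col (fun x => gu l x - gu j x) (fun x => gv l x - gv j x)) => /le_trans; apply.
  by rewrite HD -S2_col mulrDr lerD// sch.
have nB (f g : nat -> R) : cnorm2 (\col_(i < n ^ l) f i - \col_(i < n ^ l) g i) =
    cnorm2 (\col_(i < n ^ l) (g i - f i)).
  by apply: eq_bigr => i _; rewrite !mxE -opprB sqrrN.
have HD' : Hw (Amx (n ^ l) j) w - Hw (Amx (n ^ l) l) w = - (Amx (n ^ l) l - Amx (n ^ l) j).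
  by rewrite -HD opprB.
have := res_pair_compare (Hs l) b0 sl sj; rewrite !nB HD' !mulNmx !nN.
rewrite (S2_col (fun x => gu l x - gu j x) (fun x => gv l x - gv j x)) => /le_trans; apply.
by rewrite -(S2_widen jl) -S2_col mulrDr lerD// sch.
Qed.

Lemma level_pointwise j l x : (j <= l)%N -> (x0 < n ^ j)%N ->
  `|gu l x - gu j x| <= tl j / b ^+ 2 /\ `|gv l x - gv j x| <= tl j / b ^+ 2.
Proof.
move=> jl xj; have [T1 _] := level_compare jl xj.
have njl : (n ^ j <= n ^ l)%N by rewrite leq_exp2l; lia.
have lb := level_bound (leq_trans xj njl).
have t0 := tl_ge0 j; have b2 : 0 < b ^+ 2 by rewrite exprn_gt0.
have [xl|lx] := ltnP x (n ^ l); last first.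
  have jx := leq_trans njl lx.
  by rewrite /gu /gv !glev_out// subrr normr0; split; rewrite divr_ge0// ltW.
have pt : (gu l x - gu j x) ^+ 2 + (gv l x - gv j x) ^+ 2 <= (tl j / b ^+ 2) ^+ 2.
  have le1 : (gu l x - gu j x) ^+ 2 + (gv l x - gv j x) ^+ 2 <=
     S2 (fun x => gu l x - gu j x) (fun x => gv l x - gv j x) (n ^ l).
    rewrite /S2 big_mkord (bigD1 (Ordinal xl))//= lerDl sumr_ge0// => i _.
    by rewrite addr_ge0 ?sqr_ge0.
  apply: le_trans le1 _; rewrite exprMn -exprVn.
  rewrite (_ : tl j ^+ 2 * _ = tl j ^+ 2 / b ^+ 2 / b ^+ 2); last by rewrite exprVn expr2 invfM mulrA.
  rewrite ler_pdivlMr// mulrC; apply: le_trans T1 _.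
  by rewrite ler_wpM2l ?sqr_ge0// -[(b ^+ 2)^-1]mul1r ler_pdivlMr// mulrC.
have tb : 0 <= tl j / b ^+ 2 by rewrite divr_ge0// ltW.
have su := sqr_ge0 (gu l x - gu j x); have sv := sqr_ge0 (gv l x - gv j x).
by split; rewrite -(ler_pXn2r (n := 2))// ?nnegrE// real_normK ?num_real//; lra.
Qed.

(** By [level_energy] the imaginary parts are b times squared norms of columns, and the columns
    differ by at most tl j / b times the norm of either. The triangle inequality in the norm,
    squared, gives the factor. *)
Lemma level_ratio j l : (j <= l)%N -> (x0 < n ^ j)%N ->
  gv l x0 <= (1 + tl j / b) ^+ 2 * gv j x0 /\ gv j x0 <= (1 + tl j / b) ^+ 2 * gv l x0.
Proof.
move=> jl xj; have [T1 T2] := level_compare jl xj.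
have njl : (n ^ j <= n ^ l)%N by rewrite leq_exp2l; lia.
rewrite -(level_energy xj) -(level_energy (leq_trans xj njl)).
have b2 : 0 < b ^+ 2 by rewrite exprn_gt0.
have t0 := tl_ge0 j; set th := tl j / b.
have th0 : 0 <= th by rewrite divr_ge0// ltW.
set Sl := S2 (gu l) (gv l) (n ^ l); set Sj := S2 (gu j) (gv j) (n ^ j).
set Sd := S2 (fun x => gu l x - gu j x) (fun x => gv l x - gv j x) (n ^ l) in T1 T2.
have S0 f g N : 0 <= S2 f g N by rewrite /S2 sumr_ge0// => i _; rewrite addr_ge0 ?sqr_ge0.
have d1 : Sd <= th ^+ 2 * Sl.
  by rewrite -(ler_pM2l b2) (le_trans T1)// /th exprMn exprVn mulrA mulrCA divff ?mulr1// gt_eqF.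
have d2 : Sd <= th ^+ 2 * Sj.
  by rewrite -(ler_pM2l b2) (le_trans T2)// /th exprMn exprVn mulrA mulrCA divff ?mulr1// gt_eqF.
(* (x + y)^2 <= (1 + th) x^2 + (1 + 1/th) y^2, multiplied by [th] to allow [th = 0]. *)
have tri (f g f' g' : nat -> R) N : th * S2 f' g' N <= th * (1 + th) * S2 f g N +
    (1 + th) * S2 (fun x => f' x - f x) (fun x => g' x - g x) N.
  rewrite /S2 !mulr_sumr -big_split /=; apply: ler_sum => x _.
  have h1 := sqr_ge0 (th * f x - (f' x - f x)); have h2 := sqr_ge0 (th * g x - (g' x - g x)).
  nra.
have [th_eq|th_neq] := eqVneq th 0.
  have Sd0 : Sd = 0 by apply/eqP; rewrite eq_le S0 andbT (le_trans d1)// th_eq expr0n mul0r.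
  rewrite th_eq addr0 expr1n !mul1r.
  have ee : Sl = Sj.
    rewrite /Sl /Sj -(S2_widen jl); move/eqP: Sd0; rewrite /Sd /S2 psumr_eq0 => [/allP h|x _]; last first.
      by rewrite addr_ge0 ?sqr_ge0.
    apply: eq_big_seq => x xin; have := h x xin; rewrite /= paddr_eq0 ?sqr_ge0// !sqrf_eq0 !subr_eq0.
    by move=> /andP[/eqP -> /eqP ->].
  by rewrite ee lexx.
have thp : 0 < th by rewrite lt_neqAle eq_sym th_neq.
have t1 := tri (gu j) (gv j) (gu l) (gv l) (n ^ l)%N.
have t2 := tri (gu l) (gv l) (gu j) (gv j) (n ^ l)%N.
rewrite -/Sd (S2_widen jl) -/Sl -/Sj in t1.
rewrite (S2_widen jl) -/Sl -/Sj in t2.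
have SdE : S2 (fun x => gu j x - gu l x) (fun x => gv j x - gv l x) (n ^ l) = Sd.
  by apply: eq_bigr => x _; rewrite -[gu j x - _]opprB -[gv j x - _]opprB !sqrrN.
rewrite SdE in t2.
have fin (X Y : R) : 0 <= Y -> th * X <= th * (1 + th) * Y + (1 + th) * Sd -> Sd <= th ^+ 2 * Y ->
   b * X <= (1 + th) ^+ 2 * (b * Y).
  move=> Y0 h hd; rewrite mulrCA ler_pM2l// -(ler_pM2l thp).
  apply: le_trans h _.
  apply: (@le_trans _ _ (th * (1 + th) * Y + (1 + th) * (th ^+ 2 * Y))).
    by rewrite lerD2l ler_wpM2l// addr_ge0.
  by rewrite le_eqVlt; apply/orP; left; apply/eqP; ring.
by split; apply: fin => //; exact: S0.
Qed.

Definition Ulim (x : nat) : R := limn (fun l => gu l x).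
Definition Vlim (x : nat) : R := limn (fun l => gv l x).

Let x0lt j : (x0 <= j)%N -> (x0 < n ^ j)%N.
Proof. by move=> xj; apply: leq_ltn_trans xj _; apply: ltn_expl. Qed.

Let tlb : tl k / b ^+ 2 @[k --> \oo] --> 0.
Proof. by rewrite -(mul0r (b ^+ 2)^-1); apply: cvgM => //; exact: cvg_cst. Qed.

Lemma Ulim_cvg x : gu l x @[l --> \oo] --> Ulim x /\
  (forall j, (x0 <= j)%N -> `|Ulim x - gu j x| <= tl j / b ^+ 2).
Proof.
apply: cvg_of_tail => // j l xj jl.
by have [] := level_pointwise x jl (x0lt xj).
Qed.

Lemma Vlim_cvg x : gv l x @[l --> \oo] --> Vlim x /\
  (forall j, (x0 <= j)%N -> `|Vlim x - gv j x| <= tl j / b ^+ 2).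
Proof.
apply: cvg_of_tail => // j l xj jl.
by have [] := level_pointwise x jl (x0lt xj).
Qed.

Lemma Vlim_ratio j : (x0 <= j)%N ->
  Vlim x0 <= (1 + tl j / b) ^+ 2 * gv j x0 /\ gv j x0 <= (1 + tl j / b) ^+ 2 * Vlim x0.
Proof.
move=> xj; have [cv _] := Vlim_cvg x0; split.
  apply: (cvgr_to_le cv); exists j => // l /= jl.
  by have [] := level_ratio jl (x0lt xj).
have cv2 : (1 + tl j / b) ^+ 2 * gv l x0 @[l --> \oo] --> (1 + tl j / b) ^+ 2 * Vlim x0.
  by apply: cvgM => //; exact: cvg_cst.
apply: (cvgr_to_ge cv2); exists j => // l /= jl.
by have [] := level_ratio jl (x0lt xj).
Qed.

Lemma Eavg_dist r (f g : nat -> R) x e : (forall y, `|f y - g y| <= e) ->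
  `|Eavg n r f x - Eavg n r g x| <= e.
Proof.
move=> fg; rewrite /Eavg -mulrBr -sumrB normrM.
have nr : 0 < ((n ^ r)%N%:R : R) by rewrite ltr0n expn_gt0; lia.
rewrite ger0_norm ?invr_ge0 ?(ltW nr)// mulrC ler_pdivrMr//.
apply: le_trans (ler_norm_sum _ _ _) _.
apply: (@le_trans _ _ (\sum_(i < n ^ r) e)); first by apply: ler_sum => i _; exact: fg.
by rewrite sumr_const card_ord mulr_natr.
Qed.

Lemma kap_Eavg l (f : nat -> R) x : (x < n ^ l)%N ->
  \sum_(0 <= i < n ^ l) kap l x i * f i = \sum_(1 <= r < l.+1) p r * Eavg n r f x.
Proof.
move=> xl; rewrite /kap; under eq_bigr do rewrite mulr_suml.
rewrite exchange_big /= big_nat [RHS]big_nat; apply: eq_bigr => r /andP[r1 rl].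
rewrite -(@Eavg_block r (n ^ l)%N f x)//; [|by lia|by rewrite dvdn_exp2l].
by rewrite mulr_sumr; apply: eq_bigr => i _; rewrite !mulrA.
Qed.

(** Allows the limit in the equation: the level-l kernel acts as the partial sum of [hlap] up to l,
    and replacing [g l] by [f] there costs at most their uniform distance times the mass of [p]. *)
Lemma hlap_lim (g : nat -> nat -> R) (f : nat -> R) x h :
  (forall j y, (x0 <= j)%N -> `|f y - g j y| <= tl j / b ^+ 2) ->
  \sum_(0 <= i < n ^ l) kap l x i * g l i @[l --> \oo] --> h ->
  hlap n p f x = h.
Proof.
move=> fg gh.
have d0 : \sum_(1 <= r < l.+1) p r * Eavg n r f x -
    \sum_(0 <= i < n ^ l) kap l x i * g l i @[l --> \oo] --> 0.
  apply/norm_cvg0P.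
  have z : tl 0%N * (tl l / b ^+ 2) @[l --> \oo] --> 0.
    by rewrite -(mulr0 (tl 0%N)); apply: cvgM => //; exact: cvg_cst.
  apply: (squeeze_cvgr _ (cvg_cst 0) z); exists (maxn x0 x) => // l /= xl.
  rewrite normr_ge0 /=.
  have xx0 : (x0 <= l)%N by apply: leq_trans xl; exact: leq_maxl.
  have xn : (x < n ^ l)%N.
    by apply: leq_ltn_trans (ltn_expl l n2); apply: leq_trans xl; exact: leq_maxr.
  rewrite kap_Eavg// -sumrB; apply: le_trans (ler_norm_sum _ _ _) _.
  apply: (@le_trans _ _ (\sum_(1 <= r < l.+1) p r * (tl l / b ^+ 2))).
    rewrite big_nat [leRHS]big_nat; apply: ler_sum => r /andP[r1 _].
    rewrite -mulrBr normrM ger0_norm ?(ltW (p0 r1))//.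
    by apply: ler_wpM2l; [exact: ltW (p0 r1)|apply: Eavg_dist => y; exact: fg].
  rewrite -mulr_suml; apply: ler_wpM2r; first by rewrite divr_ge0// ?tl_ge0// sqr_ge0.
  exact: tlP.
have T : \sum_(1 <= r < l.+1) p r * Eavg n r f x @[l --> \oo] --> h.
  rewrite (_ : (fun l => _) = (fun l => (\sum_(1 <= r < l.+1) p r * Eavg n r f x -
    \sum_(0 <= i < n ^ l) kap l x i * g l i) + \sum_(0 <= i < n ^ l) kap l x i * g l i)).
    by rewrite -(add0r h); exact: cvgD.
  by apply/funext => l; rewrite subrK.
(* The partial sums in [hlap] have an exclusive upper bound, hence the shift by one. *)
by rewrite /hlap; apply/cvg_lim => //; rewrite -cvg_shiftS; exact: T.
Qed.

Lemma resolvent_eq x :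
  hlap n p Ulim x + (w x - a) * Ulim x + b * Vlim x = (x == x0)%:R /\
  hlap n p Vlim x + (w x - a) * Vlim x - b * Ulim x = 0.
Proof.
have [cu du] := Ulim_cvg x; have [cv dv] := Vlim_cvg x.
have near_x : \forall l \near \oo, fsys (n ^ l) l (gu l) (gv l) /\ (x < n ^ l)%N.
  exists (maxn x0 x) => // l /= xl; split.
    by apply: fsys_level; apply: x0lt; apply: leq_trans xl; exact: leq_maxl.
  by apply: leq_ltn_trans (ltn_expl l n2); apply: leq_trans xl; exact: leq_maxr.
split.
  rewrite (@hlap_lim gu Ulim x ((x == x0)%:R - ((w x - a) * Ulim x + b * Vlim x))).
  - by rewrite -addrA subrK.
  - by move=> j y xj; have [_] := Ulim_cvg y; apply.
  - have h : (x == x0)%:R - ((w x - a) * gu l x + b * gv l x) @[l --> \oo] -->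
       ((x == x0)%:R - ((w x - a) * Ulim x + b * Vlim x) : R).
      apply: cvgB; first exact: cvg_cst.
      by apply: cvgD; apply: cvgM => //; exact: cvg_cst.
    apply: cvg_trans h; apply: near_eq_cvg; move: near_x; apply: filterS => l [/(_ x) fs xl].
    by have [<- _] := fs xl; ring.
rewrite (@hlap_lim gv Vlim x (b * Ulim x - (w x - a) * Vlim x)).
- by rewrite subrK subrr.
- by move=> j y xj; have [_] := Vlim_cvg y; apply.
- have h : b * gu l x - (w x - a) * gv l x @[l --> \oo] --> b * Ulim x - (w x - a) * Vlim x.
    by apply: cvgB; apply: cvgM => //; exact: cvg_cst.
  apply: cvg_trans h; apply: near_eq_cvg; move: near_x; apply: filterS => l [/(_ x) fs xl].
  have [_ E] := fs xl; move: E; set T := \sum_(_ <= _ < _) _ => E; lra.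
Qed.

Lemma Amx0 N l : Amx N l = Amx N l - Amx N 0.
Proof.
rewrite (_ : Amx N 0 = 0) ?subr0//; apply/matrixP => i j; rewrite !mxE /kap big_geq//.
Qed.

(** Uniform in [l]: the equation writes w (u + iv) as the delta function minus the kinetic part plus
    z (u + iv), each bounded in l^2. The factor 4 is from squaring sums of at most four terms. *)
Lemma level_domain l : (x0 < n ^ l)%N ->
  \sum_(0 <= x < n ^ l) (gu l x ^+ 2 + gv l x ^+ 2) * (1 + w x ^+ 2) <=
  b ^- 2 + 4 * (1 + (tl 0%N ^+ 2 + a ^+ 2 + b ^+ 2) * b ^- 2).
Proof.
move=> h; have fs := fsys_level h; have lb := level_bound h.
have b2 : 0 < b ^+ 2 by rewrite exprn_gt0.
set S := S2 (gu l) (gv l) (n ^ l) in lb.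
have Sb : S <= b ^- 2 by rewrite -[b ^- 2]mul1r ler_pdivlMr// mulrC.
pose K (f : nat -> R) x := \sum_(0 <= i < n ^ l) kap l x i * f i.
have sch (f : nat -> R) : \sum_(0 <= x < n ^ l) K f x ^+ 2 <= tl 0%N ^+ 2 * \sum_(0 <= x < n ^ l) f x ^+ 2.
  have := schur_norm (fun x y => Adiff_ge0 x y (leq0n l)) (Adiff_sym (n ^ l) 0 l)
   (fun x => Adiff_row x (leq0n l)) (\col_(i < n ^ l) f i) (tl_ge0 0%N).
  rewrite -Amx0 /cnorm2 !big_mkord; under [X in _ <= _ * X]eq_bigr do rewrite mxE.
  move=> hh; apply: le_trans hh; rewrite le_eqVlt; apply/orP; left; apply/eqP.
  apply: eq_bigr => i _; rewrite mxE /K big_mkord; congr (_ ^+ 2); apply: eq_bigr => j _.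
  by rewrite !mxE.
have su := sch (gu l); have sv := sch (gv l).
have sd : \sum_(0 <= x < n ^ l) ((x == x0)%:R : R) = 1.
  rewrite big_mkord (bigD1 (Ordinal h))//= eqxx big1 ?addr0// => i ih.
  by rewrite (_ : (i == x0 :> nat) = false)//; exact: negbTE.
have SE : S = \sum_(0 <= x < n ^ l) gu l x ^+ 2 + \sum_(0 <= x < n ^ l) gv l x ^+ 2.
  by rewrite -big_split.
apply: (@le_trans _ _ (S + 4 * (1 + (tl 0%N ^+ 2 + a ^+ 2 + b ^+ 2) * S))); last first.
  by apply: lerD => //; rewrite ler_pM2l// lerD2l ler_wpM2l// !addr_ge0// sqr_ge0.
apply: (@le_trans _ _ (\sum_(0 <= x < n ^ l) ((gu l x ^+ 2 + gv l x ^+ 2) +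
   4 * ((x == x0)%:R + (K (gu l) x ^+ 2 + K (gv l) x ^+ 2) + (a ^+ 2 + b ^+ 2) * (gu l x ^+ 2 + gv l x ^+ 2))))).
  rewrite big_nat [leRHS]big_nat; apply: ler_sum => x /andP[_ xl].
  have [E1 E2] := fs x xl; rewrite -!/(K _ _) in E1 E2.
  have d2 : ((x == x0)%:R : R) ^+ 2 = (x == x0)%:R by case: eqP => _; rewrite ?expr1n ?expr0n.
  have W1 : w x * gu l x = (x == x0)%:R - K (gu l) x + a * gu l x - b * gv l x by move: E1; lra.
  have W2 : w x * gv l x = a * gv l x + b * gu l x - K (gv l) x by move: E2; lra.
  rewrite mulrDr mulr1 lerD2l [_ * w x ^+ 2]mulrDl -!exprMn ![_ * w x]mulrC W1 W2 -{2}d2.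
  move: ((x == x0)%:R) (K (gu l) x) (K (gv l) x) (gu l x) (gv l x) => d k1 k2 u v.
  have q1 (y1 y2 y3 y4 : R) : (y1 - y2 + y3 - y4) ^+ 2 <= 4 * (y1 ^+ 2 + y2 ^+ 2 + y3 ^+ 2 + y4 ^+ 2).
    have t1 := sqr_ge0 (y1 + y2); have t2 := sqr_ge0 (y1 - y3); have t3 := sqr_ge0 (y1 + y4).
    have t4 := sqr_ge0 (y2 + y3); have t5 := sqr_ge0 (y2 - y4); have t6 := sqr_ge0 (y3 + y4).
    nra.
  have q2 (y1 y2 y3 : R) : (y1 + y2 - y3) ^+ 2 <= 4 * (y1 ^+ 2 + y2 ^+ 2 + y3 ^+ 2).
    have t1 := sqr_ge0 (y1 - y2); have t2 := sqr_ge0 (y1 + y3); have t3 := sqr_ge0 (y2 + y3).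
    have s1 := sqr_ge0 y1; have s2 := sqr_ge0 y2; have s3 := sqr_ge0 y3.
    nra.
  apply: le_trans (lerD (q1 d k1 (a * u) (b * v)) (q2 (a * v) (b * u) k2)) _.
  by rewrite le_eqVlt; apply/orP; left; apply/eqP; ring.
rewrite big_split /= -/S lerD2l -mulr_sumr ler_pM2l//.
rewrite !big_split /= sd -mulr_sumr big_split /= -SE -addrA lerD2l.
by have := lerD su sv; rewrite -mulrDr -SE; lra.
Qed.

(** As in Fatou's lemma: each finite partial sum is a limit of sums bounded by [level_domain]. *)
Lemma resolvent_domain : in_dom w Ulim Vlim.
Proof.
rewrite /in_dom; apply: nondecreasing_is_cvgn.
  apply/nondecreasing_seqP => m; rewrite !seriesEnat /= big_nat_recr//= lerDl.
  by rewrite mulr_ge0// addr_ge0// sqr_ge0.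
exists (b ^- 2 + 4 * (1 + (tl 0%N ^+ 2 + a ^+ 2 + b ^+ 2) * b ^- 2)) => _ [m _ <-].
rewrite seriesEnat /=.
have h : \sum_(0 <= x < m) (gu l x ^+ 2 + gv l x ^+ 2) * (1 + w x ^+ 2) @[l --> \oo] -->
   \sum_(0 <= x < m) (Ulim x ^+ 2 + Vlim x ^+ 2) * (1 + w x ^+ 2).
  apply: cvg_bigsum => x; have [cu _] := Ulim_cvg x; have [cv _] := Vlim_cvg x.
  apply: cvgM; last exact: cvg_cst.
  have sq (f : nat -> R) (c : R) : f l @[l --> \oo] --> c -> f l ^+ 2 @[l --> \oo] --> c ^+ 2.
    by move=> fc; rewrite expr2; under eq_fun do rewrite expr2; exact: cvgM.
  by apply: cvgD; exact: sq.
apply: (cvgr_to_le h); exists (maxn x0 m) => // l /= xl.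
have xx0 : (x0 <= l)%N by apply: leq_trans xl; exact: leq_maxl.
have ml : (m <= n ^ l)%N.
  by apply: ltnW; apply: leq_ltn_trans (ltn_expl l n2); apply: leq_trans xl; exact: leq_maxr.
apply: le_trans (level_domain (x0lt xx0)).
rewrite [leRHS](@big_cat_nat _ _ _ m)//= lerDl sumr_ge0// => x _.
by rewrite mulr_ge0// addr_ge0// sqr_ge0.
Qed.

Lemma resolvent_solP : resolvent_sol n p w x0 a b Ulim Vlim.
Proof. by split; [exact: resolvent_domain|exact: resolvent_eq]. Qed.

End Levels.
End HierarchicalKernel.

(** * Mean measures of rescaled eigenvalues *)

Section SpectralIntensity.
Context {R : realType}.
Variables (mu : set R -> \bar R) (Q : probability (@seqR R) R) (M : R).
Hypotheses (muT : mu setT = 1%E) (HQ : iid_law mu Q) (M0 : 0 < M).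
Hypothesis muM : forall A, measurable A -> (mu A <= M%:E * lebesgue_measure A)%E.
Variables (N : nat) (A0 : 'M[R]_N) (sc e : R).
Hypotheses (A0s : A0^T = A0) (N0 : (0 < N)%N) (sc0 : 0 < sc).

Definition rv (i : nat) (w : @seqR R) : measurableTypeR R := sc * (ev A0 i w - e).

Lemma measurable_rv i : measurable_fun setT (rv i).
Proof.
apply: measurable_funM => //; apply: measurable_funB => //.
have [iN|iN] := ltnP i N; first exact: measurable_ev.
rewrite (_ : (ev A0 i : seqR -> R) = cst 0); first exact: measurable_cst.
by apply/funext => w; rewrite /ev nth_default// size_evs// Hw_sym.
Qed.

Definition rvm i : {mfun (@seqR R) >-> measurableTypeR R} :=
  mfun_Sub (mem_set (measurable_rv i)).

(** [c] times the mean of the rescaled eigenvalue process, built from the laws of single eigenvalues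
    so that it is a measure by construction; [c] will be the number of blocks. *)
Definition nu0 (c : {nonneg R}) := mscale c (msum (fun i => distribution Q (rvm i)) N).

Definition cntA (A : set R) (w : nat -> R) : nat :=
  count (fun t => (sc * (t - e)) \in A) (evs (Hw A0 w)).

Lemma cntAE A w : (cntA A w)%:R = \sum_(i < N) \1_A (rv i w) :> R.
Proof. by rewrite /cntA count_ev// natr_sum; apply: eq_bigr => i _; rewrite indicE. Qed.

Lemma measurable_cntA A : measurable A ->
  measurable_fun setT (fun w : seqR => (cntA A w)%:R : R).
Proof.
move=> mA; under eq_fun do rewrite cntAE; apply: measurable_sum => i.
by apply: (measurableT_comp _ (measurable_rv i)); exact: measurable_indic.
Qed.

Lemma measurable_cntA_eq A r : measurable A -> measurable [set w : seqR | cntA A w = r].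
Proof.
move=> mA; rewrite (_ : [set _ | _] = (fun w : seqR => (cntA A w)%:R : R) @^-1` [set r%:R]).
  by rewrite -[X in measurable X]setTI; apply: measurable_cntA.
by apply/seteqP; split => w /=; [move=> ->|move/eqP; rewrite eqr_nat => /eqP].
Qed.

Lemma nu0_integral c (g : measurableTypeR R -> \bar R) : measurable_fun setT g ->
  (forall t, 0 <= g t)%E ->
  (\int[nu0 c]_t g t = (c%:num)%:E * \int[Q]_w (\sum_(i < N) g (rv i w)))%E.
Proof.
move=> mg g0; rewrite ge0_integral_mscale//; congr (_ * _)%E.
rewrite ge0_integral_measure_sum// ge0_integral_sum//; last first.
  by move=> i; apply: (measurableT_comp mg (measurable_rv i)).
apply: eq_bigr => i _; rewrite ge0_integral_pushforward//.
Qed.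

Lemma nu0E c A : measurable A -> nu0 c A = ((c%:num)%:E * \int[Q]_w (cntA A w)%:R%:E)%E.
Proof.
move=> mA; transitivity (\int[nu0 c]_t (\1_A t)%:E)%E.
  by rewrite integral_indic// setIT.
rewrite nu0_integral.
- by congr (_ * _)%E; apply: eq_integral => w _; rewrite sumEFin cntAE.
- by apply/measurable_EFinP; exact: measurable_indic.
- by move=> t; rewrite lee_fin indicE.
Qed.

Lemma wegnerA A : measurable A ->
  (\int[Q]_w (cntA A w)%:R%:E <= (N%:R * (M * pi) / sc)%:E * lebesgue_measure A)%E.
Proof.
move=> mA; have := nu0E (NngNum (@ler01 R)) mA; rewrite /= mul1e => <-.
apply: measure_le_lebesgue => //.
  by rewrite divr_gt0// !mulr_gt0 ?ltr0n// pi_gt0.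
move=> u v uv; have mI : measurable `[u, v]%classic by exact: measurable_itv.
have E := nu0E (NngNum (@ler01 R)) mI; rewrite /= mul1e in E.
apply: (@le_trans _ _ (nu0 (NngNum (@ler01 R)) `[u, v]%classic)); first exact: lexx.
rewrite E {E}.
have uv' : e + u / sc < e + v / sc by rewrite ltrD2l ltr_pM2r// invr_gt0.
have := wegner muT HQ (ltW M0) muM A0s uv'.
have -> : N%:R * ((e + v / sc - (e + u / sc)) * (M * pi)) = N%:R * (M * pi) / sc * (v - u).
  by field; rewrite gt_eqF.
apply: le_trans; rewrite le_eqVlt; apply/orP; left; apply/eqP.
apply: eq_integral => w _; congr ((_%:R)%:E); apply: eq_count => t.
have E : (u <= sc * (t - e) <= v) = (e + u / sc <= t <= e + v / sc).
  have E1 : (e + u / sc <= t) = (u <= sc * (t - e)) by rewrite -lerBrDl ler_pdivrMr// mulrC.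
  have E2 : (t <= e + v / sc) = (sc * (t - e) <= v) by rewrite -lerBlDl ler_pdivlMr// mulrC.
  by rewrite E1 E2.
by rewrite -E; apply/idP/idP; rewrite inE /= in_itv.
Qed.

Lemma minamiA (A : set R) K : 0 < K -> measurable A -> A `<=` `]- K, K]%classic ->
  (\int[Q]_w ((cntA A w)%:R * ((cntA A w)%:R - 1))%:E <=
   ((N%:R * (3 * K / sc * (M * pi))) ^+ 2)%:E)%E.
Proof.
move=> K0 mA AK.
(* [minami] is stated for intervals closed on the left and open on the right; [-K, 2K[ contains ]-K,
   K], whence the length 3 K. *)
have uv : e - K / sc < e + 2 * K / sc.
  have : 0 < K / sc by rewrite divr_gt0.
  by rewrite -mulrA; lra.
have := minami muT HQ (ltW M0) muM A0s uv.
have -> : e + 2 * K / sc - (e - K / sc) = 3 * K / sc by field; rewrite gt_eqF.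
apply: le_trans.
set c := fun w : nat -> R => count (fun t => e - K / sc <= t < e + 2 * K / sc) (evs (Hw A0 w)).
have cc w : (cntA A w <= c w)%N.
  apply: sub_count => t; rewrite inE => /AK; rewrite /= in_itv /= => /andP[h1 h2].
  have : - (K / sc) <= t - e by rewrite -mulNr ler_pdivrMr// mulrC ltW.
  have : t - e <= K / sc by rewrite ler_pdivlMr// mulrC.
  have : 0 < K / sc by rewrite divr_gt0.
  by rewrite -mulrA; move=> ? ? ?; apply/andP; split; lra.
have nn (m : nat) : 0 <= m%:R * (m%:R - 1) :> R.
  by case: m => [|m]; rewrite ?mul0r// -natr1 addrK mulr_ge0.
apply: ge0_le_integral => //.
- by move=> w _; rewrite lee_fin.
- apply/measurable_EFinP; apply: measurable_funM; first exact: measurable_cntA.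
  by apply: measurable_funB => //; exact: measurable_cntA.
- have mc : measurable_fun setT (fun w : seqR => (c w)%:R : R).
    apply: measurable_count => //.
    rewrite (_ : [set _ | _] = `[e - K / sc, e + 2 * K / sc[%classic); first exact: measurable_itv.
    by apply/seteqP; split => t /=; rewrite in_itv.
  by apply/measurable_EFinP; apply: measurable_funM => //; exact: measurable_funB.
move=> w _; rewrite lee_fin -/(c w); have := cc w.
case: (cntA A w) => [|x]; first by rewrite mul0r.
case: (c w) => // y xy; rewrite -!natr1 !addrK.
by apply: ler_pM => //; rewrite ?addr_ge0// ?lerD2r ler_nat.
Qed.

End SpectralIntensity.

(** * The truncated matrix as a direct sum of blocks *)

Section BlockDecomposition.
Context {R : realType}.
Variables (n : nat) (p : nat -> R).
Hypothesis n2 : (2 <= n)%N.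

Lemma kap_shift j x y : kap n p j (n ^ j + x) (n ^ j + y) = kap n p j x y.
Proof.
rewrite /kap big_nat [RHS]big_nat; apply: eq_bigr => s /andP[_ sj].
have d : (n ^ s %| n ^ j)%N by rewrite dvdn_exp2l.
by rewrite !divnDl// eqn_add2l.
Qed.

(** Peel off the first block: [kap_out] kills the off-diagonal blocks, and by [kap_shift] the rest
    is the same matrix with a shifted potential. *)
Lemma count_blocks j L (q : pred R) N w : N = (L * n ^ j)%N ->
  count q (evs (Hw (Amx n p N j) w)) =
  (\sum_(l < L) count q (evs (Hw (Amx n p (n ^ j) j) (sh (n ^ j) l w))))%N.
Proof.
move=> ->; elim: L w => [|L IH] w.
  rewrite big_ord0; apply/eqP; rewrite -leqn0 -[X in (_ <= X)%N](size_evs (Hw_sym (Amx_sym n p (0 * n ^ j) j) w)).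
  exact: count_size.
set m := (n ^ j)%N; pose w' := sh m 1 w.
have Hs N' v := Hw_sym (Amx_sym n p N' j) v.
have HE : Hw (Amx n p (L.+1 * m) j) w =
  block_mx (Hw (Amx n p m j) w) 0 0 (Hw (Amx n p (L * m) j) w') :> 'M[R]_(m + L * m).
  rewrite -[LHS](@submxK R m (L * m) m (L * m)); congr block_mx; apply/matrixP => i k; rewrite !mxE /=.
  - by rewrite (inj_eq (@lshift_inj _ _)).
  - rewrite eq_lrshift mulr0n addr0.
    rewrite -[kap _ _ _ _ _](_ : kap n p j (m + k) i = _).
      by rewrite (kap_out p n2)// leq_addr.
    by rewrite /kap; apply: eq_bigr => s _; rewrite eq_sym.
  - by rewrite eq_rlshift mulr0n addr0 (kap_out p n2)// leq_addr.
  - by rewrite (inj_eq (@rshift_inj _ _)) kap_shift /w' /sh mul1n.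
have el : eigenvalue_list (Hw (Amx n p (L.+1 * m) j) w)
   (evs (Hw (Amx n p m j) w) ++ evs (Hw (Amx n p (L * m) j) w')).
  rewrite /eigenvalue_list HE /char_poly char_block_diag_mx det_ublock big_cat /=.
  by have [e1 _] := evsP (Hs m w); have [e2 _] := evsP (Hs (L * m)%N w'); rewrite -e1 -e2.
have /permP -> := eigenvalue_list_evs (Hs _ w) el.
rewrite count_cat big_ord_recl; congr addn; rewrite IH.
apply: eq_bigr => l _; congr (count q (evs (Hw _ _))).
by apply/funext => i; rewrite /w' /sh /= /bump /= -/m; congr w; lia.
Qed.

End BlockDecomposition.

(** * Truncation does not change the counts *)

Section Transfer.
Context {R : realType}.
Variables (mu : set R -> \bar R) (Q : probability (@seqR R) R) (M : R).
Hypotheses (muT : mu setT = 1%E) (HQ : iid_law mu Q) (M0 : 0 < M).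
Hypothesis muM : forall A, measurable A -> (mu A <= M%:E * lebesgue_measure A)%E.
Variables (n : nat) (p tl : nat -> R).
Hypotheses (n2 : (2 <= n)%N) (p0 : forall r, (1 <= r)%N -> 0 < p r)
  (tlP : forall j l, (j <= l)%N -> \sum_(j.+1 <= s < l.+1) p s <= tl j)
  (tlp : forall j, 0 < tl j).
Variable (e : R) (J : nat -> nat).
Hypotheses (Jk : forall k, (J k <= k)%N)
  (small : (n ^ k)%:R * tl (J k) @[k --> \oo] --> 0).

Let sc k : R := (n ^ k)%:R.
Let sc0 k : 0 < sc k. Proof. by rewrite ltr0n expn_gt0; lia. Qed.
Definition cK k := cntA (Amx n p (n ^ k) k) (n ^ k)%:R e.
Definition cJ k := cntA (Amx n p (n ^ k) (J k)) (n ^ k)%:R e.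

Let leq_count k r (lam : R) (w : nat -> R) :=
  count (fun t => t <= lam) (evs (Hw (Amx n p (n ^ k) r) w)).

(** The two forms differ by at most d = [tl (J k)], so no eigenvalue moves further than d. The upper
    margin is 2 d because the count up to and including [lam] is first majorised by the strict count
    below lam + d. *)
Lemma leq_count_stable k lam w :
  count (fun t => lam - tl (J k) <= t <= lam + 2 * tl (J k)) (evs (Hw (Amx n p (n ^ k) (J k)) w)) = 0%N ->
  leq_count k k lam w = leq_count k (J k) lam w.
Proof.
move=> c0; set d := tl (J k) in c0.
have d0 : 0 < d by exact: tlp.
have Hs r := Hw_sym (Amx_sym n p (n ^ k) r) w.
have quad (x : 'rV[R]_(n ^ k)) : `|(x *m Hw (Amx n p (n ^ k) k) w *m x^T) 0 0 - (x *m Hw (Amx n p (n ^ k) (J k)) w *m x^T) 0 0|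
    <= d * (x *m x^T) 0 0.
  have := schur_quad (fun y z => Adiff_ge0 n2 p0 y z (Jk k)) (Adiff_sym n p (n ^ k) (J k) k)
    (fun y => Adiff_row n2 p0 tlP y (Jk k)) x.
  rewrite mulmxBr mulmxBl !quad_Hw; apply: le_trans; rewrite le_eqVlt; apply/orP; left; apply/eqP.
  have mB (X Y : 'M[R]_1) : (X - Y) 0 0 = X 0 0 - Y 0 0 by rewrite !mxE.
  by congr `|_|; rewrite mB; ring.
have lo mu' : (count (fun t => t < mu' - d)%R (evs (Hw (Amx n p (n ^ k) (J k)) w)) <=
    count (fun t => t < mu')%R (evs (Hw (Amx n p (n ^ k) k) w)))%N.
  by apply: count_lt_le_shift => // x; have := quad x; rewrite ler_norml => /andP[_]; lra.
have hi mu' : (count (fun t => t < mu' - d)%R (evs (Hw (Amx n p (n ^ k) k) w)) <=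
    count (fun t => t < mu')%R (evs (Hw (Amx n p (n ^ k) (J k)) w)))%N.
  by apply: count_lt_le_shift => // x; have := quad x; rewrite ler_norml => /andP[+ _]; lra.
set lJ := evs (Hw (Amx n p (n ^ k) (J k)) w) in c0 lo hi *.
have eqJ : (count (fun t => t < lam - d)%R lJ = count (fun t => t < lam + 2 * d)%R lJ)%N.
  have od : lam - d <= lam + 2 * d by lra.
  have := count_co (ltW M0) lJ od.
  suff -> : count (fun t => lam - d <= t < lam + 2 * d) lJ = 0%N by [].
  apply/eqP; rewrite -leqn0 -[X in (_ <= X)%N]c0; apply: sub_count => t /= /andP[-> /ltW ->]//.
have h1 : (count (fun t => t < lam)%R (evs (Hw (Amx n p (n ^ k) k) w)) <= leq_count k k lam w)%N.
  by apply: sub_count => t /= /ltW.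
have h2 : (leq_count k k lam w <= count (fun t => t < lam + 2 * d - d)%R (evs (Hw (Amx n p (n ^ k) k) w)))%N.
  by apply: sub_count => t /= ?; lra.
have h3 : (count (fun t => t < lam - d)%R lJ <= leq_count k (J k) lam w)%N.
  by apply: sub_count => t /= ?; lra.
have h4 : (leq_count k (J k) lam w <= count (fun t => t < lam + 2 * d)%R lJ)%N.
  by apply: sub_count => t /= ?; lra.
have h5 := lo lam; have h6 := hi (lam + 2 * d).
by apply/eqP; rewrite eqn_leq; apply/andP; split; lia.
Qed.

(** [B k] is the event that the window of length 3 [tl (J k)] is occupied; by Wegner its probability
    is at most a constant times n^k [tl (J k)]. *)
Lemma leq_count_differ lam :
  exists B : nat -> set (@seqR R), [/\ forall k, measurable (B k),
    (forall k w, ~ B k w -> leq_count k k (lam k) w = leq_count k (J k) (lam k) w) &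
    fine (Q (B k)) @[k --> \oo] --> 0].
Proof.
pose c k (w : nat -> R) := count (fun t => lam k - tl (J k) <= t <= lam k + 2 * tl (J k))
   (evs (Hw (Amx n p (n ^ k) (J k)) w)).
have mc k : measurable_fun setT (fun w : seqR => (c k w)%:R : R).
  apply: measurable_count; first exact: Amx_sym.
  rewrite (_ : [set _ | _] = `[lam k - tl (J k), lam k + 2 * tl (J k)]%classic); first exact: measurable_itv.
  by apply/seteqP; split => t /=; rewrite in_itv.
pose B k : set (@seqR R) := ~` ((fun w : seqR => (c k w)%:R : R) @^-1` [set 0]).
have mB k : measurable (B k).
  by apply: measurableC; rewrite -[X in measurable X]setTI; apply: mc.
exists B; split => //.
  move=> k w /contrapT /= /eqP; rewrite pnatr_eq0 => /eqP c0; exact: leq_count_stable.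
have bd k : fine (Q (B k)) <= 3 * (M * pi) * ((n ^ k)%:R * tl (J k)).
  have uv : lam k - tl (J k) < lam k + 2 * tl (J k) by have := tlp (J k); lra.
  have W := wegner muT HQ (ltW M0) muM (Amx_sym n p (n ^ k) (J k)) uv.
  rewrite -lee_fin fineK ?fin_num_measure//.
  have -> : (3 * (M * pi) * ((n ^ k)%:R * tl (J k))) =
    (n ^ k)%:R * ((lam k + 2 * tl (J k) - (lam k - tl (J k))) * (M * pi)) by ring.
  apply: le_trans W; rewrite -[Q (B k)]/(Q (B k)) -[B k]setIT -integral_indic//.
  apply: ge0_le_integral => //.
  - by apply/measurable_EFinP; exact: measurable_indic.
  - by apply/measurable_EFinP; exact: mc.
  move=> w _; rewrite lee_fin indicE; case: (boolP (w \in _)) => //.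
  by rewrite inE /B /= => /eqP; rewrite pnatr_eq0 -lt0n => h; rewrite ler1n.
have z : 3 * (M * pi) * ((n ^ k)%:R * tl (J k)) @[k --> \oo] --> 0.
  by rewrite -(mulr0 (3 * (M * pi))); apply: cvgM => //; exact: cvg_cst.
apply: (squeeze_cvgr _ (cvg_cst 0) z); near=> k.
by rewrite bd andbT fine_ge0.
Unshelve. all: by end_near. Qed.

(** [dynkin_vanish] for the probability that the counts in B differ. Differing counts are not both
    zero, so Wegner for each matrix gives the Lebesgue bound; on an interval the counts can differ
    only if a threshold count differs at an endpoint. *)
Lemma transfer (A : set R) K : measurable A -> 0 < K -> A `<=` `]- K, K]%classic ->
  fine (Q [set w | cK k A w <> cJ k A w]) @[k --> \oo] --> 0.
Proof.
move=> mA K0 AK; set W := `]- K, K]%classic.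
have mW : measurable W by exact: measurable_itv.
pose D k (B : set R) : set (@seqR R) := [set w | cK k (B `&` W) w <> cJ k (B `&` W) w].
have As k r := Amx_sym n p (n ^ k) r.
have mD k B : measurable B -> measurable (D k B).
  move=> mB; have mBW := measurableI _ _ mB mW.
  rewrite (_ : D k B = ~` ((fun w : seqR => (cK k (B `&` W) w)%:R - (cJ k (B `&` W) w)%:R : R) @^-1` [set 0])).
    apply: measurableC; rewrite -[X in measurable X]setTI.
    suff h : measurable_fun setT (fun w : seqR => (cK k (B `&` W) w)%:R - (cJ k (B `&` W) w)%:R : R) by exact: h.
    by apply: measurable_funB; [exact: (measurable_cntA _ _ (As k k) mBW)|exact: (measurable_cntA _ _ (As k (J k)) mBW)].
  apply/seteqP; split => w /= h h'; apply: h.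
    by move/eqP: h'; rewrite subr_eq0 eqr_nat => /eqP.
  by rewrite h' subrr.
pose g k B := fine (Q (D k B)).
have AW : A `&` W = A by apply: setIidl.
have -> : (fun k => fine (Q [set w | cK k A w <> cJ k A w])) = (fun k => g k A).
  by apply/funext => k; rewrite /g /D AW.
have sub2 (X Y Z : set (@seqR R)) : measurable X -> measurable Y -> measurable Z ->
    Z `<=` X `|` Y -> fine (Q Z) <= fine (Q X) + fine (Q Y).
  move=> mX mY mZ ZXY; rewrite -fineD ?fin_num_measure//; apply: fine_le; rewrite ?fin_numD ?fin_num_measure//.
  apply: le_trans (measureU2 _ mX mY); apply: le_measure; rewrite ?inE//; exact: measurableU.
have addc k r (B B' : set R) w : B `&` B' = set0 ->
  cntA (Amx n p (n ^ k) r) (n ^ k)%:R e ((B `|` B') `&` W) w =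
  (cntA (Amx n p (n ^ k) r) (n ^ k)%:R e (B `&` W) w + cntA (Amx n p (n ^ k) r) (n ^ k)%:R e (B' `&` W) w)%N.
  move=> BB'; rewrite /cntA; elim: (evs _) => //= t l ->.
  set y := (n ^ k)%:R * (t - e).
  have -> : ((y \in (B `|` B') `&` W) : nat) = ((y \in B `&` W) + (y \in B' `&` W))%N.
    rewrite !in_setI in_setU; case: (boolP (y \in B)) => h1; case: (boolP (y \in B')) => h2; try by case: (y \in W).
    exfalso; move: h1 h2; rewrite !inE => h1 h2; have : (B `&` B') y by split.
    by match goal with D : B `&` B' = set0 |- _ => rewrite D end.
  by rewrite addnACA.
apply: (@dynkin_vanish R K (2 * (M * pi)) g) => //.
- move=> k B mB; have mBW := measurableI _ _ mB mW.
  rewrite fine_ge0//=.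
  have fl : lebesgue_measure (B `&` W) \is a fin_num.
    rewrite ge0_fin_numE//; apply: (@le_lt_trans _ _ (lebesgue_measure W)).
      by apply: le_measure; rewrite ?inE; [exact: mBW|exact: mW|exact: subIsetr].
    by rewrite lebesgue_measure_itv /=; case: ifP => _; rewrite ?ltry// -EFinB ltry.
  have nk0 : (0 < n ^ k)%N by rewrite expn_gt0; lia.
  have W1 := wegnerA muT HQ M0 muM e (As k k) nk0 (sc0 k) mBW.
  have W2 := wegnerA muT HQ M0 muM e (As k (J k)) nk0 (sc0 k) mBW.
  have cE : (n ^ k)%:R * (M * pi) / sc k = M * pi by rewrite /sc; field; rewrite gt_eqF// sc0.
  rewrite cE in W1 W2.
  have fD : Q (D k B) \is a fin_num by apply: fin_num_measure; exact: mD.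
  rewrite /g -lee_fin (fineK fD) EFinM (fineK fl).
  have -> : ((2 * (M * pi))%:E * lebesgue_measure (B `&` W) =
     (M * pi)%:E * lebesgue_measure (B `&` W) + (M * pi)%:E * lebesgue_measure (B `&` W))%E.
    by rewrite -(fineK fl) -!EFinM -EFinD; congr EFin; ring.
  apply: le_trans (leeD W1 W2).
  have m1 : measurable_fun setT (fun w : seqR => (cK k (B `&` W) w)%:R : R) by exact: (measurable_cntA _ _ (As k k) mBW).
  have m2 : measurable_fun setT (fun w : seqR => (cJ k (B `&` W) w)%:R : R) by exact: (measurable_cntA _ _ (As k (J k)) mBW).
  rewrite -ge0_integralD//; [|exact/measurable_EFinP..].
  rewrite -[D k B]setIT -integral_indic//; last exact: mD.
  apply: ge0_le_integral => //.
  + by apply/measurable_EFinP; apply: measurable_indic; exact: mD.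
  + by apply: emeasurable_funD; exact/measurable_EFinP.
  move=> w _; rewrite -EFinD lee_fin -natrD indicE; case: (boolP (w \in _)) => //.
  rewrite inE /D /= -/(cK k _ w) -/(cJ k _ w) => h; rewrite ler1n lt0n addn_eq0.
  by apply/negP => /andP[/eqP e1 /eqP e2]; apply: h; rewrite e1 e2.
- move=> k B mB; have mB' := measurableC mB.
  apply: (sub2 _ _ _ (mD k B mB) (mD k setT measurableT) (mD k _ mB')) => w h.
  apply: contrapT => nU.
  have h1 : cK k (B `&` W) w = cJ k (B `&` W) w by apply: contrapT => ne; apply: nU; left.
  have h2 : cK k (setT `&` W) w = cJ k (setT `&` W) w by apply: contrapT => ne; apply: nU; right.
  apply: h; rewrite /cK /cJ in h1 h2 *; move: h2.
  by rewrite -(setUCr B) !addc ?setICr// h1 => /addnI.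
- move=> k B B' mB mB' BB'.
  apply: (sub2 _ _ _ (mD k B mB) (mD k B' mB') (mD k _ (measurableU _ _ mB mB'))) => w h.
  apply: contrapT => nU.
  have h1 : cK k (B `&` W) w = cJ k (B `&` W) w by apply: contrapT => ne; apply: nU; left.
  have h2 : cK k (B' `&` W) w = cJ k (B' `&` W) w by apply: contrapT => ne; apply: nU; right.
  by apply: h; rewrite /cK /cJ in h1 h2 *; rewrite !addc// h1 h2.
- move=> X oX; have oW : ocitv W by exists (- K, K).
  have [[u v] _ /= E] := ocitvI oX oW.
  have [B1 [mB1 hB1 l1]] := leq_count_differ (fun k => e + u / sc k).
  have [B2 [mB2 hB2 l2]] := leq_count_differ (fun k => e + v / sc k).
  have z : fine (Q (B1 k)) + fine (Q (B2 k)) @[k --> \oo] --> 0.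
    by rewrite -(addr0 0); exact: cvgD.
  have mX : measurable X by case: oX => [[x y] _ <-]; exact: measurable_itv.
  apply: (squeeze_cvgr _ (cvg_cst 0) z); near=> k; rewrite fine_ge0//=.
  apply: (sub2 _ _ _ (mB1 k) (mB2 k) (mD k X mX)) => w h; apply: contrapT => nU.
  have h1 : ~ B1 k w by move=> b1; apply: nU; left.
  have h2 : ~ B2 k w by move=> b2; apply: nU; right.
  apply: h; rewrite -E.
  have [uv|vu] := leP u v; last first.
    have z0 r : cntA (Amx n p (n ^ k) r) (n ^ k)%:R e `]u, v]%classic w = 0%N.
      rewrite /cntA set_itv_ge ?bnd_simp -?leNgt ?(ltW vu)//.
      by apply/eqP; rewrite -leqn0 leqNgt -has_count; apply/hasP => -[t _]; rewrite in_set0.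
    by rewrite /cK /cJ !z0.
  have cE r : (cntA (Amx n p (n ^ k) r) (n ^ k)%:R e `]u, v]%classic w +
      leq_count k r (e + u / sc k) w = leq_count k r (e + v / sc k) w)%N.
    rewrite /cntA /leq_count; elim: (evs _) => //= t l <-.
    set y := (n ^ k)%:R * (t - e).
    have uE : (t <= e + u / sc k) = (y <= u) by rewrite -lerBlDl ler_pdivlMr// mulrC.
    have vE : (t <= e + v / sc k) = (y <= v) by rewrite -lerBlDl ler_pdivlMr// mulrC.
    have -> : (y \in `]u, v]%classic) = (u < y <= v).
      by apply/idP/idP; rewrite inE /= in_itv.
    rewrite uE vE; case: (leP y (u)) => [h3|h3] /=; last by rewrite add0n addnA.
    have -> : y <= v by exact: le_trans h3 uv.
    by rewrite add0n addnCA.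
  have e1 : leq_count k k (e + u / sc k) w = leq_count k (J k) (e + u / sc k) w := hB1 _ _ h1.
  have e2 : leq_count k k (e + v / sc k) w = leq_count k (J k) (e + v / sc k) w := hB2 _ _ h2.
  have ck := cE k; rewrite e1 e2 -(cE (J k)) in ck.
  by apply/eqP; rewrite -(eqn_add2r (leq_count k (J k) (e + u / sc k) w)); apply/eqP; exact: ck.
- have [B1 [mB1 hB1 l1]] := leq_count_differ (fun k => e + (- K) / sc k).
  have [B2 [mB2 hB2 l2]] := leq_count_differ (fun k => e + K / sc k).
  have z : fine (Q (B1 k)) + fine (Q (B2 k)) @[k --> \oo] --> 0.
    by rewrite -(addr0 0); exact: cvgD.
  apply: (squeeze_cvgr _ (cvg_cst 0) z); near=> k; rewrite fine_ge0//=.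
  apply: (sub2 _ _ _ (mB1 k) (mB2 k) (mD k setT measurableT)) => w h; apply: contrapT => nU.
  have h1 : ~ B1 k w by move=> b1; apply: nU; left.
  have h2 : ~ B2 k w by move=> b2; apply: nU; right.
  apply: h.
  have cE r : (cntA (Amx n p (n ^ k) r) (n ^ k)%:R e (setT `&` W) w +
      leq_count k r (e + (- K) / sc k) w = leq_count k r (e + K / sc k) w)%N.
    rewrite setTI /cntA /leq_count; elim: (evs _) => //= t l <-.
    set y := (n ^ k)%:R * (t - e).
    have uE : (t <= e + (- K) / sc k) = (y <= - K) by rewrite -lerBlDl ler_pdivlMr// mulrC.
    have vE : (t <= e + K / sc k) = (y <= K) by rewrite -lerBlDl ler_pdivlMr// mulrC.
    have -> : (y \in W) = (- K < y <= K).
      by apply/idP/idP; rewrite inE /W /= in_itv.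
    rewrite uE vE; case: (leP y (- K)) => [h3|h3] /=; last by rewrite add0n addnA.
    have -> : y <= K by lra.
    by rewrite add0n addnCA.
  have e1 : leq_count k k (e + (- K) / sc k) w = leq_count k (J k) (e + (- K) / sc k) w := hB1 _ _ h1.
  have e2 : leq_count k k (e + K / sc k) w = leq_count k (J k) (e + K / sc k) w := hB2 _ _ h2.
  have ck := cE k; rewrite e1 e2 -(cE (J k)) in ck.
  by apply/eqP; rewrite -(eqn_add2r (leq_count k (J k) (e + (- K) / sc k) w)); apply/eqP; exact: ck.
Unshelve. all: by end_near. Qed.

End Transfer.

(** * Homogeneity of the hierarchical structure *)

Section Homogeneity.
Context {R : realType}.

Lemma imG_reindex N (M M' : 'M[R]_N) (sg : 'I_N -> 'I_N) a b x :
  M^T = M -> M'^T = M' -> 0 < b -> injective sg ->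
  (forall i j, M' i j = M (sg i) (sg j)) -> imG M' a b x = imG M a b (sg x).
Proof.
move=> Ms M's b0 sgi h.
have [h1 h2] := res_pairP a Ms b0 (sg x).
pose u' := rowsub sg (resu M a b (sg x)); pose v' := rowsub sg (resv M a b (sg x)).
have mul (u : 'cV[R]_N) : (M' - a%:M) *m rowsub sg u = rowsub sg ((M - a%:M) *m u).
  apply/colP => i; rewrite !mxE [RHS](reindex_inj sgi) /=; apply: eq_bigr => j _.
  by rewrite !mxE h (inj_eq sgi).
have rp : res_pair M' a b (delta_mx x 0) 0 u' v'.
  split; rewrite mul.
    by apply/colP => i; have /colP/(_ (sg i)) := h1; rewrite !mxE (inj_eq sgi).
  by apply/colP => i; have /colP/(_ (sg i)) := h2; rewrite !mxE.
have [_ E] := res_pair_unique M's b0 (res_pairP a M's b0 x) rp.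
by rewrite -resvE E mxE resvE.
Qed.

Variables (n : nat) (p : nat -> R).
Hypothesis n2 : (2 <= n)%N.

(* Digitwise translation by [c] of the last [j] base-[n] digits. *)
Fixpoint digit_shift (j c x : nat) : nat :=
  if j is j'.+1 then (digit_shift j' (c %/ n) (x %/ n) * n + (x %% n + c %% n) %% n)%N else x.

(** There is no carry between digits, so dropping the last [s] digits commutes with the translation;
    hence balls go to balls. *)
Lemma digit_shift_div s j c x : (s <= j)%N ->
  (digit_shift j c x %/ n ^ s = digit_shift (j - s) (c %/ n ^ s) (x %/ n ^ s))%N.
Proof.
elim: s j c x => [|s IH] j c x; first by rewrite expn0 !divn1 subn0.
case: j => // j sj; rewrite expnS !divnMA /= divnMDl; last by lia.
by rewrite (divn_small (ltn_pmod _ _)) ?addn0 ?IH//; lia.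
Qed.

Lemma digit_shift_inj j c : injective (digit_shift j c).
Proof.
elim: j c => [|j IH] c x y //= E.
have n0 : (0 < n)%N by lia.
have Ed : (x %/ n = y %/ n)%N.
  apply: (IH (c %/ n)%N); have := congr1 (divn^~ n) E.
  by rewrite !divnMDl// !(divn_small (ltn_pmod _ n0)) !addn0.
have Em : (x %% n = y %% n)%N.
  have := congr1 (modn^~ n) E; rewrite !modnMDl !modn_mod => /eqP.
  by rewrite eqn_modDr !modn_mod => /eqP.
by rewrite (divn_eq x n) (divn_eq y n) Ed Em.
Qed.

Lemma digit_shift_lt j c x : (x < n ^ j)%N -> (digit_shift j c x < n ^ j)%N.
Proof.
move=> xj; have n0 : (0 < n ^ j)%N by rewrite expn_gt0; lia.
by rewrite -[X in (_ < X)%N]mul1n -ltn_divLR// digit_shift_div// subnn /= divn_small.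
Qed.

Lemma digit_shift_trans j x y : (x < n ^ j)%N -> (y < n ^ j)%N ->
  exists c, digit_shift j c x = y.
Proof.
elim: j x y => [|j IH] x y; first by rewrite expn0 !ltnS !leqn0 => /eqP -> /eqP ->; exists 0%N.
have n0 : (0 < n)%N by lia.
rewrite expnSr => xj yj.
have [c cE] := IH (x %/ n)%N (y %/ n)%N ltac:(by rewrite ltn_divLR) ltac:(by rewrite ltn_divLR).
exists (c * n + (y %% n + (n - x %% n)) %% n)%N => /=.
rewrite divnMDl// (divn_small (ltn_pmod _ n0)) addn0 cE modnMDl modn_mod modnDmr.
have xn := ltn_pmod x n0.
have -> : (x %% n + (y %% n + (n - x %% n)) = y %% n + n)%N by lia.
by rewrite modnDr modn_mod -divn_eq.
Qed.

(** Some digit translation takes [x] to [y]; it preserves the kernel, and being injective on all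
    sites it preserves the law of the potential. *)
Lemma imG_homogeneous (mu : set R -> \bar R) (Q : probability (@seqR R) R) j a b (x y : 'I_(n ^ j)) :
  iid_law mu Q -> 0 < b ->
  (\int[Q]_w (imG (Hw (Amx n p (n ^ j) j) w) a b x)%:E =
   \int[Q]_w (imG (Hw (Amx n p (n ^ j) j) w) a b y)%:E)%E.
Proof.
move=> HQ b0; have As := Amx_sym n p (n ^ j) j.
have [c cE] := digit_shift_trans (ltn_ord x) (ltn_ord y).
have si := @digit_shift_inj j c.
pose sg (i : 'I_(n ^ j)) : 'I_(n ^ j) := Ordinal (digit_shift_lt c (ltn_ord i)).
have sgi : injective sg by move=> i i' [/si /val_inj].
have sgx : sg x = y by apply: val_inj.
have kE i i' : kap n p j (digit_shift j c i) (digit_shift j c i') = kap n p j i i'.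
  rewrite /kap big_nat [RHS]big_nat; apply: eq_bigr => s /andP[_ sj].
  by rewrite !digit_shift_div// (inj_eq (@digit_shift_inj _ _)).
have HE w i i' : Hw (Amx n p (n ^ j) j) (w \o digit_shift j c) i i' = Hw (Amx n p (n ^ j) j) w (sg i) (sg i').
  by rewrite !mxE (inj_eq sgi) /= kE.
rewrite [LHS](iid_integral_reindex HQ si); last 2 first.
- by apply/measurable_EFinP; exact: measurable_imG.
- by move=> w; rewrite lee_fin ltW// imG_gt0// Hw_sym.
apply: eq_integral => w _; congr EFin; rewrite -sgx.
by apply: imG_reindex => //; exact: Hw_sym.
Qed.

End Homogeneity.

Section TailEstimates.
Context {R : realType}.

Lemma geometric_tail (rho : R) j l : 1 < rho -> (j <= l)%N ->
  \sum_(j.+1 <= s < l.+1) rho ^- s <= rho ^- j / (rho - 1).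
Proof.
move=> r1; have r0 : 0 < rho by lra.
have rm : 0 < rho - 1 by lra.
suff E : forall d, \sum_(j.+1 <= s < (j + d).+1) rho ^- s = (rho ^- j - rho ^- (j + d)) / (rho - 1).
  move=> jl; rewrite -(subnKC jl) E ler_pM2r ?invr_gt0// lerBlDr lerDl.
  by rewrite invr_ge0 exprn_ge0// ltW.
elim=> [|d IH]; first by rewrite addn0 big_geq// subrr mul0r.
rewrite addnS big_nat_recr//=; last by lia.
rewrite IH exprS; have : rho ^+ (j + d) != 0 by rewrite expf_neq0 ?gt_eqF.
have : rho ^+ j != 0 by rewrite expf_neq0 ?gt_eqF.
move: (rho ^+ (j + d)) (rho ^+ j) => x y y0 x0.
by field; rewrite x0 y0 !gt_eqF.
Qed.

Lemma uphalf_pow_cvg0 (z : R) : `|z| < 1 -> z ^+ uphalf k @[k --> \oo] --> 0.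
Proof.
move=> z1; apply/cvgrPdist_lt => e e0.
have /cvgrPdist_lt/(_ e e0) [K _ hK] := cvg_expr z1.
exists K.*2 => // k /= Kk; apply: hK => /=.
by rewrite -(doubleK K) (leq_trans (half_leq Kk))// uphalfE half_leq.
Qed.

End TailEstimates.

(** * States of a single block *)

Section BlockStates.
Context {R : realType}.
Variables (mu : set R -> \bar R) (Q : probability (@seqR R) R) (M : R).
Hypotheses (muT : mu setT = 1%E) (HQ : iid_law mu Q) (M0 : 0 < M).
Hypothesis muM : forall A, measurable A -> (mu A <= M%:E * lebesgue_measure A)%E.
Variables (N : nat) (A0 : 'M[R]_N) (sc e K : R) (m : nat) (A : 'I_m -> set R).
Hypotheses (A0s : A0^T = A0) (N0 : (0 < N)%N) (sc0 : 0 < sc) (K0 : 0 < K)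
  (mA : forall s, measurable (A s)) (AK : forall s, A s `<=` `]- K, K]%classic)
  (dA : forall s s', s != s' -> A s `&` A s' = set0).

Local Notation cB := (cntA A0 sc e).

(** [None]: no rescaled eigenvalue in any [A s]. [Some s]: exactly one, and it is in [A s]. A block
    with two or more eigenvalues in the union is in no state. *)
Definition state (o : option 'I_m) : set (@seqR R) :=
  [set w | forall s, cB (A s) w = (o == Some s)].

Lemma measurable_state o : measurable (state o).
Proof.
rewrite (_ : state o = \big[setI/setT]_(s <- enum 'I_m) [set w : seqR | cB (A s) w = (o == Some s)]).
  by apply: bigsetI_measurable => s _; apply: measurable_cntA_eq; [exact: A0s|exact: mA].
rewrite -bigcap_seq; apply/seteqP; split => w /= h s; first by move=> _; exact: h.
by apply: h; rewrite /= mem_enum.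
Qed.

Lemma state_disjoint o o' : o != o' -> state o `&` state o' = set0.
Proof.
move=> oo'; apply/seteqP; split => // w [h h']; move/eqP: oo'; apply.
case: o o' h h' => [s|] [s'|] h h' //.
- by have := h s; rewrite (h' s) eqxx; case: eqP.
- by have := h s; rewrite (h' s) eqxx.
- by have := h' s'; rewrite (h s') eqxx.
Qed.

Lemma Hw_local (w w' : nat -> R) : (forall i, (i < N)%N -> w i = w' i) -> Hw A0 w = Hw A0 w'.
Proof.
move=> ww'; rewrite /Hw; congr (_ + diag_mx _); apply/rowP => i; rewrite !mxE; exact: ww'.
Qed.

Lemma state_local o (w w' : nat -> R) : (forall i, (i < N)%N -> w i = w' i) -> state o w -> state o w'.
Proof. by move=> ww' h s; rewrite -(h s) /cntA (Hw_local ww'). Qed.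

Definition AU := \bigcup_s A s.

Lemma measurable_AU : measurable AU.
Proof. by apply: countable_bigcupT_measurable => //; exact: countableP. Qed.

Lemma AU_sub : AU `<=` `]- K, K]%classic.
Proof. by move=> t [s _ h]; exact: AK h. Qed.

Lemma cntA_AU w : cB AU w = (\sum_s cB (A s) w)%N.
Proof.
rewrite /cntA; elim: (evs _) => [|t l IH] /=; first by rewrite big1.
rewrite IH big_split /=; congr addn.
case: (boolP (_ \in AU)) => [|h].
  rewrite inE => -[s _ h]; rewrite (bigD1 s)//= mem_set// big1// => s' s's.
  by apply/eqP; rewrite eqb0; apply/negP; rewrite inE => h'; have /seteqP[/(_ _ (conj h' h))] := dA s's.
rewrite big1// => s _; apply/eqP; rewrite eqb0; apply: contra h.
by rewrite !inE => h; exists s.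
Qed.

Lemma state_good w : (cB AU w <= 1)%N -> exists o, state o w.
Proof.
clear M0 N0 sc0 K0; rewrite cntA_AU => h.
have [h0|/existsNP[s hs]] := pselect (forall s, cB (A s) w = 0%N); first by exists None => s; rewrite h0.
exists (Some s) => s'; move: h; rewrite (bigD1 s)//=.
have [->|s's] := eqVneq s' s; first by rewrite eqxx; lia.
rewrite (inj_eq Some_inj) eq_sym (negbTE s's) (bigD1 s')//=; lia.
Qed.

Definition bad : set (@seqR R) := [set w | (1 < cB AU w)%N].
(** The second factorial moment, small by Minami; it bounds both the probability of [bad] and the
    error in replacing mean counts by probabilities of states. *)
Definition Ecc := (\int[Q]_w ((cB AU w)%:R * ((cB AU w)%:R - 1))%:E)%E.

Let mU := measurable_AU.
Let mcU : measurable_fun setT (fun w : seqR => (cB AU w)%:R : R) := measurable_cntA sc e A0s mU.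

Lemma measurable_bad : measurable bad.
Proof.
rewrite (_ : bad = (fun w : seqR => (cB AU w)%:R : R) @^-1` `]1, +oo[%classic).
  by rewrite -[X in measurable X]setTI; apply: mcU => //; exact: measurable_itv.
by apply/seteqP; split => w /=; rewrite in_itv /= andbT ltr1n.
Qed.

Let cc0 (x : nat) : 0 <= x%:R * (x%:R - 1) :> R.
Proof. by case: x => [|x]; rewrite ?mul0r// -natr1 addrK mulr_ge0. Qed.

Let mcc : measurable_fun setT (fun w : seqR => ((cB AU w)%:R * ((cB AU w)%:R - 1))%:E : \bar R).
Proof. by apply/measurable_EFinP; apply: measurable_funM => //; exact: measurable_funB. Qed.

Lemma Ecc_le : (Ecc <= ((N%:R * (3 * K / sc * (M * pi))) ^+ 2)%:E)%E.
Proof. exact: (minamiA muT HQ M0 muM e A0s sc0 K0 mU AU_sub). Qed.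

Lemma Ecc_fin : Ecc \is a fin_num.
Proof.
rewrite ge0_fin_numE; first exact: le_lt_trans Ecc_le (ltry _).
by apply: integral_ge0 => w _; rewrite lee_fin cc0.
Qed.

Lemma Q_bad_le : fine (Q bad) <= fine Ecc.
Proof.
clear N0.
apply: fine_le; rewrite ?Ecc_fin ?fin_num_measure//; try exact: measurable_bad.
rewrite /Ecc -[bad]setIT -integral_indic//; last exact: measurable_bad.
apply: ge0_le_integral => //.
- by apply/measurable_EFinP; apply: measurable_indic; exact: measurable_bad.
- move=> w _; rewrite lee_fin indicE; case: (boolP (w \in _)) => [|_]; last exact: cc0.
  rewrite inE /bad /=; case: (cB AU w) => [//|[//|x]] _.
  have h : 1 <= x.+1%:R :> R by rewrite ler1n.
  have -> : x.+2%:R = x.+1%:R + 1 :> R by rewrite natr1.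
  by rewrite addrK; move: x.+1%:R h => y h; nra.
Qed.

(** Off [bad] the count in [A s] is the indicator of [Some s]; on [bad] it is at most c, hence at
    most c (c - 1), with c >= 2 the count in the union. *)
Lemma first_moment s : let E1 := (\int[Q]_w (cB (A s) w)%:R%:E)%E in
  E1 \is a fin_num /\ `|fine E1 - fine (Q (state (Some s)))| <= fine Ecc.
Proof.
clear N0; move=> E1.
have mc : measurable_fun setT (fun w : seqR => (cB (A s) w)%:R%:E : \bar R).
  by apply/measurable_EFinP; exact: (measurable_cntA sc e A0s (mA s)).
have mS := measurable_state (Some s).
have mi : measurable_fun setT (fun w : seqR => (\1_(state (Some s)) w)%:E : \bar R).
  by apply/measurable_EFinP; apply: measurable_indic.
have qE : Q (state (Some s)) = (\int[Q]_w (\1_(state (Some s)) w)%:E)%E by rewrite integral_indic// setIT.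
have lo : (Q (state (Some s)) <= E1)%E.
  rewrite qE; apply: ge0_le_integral => // w _; rewrite lee_fin indicE.
  by case: (boolP (w \in _)) => //; rewrite inE => /(_ s) ->; rewrite eqxx.
have hi : (E1 <= Q (state (Some s)) + Ecc)%E.
  rewrite qE /Ecc -ge0_integralD//; last by move=> w _; rewrite lee_fin cc0.
  apply: ge0_le_integral => //; first exact: emeasurable_funD.
  move=> w _; rewrite -EFinD lee_fin indicE.
  have [cU|cU] := leqP (cB AU w) 1.
    have [st so] := state_good cU; rewrite (so s).
    case: (eqVneq st (Some s)) => [oE|_]; last by rewrite addr_ge0// cc0.
    by rewrite mem_set ?lerDl ?cc0// => s'; rewrite -oE; exact: so.
  apply: (@le_trans _ _ (cB AU w)%:R).
    by rewrite ler_nat cntA_AU (bigD1 s)//= leq_addr.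
  apply: (@le_trans _ _ ((cB AU w)%:R * ((cB AU w)%:R - 1))); last by rewrite lerDr.
  have h2 : (2 : R) <= (cB AU w)%:R by rewrite ler_nat.
  by rewrite ler_peMr//; lra.
have f1 : E1 \is a fin_num.
  rewrite ge0_fin_numE; last by apply: integral_ge0.
  by apply: le_lt_trans hi _; rewrite ltey_eq fin_numD Ecc_fin fin_num_measure.
have fE := Ecc_fin; have fq : Q (state (Some s)) \is a fin_num by exact: fin_num_measure.
have h1 : fine E1 <= fine (Q (state (Some s))) + fine Ecc.
  by rewrite -fineD//; apply: fine_le; [exact: f1|rewrite fin_numD fq fE|exact: hi].
have h2 : fine (Q (state (Some s))) <= fine E1 by apply: fine_le; [exact: fq|exact: f1|exact: lo].
by split=> //; rewrite ger0_norm ?subr_ge0// lerBlDl.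
Qed.

(** The states are disjoint, and by [state_good] whatever they leave uncovered lies in [bad]. *)
Lemma none_prob : fine (Q (state None)) <= 1 /\
  0 <= (1 - fine (Q (state None))) - \sum_s fine (Q (state (Some s))) <= fine (Q bad).
Proof.
have fs o : Q (state o) \is a fin_num by rewrite fin_num_measure//; exact: measurable_state.
have US : Q (\big[setU/set0]_(o <- states m) state o) = (\sum_(o <- states m) Q (state o))%E.
  apply: measure_bigU; [|exact: measurable_state|exact: state_disjoint].
  have Si : injective (@Some 'I_m) by move=> ? ? [].
  by rewrite /states /= (map_inj_uniq Si) enum_uniq andbT; apply/negP => /mapP [].
have mUS : measurable (\big[setU/set0]_(o <- states m) state o).
  by apply: bigsetU_measurable => o _; exact: measurable_state.
have tot : fine (Q (\big[setU/set0]_(o <- states m) state o)) =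
    fine (Q (state None)) + \sum_s fine (Q (state (Some s))).
  rewrite US /states big_cons big_map /= big_enum /= fineD//; last by apply/sum_fin_numP.
  congr (_ + _); rewrite -[RHS]/(fine (\sum_s fine (Q (state (Some s))))%:E) -sumEFin; congr fine.
  by apply: eq_bigr => s _; rewrite fineK.
have le1 : fine (Q (\big[setU/set0]_(o <- states m) state o)) <= 1.
  by rewrite -lee_fin fineK ?fin_num_measure// probability_le1.
have s0 : 0 <= \sum_s fine (Q (state (Some s))) by rewrite sumr_ge0// => s _; rewrite fine_ge0.
split; first by rewrite tot in le1; lra.
rewrite tot in le1; apply/andP; split; first lra.
suff : 1 <= fine (Q (\big[setU/set0]_(o <- states m) state o)) + fine (Q bad) by rewrite tot; lra.
rewrite -lee_fin EFinD !fineK ?fin_num_measure//; try exact: measurable_bad.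
rewrite -(probability_setT Q); apply: le_trans (measureU2 _ mUS measurable_bad).
apply: le_measure; rewrite ?inE//; first exact: measurableU mUS measurable_bad.
move=> w _; have [cU|cU] := leqP (cB AU w) 1; last by right.
left; have [st so] := state_good cU; rewrite -bigcup_seq; exists st => //=.
by rewrite /states inE; case: st {so} => // s; rewrite map_f ?orbT// mem_enum.
Qed.

Lemma pattern_iff L r w : (forall l, (l < L)%N -> exists o, state o (sh N l w)) ->
  pattern N state L r w <-> (forall s, (\sum_(l < L) cB (A s) (sh N l w))%N = r s).
Proof.
clear muT HQ M0 muM N0 sc0 K0 AK dA; elim: L r => [|L IH] r good /=.
  by split => h s; have := h s; rewrite big_ord0.
have [st so] := good L (ltnSn L).
have {}IH r' := IH r' (fun l lL => good l (ltnW lL)).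
rewrite -bigcup_seq; split.
  move=> [st' _] /=; case: ifP => // ok [/IH h so'] s.
  rewrite big_ord_recr /= h so' /rdec subnK//.
  by case: eqP ok => [-> //=|] _ _.
move=> h; exists st => /=.
  by rewrite /states inE; case: st {so} => // s; rewrite map_f ?orbT// mem_enum.
have ok : rok r st.
  case: st so => [s|] so //=; by rewrite -(h s) big_ord_recr /= (so s) eqxx addn1.
rewrite ok; split => //; apply/IH => s.
by rewrite /rdec -(h s) big_ord_recr /= (so s) addnK.
Qed.

End BlockStates.

Section ProbabilityDifference.
Context {R : realType} (d : measure_display) (T : measurableType d) (Q : probability T R).

Lemma prob_diff_le (X Y Z : set T) : measurable X -> measurable Y -> measurable Z ->
  (forall w, ~ Z w -> X w <-> Y w) -> `|fine (Q X) - fine (Q Y)| <= fine (Q Z).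
Proof.
move=> mX mY mZ h.
have sub X' Y' : measurable X' -> measurable Y' -> (forall w, ~ Z w -> X' w -> Y' w) ->
    fine (Q X') <= fine (Q Y') + fine (Q Z).
  move=> mX' mY' h'; rewrite -fineD ?fin_num_measure//; apply: fine_le; rewrite ?fin_numD ?fin_num_measure//.
  apply: le_trans (measureU2 _ mY' mZ); apply: le_measure; rewrite ?inE//; first exact: measurableU.
  by move=> w Xw; have [Zw|Zw] := pselect (Z w); [right|left; exact: h' Xw].
have h1 := sub X Y mX mY (fun w z => (h w z).1); have h2 := sub Y X mY mX (fun w z => (h w z).2).
by rewrite ler_norml; apply/andP; split; lra.
Qed.

End ProbabilityDifference.

(** * The law of the random potential as a measure on sequences *)

Section LawOfSequence.
Context {R : realType} (d : measure_display) (Omega : measurableType d) (P : probability Omega R).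
Variables (omega : nat -> Omega -> R) (gamma : R -> R).
Hypotheses (momega : forall x, measurable_fun setT (omega x))
  (ind : mutually_independent P omega) (mg : measurable_fun setT gamma)
  (g0 : forall t, 0 <= gamma t)
  (law : forall x (A : set R), measurable A ->
     P (omega x @^-1` A) = (\int[lebesgue_measure]_(t in A) (gamma t)%:E)%E).

Definition dens (A : set R) : \bar R := (\int[lebesgue_measure]_(t in A) (gamma t)%:E)%E.

Definition path_of (om : Omega) : @seqR R := fun i => omega i om.

Lemma measurable_path_of : measurable_fun setT path_of.
Proof. by apply: measurable_fun_seqR => i; exact: momega. Qed.

Definition pathm : {mfun Omega >-> @seqR R} := mfun_Sub (mem_set measurable_path_of).

Definition path_law : probability (@seqR R) R := distribution P pathm.

Lemma path_lawE X : path_law X = P (path_of @^-1` X).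
Proof. by []. Qed.

Lemma dens_setT : dens setT = 1%E.
Proof. by rewrite /dens -(law 0%N)// preimage_setT probability_setT. Qed.

Lemma iid_path_law : iid_law dens path_law.
Proof.
move=> S A uS mA.
transitivity (P (\big[setI/setT]_(i <- S) (omega i @^-1` A i))).
  rewrite path_lawE; congr (P _); rewrite -bigcap_seq.
  by apply/seteqP; split => om h i iS; exact: (h i iS).
by rewrite ind//; apply: eq_bigr => i _; exact: law.
Qed.

Lemma dens_le Mg : (forall t, gamma t <= Mg) ->
  forall A, measurable A -> (dens A <= Mg%:E * lebesgue_measure A)%E.
Proof.
move=> h A mA; rewrite -integral_cst//; apply: ge0_le_integral => //.
- by move=> t _; rewrite lee_fin.
- by apply/measurable_EFinP; exact: measurable_funTS.
- by move=> t _ /=; rewrite lee_fin.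
Qed.

Lemma path_integral (f : @seqR R -> \bar R) : measurable_fun setT f ->
  (forall w, 0 <= f w)%E -> (\int[path_law]_w f w = \int[P]_om f (path_of om))%E.
Proof. by move=> mf f0; rewrite ge0_integral_pushforward. Qed.

End LawOfSequence.

(** * Rates for the dropped levels and the number of blocks *)

Section HierarchicalRates.
Context {R : realType}.
Variables (n : nat) (rho C : R).
Hypotheses (n2 : (2 <= n)%N) (r1 : 1 < rho) (C0 : 0 < C).

Definition tailc (j : nat) : R := C / (rho - 1) * rho ^- j.

Let c0 : 0 < C / (rho - 1). Proof. by rewrite divr_gt0// subr_gt0. Qed.
Let rho0 : 0 < rho. Proof. exact: lt_trans ltr01 r1. Qed.
Let n0 : 0 < n%:R :> R. Proof. by rewrite ltr0n; exact: leq_trans n2. Qed.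

Lemma tailc_gt0 j : 0 < tailc j.
Proof. by rewrite mulr_gt0// invr_gt0 exprn_gt0. Qed.

Lemma tailc_sum (p : nat -> R) : (forall r, (1 <= r)%N -> p r <= C * rho ^- r) ->
  forall j l, (j <= l)%N -> \sum_(j.+1 <= s < l.+1) p s <= tailc j.
Proof.
move=> h j l jl; apply: (@le_trans _ _ (C * (rho ^- j / (rho - 1)))).
  apply: le_trans (ler_wpM2l (ltW C0) (geometric_tail r1 jl)).
  rewrite mulr_sumr big_nat [leRHS]big_nat; apply: ler_sum => s /andP[js _].
  by apply: h; exact: leq_trans js.
by rewrite /tailc -mulrA [_^-1 * _]mulrC.
Qed.

Lemma tailc_cvg0 : tailc j @[j --> \oo] --> 0.
Proof.
have h : (rho^-1) ^+ j @[j --> \oo] --> 0.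
  by apply: cvg_expr; rewrite ger0_norm ?invr_ge0 ?(ltW rho0)// invf_lt1.
rewrite /tailc -(mulr0 (C / (rho - 1))); apply: cvgM; first exact: cvg_cst.
by rewrite (_ : (fun j => rho ^- j) = (fun j => rho^-1 ^+ j))//; apply/funext => j; rewrite exprVn.
Qed.

Lemma spectral_dimension_lt : 2 * ln n%:R / ln rho < 1 -> (n ^ 2)%:R < rho.
Proof.
move=> h; have l0 : 0 < ln rho by rewrite ln_gt0.
rewrite ltr_pdivrMr// mul1r in h.
have a0 : (n ^ 2)%:R \is @Num.pos R by rewrite posrE natrX exprn_gt0.
have b0 : rho \is Num.pos by rewrite posrE.
by rewrite -(ltr_ln a0 b0) natrX lnXn// mulr2n; lra.
Qed.

(** The spectral dimension enters here: with J = [uphalf k] one has k <= 2 J, so n^k rho^-J <= (n^2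
    / rho)^J. *)
Lemma tailc_small : (n ^ 2)%:R < rho -> tailc (uphalf k) * (n ^ k)%:R @[k --> \oo] --> 0.
Proof.
move=> nr; pose z := (n ^ 2)%:R / rho.
have z1 : `|z| < 1 by rewrite ger0_norm ?divr_ge0 ?(ltW rho0)// ltr_pdivrMr// mul1r.
have h : C / (rho - 1) * z ^+ uphalf k @[k --> \oo] --> C / (rho - 1) * 0.
  by apply: cvgM; [exact: cvg_cst|exact: uphalf_pow_cvg0].
rewrite mulr0 in h.
apply: (squeeze_cvgr _ (cvg_cst 0) h); near=> k.
rewrite mulr_ge0 ?(ltW (tailc_gt0 _))//= /tailc -mulrA ler_pM2l// expr_div_n mulrC.
rewrite ler_pM2r ?invr_gt0 ?exprn_gt0// -natrX ler_nat -expnM leq_exp2l//.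
by rewrite mul2n uphalf_half; have := odd_double_half k; case: (odd k); lia.
Unshelve. all: by end_near. Qed.

Lemma blocks_inv_cvg0 : ((n ^ (k - uphalf k))%:R)^-1 @[k --> \oo] --> (0 : R).
Proof.
have z1 : `|(n%:R : R)^-1| < 1 by rewrite ger0_norm ?invr_ge0// invf_lt1// ltr1n.
(* The extra factor [n] covers odd k, where k - [uphalf k] is [uphalf k] - 1. *)
have h : n%:R * n%:R^-1 ^+ uphalf k @[k --> \oo] --> (n%:R * 0 : R).
  by apply: cvgM; [exact: cvg_cst|exact: uphalf_pow_cvg0].
rewrite mulr0 in h.
apply: (squeeze_cvgr _ (cvg_cst 0) h); near=> k.
rewrite invr_ge0 ler0n /= exprVn -[_ * _]/(n%:R / n%:R ^+ uphalf k) ler_pdivlMr ?exprn_gt0//.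
rewrite -natrX mulrC ler_pdivrMr ?ltr0n ?expn_gt0 ?(leq_trans _ n2)// -natrM ler_nat -expnS leq_exp2l//.
by rewrite uphalf_half; have := odd_double_half k; case: (odd k); lia.
Unshelve. all: by end_near. Qed.

End HierarchicalRates.

Section LimitComparison.
Context {R : realType}.

Lemma cvg_of_dist (f g h : nat -> R) (l : R) : (forall k, `|f k - g k| <= h k) ->
  h k @[k --> \oo] --> (0 : R) -> f k @[k --> \oo] --> l -> g k @[k --> \oo] --> l.
Proof.
move=> fgh h0 fl.
have lo : f k - h k @[k --> \oo] --> l - 0 by apply: cvgB; [exact: fl|exact: h0].
have hi : f k + h k @[k --> \oo] --> l + 0 by apply: cvgD; [exact: fl|exact: h0].
rewrite subr0 in lo; rewrite addr0 in hi.
apply: (squeeze_cvgr _ lo hi); near=> k.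
by have := fgh k; rewrite ler_norml => /andP[? ?]; apply/andP; split; lra.
Unshelve. all: by end_near. Qed.

End LimitComparison.

Section UnionBound.
Context {R : realType} (d : measure_display) (T : measurableType d) (Q : probability T R).

Lemma fine_bigsetU_le (I : eqType) (s : seq I) (F : I -> set T) : (forall i, measurable (F i)) ->
  fine (Q (\big[setU/set0]_(i <- s) F i)) <= \sum_(i <- s) fine (Q (F i)).
Proof.
move=> mF; elim: s => [|i s IH]; first by rewrite !big_nil measure0.
have mU : measurable (\big[setU/set0]_(j <- s) F j) by exact: bigsetU_measurable.
have mFU := measurableU _ _ (mF i) mU.
have f1 := fin_num_measure Q _ mFU; have f2 := fin_num_measure Q _ mU.
have f3 := fin_num_measure Q _ (mF i).
rewrite !big_cons.
apply: (@le_trans _ _ (fine (Q (F i)) + fine (Q (\big[setU/set0]_(j <- s) F j)))); last by rewrite lerD2l.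
rewrite -fineD//; apply: fine_le; [exact: f1|by rewrite fin_numD f2 f3|exact: measureU2].
Qed.

End UnionBound.

(** * Poisson transform of the mean measure *)

Section BlockPoissonKernel.
Context {R : realType}.

Lemma pk_scale (sc e a b t : R) : 0 < sc -> 0 < b ->
  pk a b (sc * (t - e)) = sc^-1 * pk (e + a / sc) (b / sc) t.
Proof.
move=> s0 b0; have h1 : (sc * (t - e) - a) ^+ 2 + b ^+ 2 != 0 by apply: lt0r_neq0; apply: pk_den.
rewrite /pk; have -> : (t - (e + a / sc)) ^+ 2 + (b / sc) ^+ 2 = ((sc * (t - e) - a) ^+ 2 + b ^+ 2) / sc ^+ 2.
  by field; rewrite gt_eqF.
move: h1; set D := (sc * (t - e) - a) ^+ 2 + b ^+ 2; move: D => D h1.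
by field; rewrite ?h1 ?(gt_eqF s0).
Qed.

Variables (mu : set R -> \bar R) (Q : probability (@seqR R) R) (M : R).
Hypotheses (muT : mu setT = 1%E) (HQ : iid_law mu Q) (M0 : 0 < M).
Hypothesis muM : forall A, measurable A -> (mu A <= M%:E * lebesgue_measure A)%E.

Lemma integral_le_scale (f g : @seqR R -> R) th :
  measurable_fun setT f -> measurable_fun setT g -> (forall w, 0 <= f w) ->
  (forall w, 0 <= g w) -> 0 <= th -> (forall w, f w <= th * g w) ->
  (\int[Q]_w (f w)%:E <= th%:E * \int[Q]_w (g w)%:E)%E.
Proof.
move=> mf mg f0 g0 th0 fg.
have mgE : measurable_fun setT (fun w => (g w)%:E) by exact/measurable_EFinP.
have mfE : measurable_fun setT (fun w => (f w)%:E) by exact/measurable_EFinP.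
have gE w : setT w -> (0 <= (g w)%:E)%E by rewrite lee_fin.
rewrite -ge0_integralZl_EFin//; apply: ge0_le_integral => //.
- by move=> w _; rewrite lee_fin.
- by apply/measurable_EFinP; apply: measurable_funM => //; exact: measurable_cst.
- by move=> w _; rewrite -EFinM lee_fin.
Qed.

Lemma nu0_pk (N : nat) (A0 : 'M[R]_N) (sc e : R) (A0s : A0^T = A0) c a b : 0 < sc -> 0 < b ->
  (\int[nu0 Q sc e A0s c]_t (pk a b t)%:E =
   (c%:num / sc)%:E * \int[Q]_w (\sum_x imG (Hw A0 w) (e + a / sc) (b / sc) x)%:E)%E.
Proof.
move=> sc0 b0; have b0' : 0 < b / sc by rewrite divr_gt0.
have mp : measurable_fun setT (fun t : measurableTypeR R => (pk a b t)%:E : \bar R).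
  by apply/measurable_EFinP; exact: measurable_pk.
have p0 (t : measurableTypeR R) : (0 <= (pk a b t)%:E)%E by rewrite lee_fin pk_ge0.
rewrite (nu0_integral Q sc e A0s c mp p0) EFinM -muleA; congr (_ * _)%E.
set S := fun w : @seqR R => \sum_x imG (Hw A0 w) (e + a / sc) (b / sc) x.
have mS : measurable_fun setT (fun w => (S w)%:E).
  by apply/measurable_EFinP; apply: measurable_sum => x; exact: measurable_imG.
have S0 w : setT w -> (0 <= (S w)%:E)%E.
  by move=> _; rewrite lee_fin sumr_ge0// => x _; rewrite ltW//; apply: imG_gt0 => //; exact: Hw_sym.
have i0 : 0 <= sc^-1 by rewrite invr_ge0 ltW.
rewrite -ge0_integralZl_EFin//; apply: eq_integral => w _.
rewrite sumEFin -EFinM; congr EFin; rewrite /S sum_imG//; last exact: Hw_sym.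
by rewrite (sum_ev A0s) mulr_sumr; apply: eq_bigr => i _; rewrite /rv pk_scale.
Qed.

(** By homogeneity all n^j diagonal entries have the same mean, and the scale is L n^j, so the
    prefactors cancel and one site is left. *)
Lemma nu0_pk_homogeneous (n : nat) (p : nat -> R) (j L : nat) (x : 'I_(n ^ j)) (c : {nonneg R})
    (sc e a b : R) : (2 <= n)%N -> sc = (L * n ^ j)%:R -> 0 < sc -> c%:num = L%:R -> 0 < b ->
  let I := (\int[Q]_w (imG (Hw (Amx n p (n ^ j) j) w) (e + a / sc) (b / sc) x)%:E)%E in
  I \is a fin_num /\ (\int[nu0 Q sc e (Amx_sym n p (n ^ j) j) c]_t (pk a b t)%:E)%E = I.
Proof.
move=> n2 scE sc0 cE b0 I; have b0' : 0 < b / sc by rewrite divr_gt0.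
have As := Amx_sym n p (n ^ j) j.
have mI y : measurable_fun setT (fun w : @seqR R => (imG (Hw (Amx n p (n ^ j) j) w) (e + a / sc) (b / sc) y)%:E).
  by apply/measurable_EFinP; exact: measurable_imG.
have I0 y (w : @seqR R) : setT w -> (0 <= (imG (Hw (Amx n p (n ^ j) j) w) (e + a / sc) (b / sc) y)%:E)%E.
  by move=> _; rewrite lee_fin ltW//; apply: imG_gt0 => //; exact: Hw_sym.
have If : I \is a fin_num.
  rewrite ge0_fin_numE; last by apply: integral_ge0 => w Tw; exact: (I0 x w Tw).
  apply: le_lt_trans (ltry (M * pi)).
  by apply: (integral_imG muT HQ (ltW M0) muM As).
split=> //; rewrite nu0_pk//.
have -> : (\int[Q]_w (\sum_y imG (Hw (Amx n p (n ^ j) j) w) (e + a / sc) (b / sc) y)%:E =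
    (fine I *+ (n ^ j))%:E)%E.
  under eq_integral => w _ do rewrite -sumEFin.
  rewrite ge0_integral_sum//; try by move=> y w _; exact: I0.
  transitivity (\sum_(y < n ^ j) (fine I)%:E)%E.
    by apply: eq_bigr => y _; rewrite fineK//; apply: imG_homogeneous; first [exact: n2|exact: HQ|exact: b0'].
  by rewrite sumEFin sumr_const card_ord.
rewrite -EFinM -[RHS](fineK If); congr EFin.
move: sc0; rewrite scE ltr0n muln_gt0 => /andP[L0 N0].
have l0 : L%:R != 0 :> R by rewrite pnatr_eq0 -lt0n.
have n0 : (n ^ j)%:R != 0 :> R by rewrite pnatr_eq0 -lt0n.
have alg (u v z : R) : u != 0 -> v != 0 -> u / (u * v) * (v * z) = z.
  by move=> u1 v1; field; rewrite u1 v1.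
by rewrite cE natrM -[fine I *+ _]mulr_natl alg.
Qed.

End BlockPoissonKernel.

Section LimitResolvent.
Context {R : realType}.
Variables (n : nat) (p tl : nat -> R) (x0 : nat).
Hypotheses (n2 : (2 <= n)%N) (p0 : forall r, (1 <= r)%N -> 0 < p r)
  (tlP : forall j l, (j <= l)%N -> \sum_(j.+1 <= s < l.+1) p s <= tl j)
  (tl0 : tl k @[k --> \oo] --> 0).
Variables (a b : R).
Hypothesis b0 : 0 < b.

Lemma ltn_level j : (x0 <= j)%N -> (x0 < n ^ j)%N.
Proof. by move=> xj; apply: leq_ltn_trans xj _; exact: ltn_expl. Qed.

Lemma gv_gt0 w j : (x0 <= j)%N -> 0 < gv n p w a b x0 j x0.
Proof.
move=> xj; have h := ltn_level xj.
have -> : gv n p w a b x0 j x0 = imG (Hw (Amx n p (n ^ j) j) w) a b (Ordinal h) by exact: gv_imG.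
by apply: imG_gt0 => //; apply: Hw_sym; exact: Amx_sym.
Qed.

Lemma Vlim_bounds w j : (x0 <= j)%N ->
  Vlim n p w a b x0 x0 <= (1 + tl j / b) ^+ 2 * gv n p w a b x0 j x0 /\
  gv n p w a b x0 j x0 <= (1 + tl j / b) ^+ 2 * Vlim n p w a b x0 x0.
Proof. by move=> xj; apply: (Vlim_ratio n2 p0 tlP tl0). Qed.

Lemma Vlim_ge0 w : 0 <= Vlim n p w a b x0 x0.
Proof.
have [_ h] := Vlim_bounds w (leqnn x0); have g := lt_le_trans (gv_gt0 w (leqnn x0)) h.
rewrite leNgt; apply/negP => v; move: g; rewrite ltNge => /negP; apply.
by rewrite mulr_ge0_le0// ?sqr_ge0// ltW.
Qed.

Lemma measurable_gv j : measurable_fun setT (fun w : @seqR R => gv n p w a b x0 j x0).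
Proof.
have [h|h] := ltnP x0 (n ^ j); last first.
  rewrite (_ : (fun w : seqR => _) = cst 0); first exact: measurable_cst.
  by apply/funext => w; exact: glev_out.
rewrite (_ : (fun w : seqR => _) = (fun w : seqR => imG (Hw (Amx n p (n ^ j) j) w) a b (Ordinal h))).
  by apply: measurable_imG => //; exact: Amx_sym.
by apply/funext => w; exact: gv_imG.
Qed.

Lemma measurable_Vlim : measurable_fun setT (fun w : @seqR R => Vlim n p w a b x0 x0).
Proof.
apply: (measurable_fun_cvg (h := fun l (w : @seqR R) => gv n p w a b x0 l x0)).
  by move=> l; exact: measurable_gv.
move=> w _.
have H : gv n p w a b x0 l x0 @[l --> \oo] --> Vlim n p w a b x0 x0 /\
    (forall j, (x0 <= j)%N -> `|Vlim n p w a b x0 x0 - gv n p w a b x0 j x0| <= tl j / b ^+ 2).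
  by apply: (Vlim_cvg n2 p0 tlP tl0).
exact: H.1.
Qed.

End LimitResolvent.

(** * Convergence of the mean measure of the truncated process *)

Section LevelIntensity.
Context {R : realType}.
Variables (mu : set R -> \bar R) (Q : probability (@seqR R) R) (M : R).
Hypotheses (muT : mu setT = 1%E) (HQ : iid_law mu Q) (M0 : 0 < M).
Hypothesis muM : forall A, measurable A -> (mu A <= M%:E * lebesgue_measure A)%E.
Variables (n : nat) (p tl : nat -> R) (x0 : nat) (e ee : R) (J : nat -> nat).
Hypotheses (n2 : (2 <= n)%N) (p0 : forall r, (1 <= r)%N -> 0 < p r)
  (tlP : forall j l, (j <= l)%N -> \sum_(j.+1 <= s < l.+1) p s <= tl j)
  (tl0 : tl k @[k --> \oo] --> 0) (tlp : forall j, 0 < tl j).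
Hypotheses (Jk : forall k, (J k <= k)%N) (Jx : \forall k \near \oo, (x0 <= J k)%N)
  (small : (n ^ k)%:R * tl (J k) @[k --> \oo] --> 0) (ee0 : 0 <= ee).
Hypothesis EV : forall a b : R, 0 < b ->
  (fun k => \int[Q]_w (Vlim n p w (e + a / (n ^ k)%:R) (b / (n ^ k)%:R) x0 x0)%:E)%E @ \oo -->
    (pi * ee)%:E.

Definition level_nu k : set (measurableTypeR R) -> \bar R :=
  nu0 Q (n ^ k)%:R e (Amx_sym n p (n ^ J k) (J k)) (NngNum (ler0n R (n ^ (k - J k)))).

HB.instance Definition _ k := Measure.on (level_nu k).

Lemma level_nuE k B : measurable B -> level_nu k B =
  ((n ^ (k - J k))%:R%:E * \int[Q]_w (cntA (Amx n p (n ^ J k) (J k)) (n ^ k)%:R e B w)%:R%:E)%E.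
Proof. by move=> mB; rewrite /level_nu nu0E. Qed.

Lemma fin_num_level_nu k : fin_num_fun (level_nu k).
Proof.
move=> B mB; have As := Amx_sym n p (n ^ J k) (J k).
rewrite level_nuE// fin_numM// ge0_fin_numE; last by apply: integral_ge0 => w _; rewrite lee_fin.
apply: (@le_lt_trans _ _ (\int[Q]_w (cst (n ^ J k)%:R%:E w))%E).
  apply: ge0_le_integral => //.
  - by apply/measurable_EFinP; exact: measurable_cntA.
  - move=> w _ /=; rewrite lee_fin ler_nat -[leqRHS](size_evs (Hw_sym As w)).
    exact: count_size.
by rewrite integral_cst//= probability_setT mule1 ltry.
Qed.

HB.instance Definition _ k :=
  Measure_isFinite.Build _ _ _ (level_nu k) (fin_num_level_nu k).

Lemma level_size k : (n ^ k = n ^ (k - J k) * n ^ J k)%N.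
Proof. by rewrite -expnD subnK. Qed.

Lemma expn_gt0R k : 0 < (n ^ k)%:R :> R.
Proof. by rewrite ltr0n expn_gt0 (leq_trans _ n2). Qed.

Lemma level_dom k B : measurable B -> (level_nu k B <= (M * pi)%:E * lebesgue_measure B)%E.
Proof.
move=> mB; rewrite level_nuE//.
have N0 : (0 < n ^ J k)%N by rewrite expn_gt0 (leq_trans _ n2).
have W := wegnerA muT HQ M0 muM e (Amx_sym n p (n ^ J k) (J k)) N0 (expn_gt0R k) mB.
have L0 : (0 <= ((n ^ (k - J k))%:R : R)%:E)%E by rewrite lee_fin.
apply: le_trans; first by apply: lee_wpmul2l; [exact: L0|exact: W].
have scE : (n ^ k)%:R = (n ^ (k - J k))%:R * (n ^ J k)%:R :> R by rewrite (level_size k) natrM.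
have alg (x y z : R) : x != 0 -> y != 0 -> x * (y * z / (x * y)) = z.
  by move=> x1 y1; field; rewrite x1 y1.
have l0 := lt0r_neq0 (expn_gt0R (k - J k)); have n0 := lt0r_neq0 (expn_gt0R (J k)).
by rewrite muleA -EFinM scE alg.
Qed.

Lemma level_pk k a b : (x0 <= J k)%N -> 0 < b -> let sc := (n ^ k)%:R in
  let G := (\int[Q]_w (gv n p w (e + a / sc) (b / sc) x0 (J k) x0)%:E)%E in
  G \is a fin_num /\ (\int[level_nu k]_t (pk a b t)%:E)%E = G.
Proof.
move=> xJ b0 sc G; have h := ltn_level n2 xJ.
have sE : sc = (n ^ (k - J k) * n ^ J k)%:R by rewrite /sc level_size.
have [f E] := nu0_pk_homogeneous muT HQ M0 muM p (Ordinal h)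
   (c := NngNum (ler0n R (n ^ (k - J k)))) e a n2 sE (expn_gt0R k) erefl b0.
have GE : G = (\int[Q]_w (imG (Hw (Amx n p (n ^ J k) (J k)) w) (e + a / sc) (b / sc) (Ordinal h))%:E)%E.
  by apply: eq_integral => w _; congr EFin; exact: gv_imG.
by rewrite GE; split.
Qed.

(** The mean over the block of level J k and the mean in infinite volume bound each other up to the
    factor [th k], which tends to one; the latter converges by [EV]. *)
Lemma level_lim a b : 0 < b ->
  (fun k => \int[level_nu k]_t (pk a b t)%:E)%E @ \oo --> (pi * ee)%:E.
Proof.
move=> b0; have /fine_cvgP[Vfin vlim] := EV a b0.
pose v k := fine (\int[Q]_w (Vlim n p w (e + a / (n ^ k)%:R) (b / (n ^ k)%:R) x0 x0)%:E)%E.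
pose sm k := (n ^ k)%:R * tl (J k).
(* The factor of [Vlim_bounds] at level J k and width b / n^k; dividing by this width turns
   [tl (J k)] into [sm k]. *)
pose th k := (1 + sm k / b) ^+ 2.
have f1 : 1 + sm k / b @[k --> \oo] --> 1 + 0 / b.
  by apply: cvgD; [exact: cvg_cst|apply: cvgM; [exact: small|exact: cvg_cst]].
rewrite mul0r addr0 in f1.
have thl : th k @[k --> \oo] --> (1 : R) ^+ 2 by exact: cvg_pow.
rewrite expr1n in thl.
have lo : v k * (th k)^-1 @[k --> \oo] --> pi * ee * 1^-1.
  by apply: cvgM; [exact: vlim|apply: cvgV => //; exact: oner_neq0].
have hi : th k * v k @[k --> \oo] --> 1 * (pi * ee) by apply: cvgM; [exact: thl|exact: vlim].
rewrite invr1 mulr1 in lo; rewrite mul1r in hi.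
have th0 k : 0 < th k.
  by rewrite exprn_gt0// ltr_pwDl// divr_ge0 ?(ltW b0)// mulr_ge0 ?(ltW (tlp _)).
have thE k : (1 + tl (J k) / (b / (n ^ k)%:R)) ^+ 2 = th k.
  by rewrite /th /sm invf_div mulrA [tl _ * _]mulrC.
apply/fine_cvgP; split.
  near=> k; have xJ : (x0 <= J k)%N by near: k; exact: Jx.
  by have [f ->] := level_pk a xJ b0.
apply: (squeeze_cvgr _ lo hi); near=> k.
have xJ : (x0 <= J k)%N by near: k; exact: Jx.
have Vf : (\int[Q]_w (Vlim n p w (e + a / (n ^ k)%:R) (b / (n ^ k)%:R) x0 x0)%:E)%E \is a fin_num by near: k; exact: Vfin.
have b0' : 0 < b / (n ^ k)%:R by rewrite divr_gt0// expn_gt0R.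
have [f E] := level_pk a xJ b0; rewrite /= E.
set a' := e + a / (n ^ k)%:R in Vf f E *; set b' := b / (n ^ k)%:R in Vf f E b0' *.
have mV : measurable_fun setT (fun w : @seqR R => Vlim n p w a' b' x0 x0).
  by apply: (measurable_Vlim _ n2 p0 tlP tl0).
have mG : measurable_fun setT (fun w : @seqR R => gv n p w a' b' x0 (J k) x0) by exact: measurable_gv.
have V0 (w : @seqR R) : 0 <= Vlim n p w a' b' x0 x0 by apply: (Vlim_ge0 _ n2 p0 tlP tl0).
have G0 (w : @seqR R) : 0 <= gv n p w a' b' x0 (J k) x0 by apply: ltW; apply: gv_gt0.
have V1 (w : @seqR R) : Vlim n p w a' b' x0 x0 <= th k * gv n p w a' b' x0 (J k) x0.
  by rewrite -thE; apply: (Vlim_bounds n2 p0 tlP tl0 _ b0' w xJ).1.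
have V2 (w : @seqR R) : gv n p w a' b' x0 (J k) x0 <= th k * Vlim n p w a' b' x0 x0.
  by rewrite -thE; apply: (Vlim_bounds n2 p0 tlP tl0 _ b0' w xJ).2.
have i1 := integral_le_scale Q mV mG V0 G0 (ltW (th0 k)) V1.
have i2 := integral_le_scale Q mG mV G0 V0 (ltW (th0 k)) V2.
rewrite -(fineK f) -(fineK Vf) -EFinM lee_fin in i1.
rewrite -(fineK f) -(fineK Vf) -EFinM lee_fin in i2.
by rewrite i2 andbT ler_pdivrMr// mulrC.
Unshelve. all: by end_near. Qed.

Lemma level_intensity (B : set R) (K : R) : measurable B -> 0 < K -> B `<=` `]- K, K]%classic ->
  fine (level_nu k B) @[k --> \oo] --> ee * fine (lebesgue_measure B).
Proof.
move=> mB K0 BK; have C0 : 0 < M * pi by rewrite mulr_gt0// pi_gt0.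
exact: (@intensity_limit R (fun k => level_nu k) ee (M * pi) ee0 C0 level_dom level_lim B K mB K0 BK).
Qed.

End LevelIntensity.

(** * Poisson limit for the block counts and for the full box *)

Section PoissonAssembly.
Context {R : realType}.
Variables (mu : set R -> \bar R) (Q : probability (@seqR R) R) (M : R).
Hypotheses (muT : mu setT = 1%E) (HQ : iid_law mu Q) (M0 : 0 < M).
Hypothesis muM : forall A, measurable A -> (mu A <= M%:E * lebesgue_measure A)%E.
Variables (n : nat) (p tl : nat -> R) (e ee : R) (J : nat -> nat).
Hypotheses (n2 : (2 <= n)%N) (p0 : forall r, (1 <= r)%N -> 0 < p r)
  (tlP : forall j l, (j <= l)%N -> \sum_(j.+1 <= s < l.+1) p s <= tl j)
  (tlp : forall j, 0 < tl j).
Hypotheses (Jk : forall k, (J k <= k)%N)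
  (small : (n ^ k)%:R * tl (J k) @[k --> \oo] --> 0)
  (Linv : ((n ^ (k - J k))%:R)^-1 @[k --> \oo] --> (0 : R)).
Variables (m : nat) (A : 'I_m -> set R) (rr : 'I_m -> nat) (K : R).
Hypotheses (K0 : 0 < K) (mA : forall s, measurable (A s))
  (AK : forall s, A s `<=` `]- K, K]%classic)
  (dA : forall s s', s != s' -> A s `&` A s' = set0).
Hypothesis intens : forall s,
  fine (level_nu Q n p e J k (A s)) @[k --> \oo] --> ee * fine (lebesgue_measure (A s)).

Local Notation L k := (n ^ (k - J k))%N.
Local Notation blk k := (Amx n p (n ^ J k) (J k)).
Local Notation sc k := ((n ^ k)%:R : R).

Definition block_prob k o := fine (Q (state (blk k) (sc k) e A o)).
Definition block_ecc k := fine (Ecc Q (blk k) (sc k) e A).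

Let bs k : (blk k)^T = blk k := Amx_sym n p _ _.
Let N0 k : (0 < n ^ J k)%N. Proof. by rewrite expn_gt0 (leq_trans _ n2). Qed.
Let sc0 k : 0 < sc k. Proof. exact: expn_gt0R. Qed.
Let L0 k : 0 < (L k)%:R :> R. Proof. exact: expn_gt0R. Qed.

Lemma block_ecc_ge0 k : 0 <= block_ecc k.
Proof.
apply: fine_ge0; apply: integral_ge0 => w _; rewrite lee_fin.
by case: (cntA _ _ _ _ _) => [|x]; rewrite ?mul0r// -natr1 addrK mulr_ge0.
Qed.

(** The block size over the scale is 1 / L, so the Minami bound for one block is c / L^2, and L
    blocks contribute c / L. *)
Lemma block_ecc_cvg0 : (L k)%:R * block_ecc k @[k --> \oo] --> 0.
Proof.
pose c := (3 * K * (M * pi)) ^+ 2.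
have h : c * ((L k)%:R)^-1 @[k --> \oo] --> c * 0 by apply: cvgM; [exact: cvg_cst|exact: Linv].
rewrite mulr0 in h; apply: (squeeze_cvgr _ (cvg_cst 0) h); near=> k.
rewrite mulr_ge0 ?block_ecc_ge0//=.
have := Ecc_le muT HQ M0 muM e (bs k) (sc0 k) K0 mA AK.
have f : Ecc Q (blk k) (sc k) e A \is a fin_num by apply: (Ecc_fin muT HQ M0 muM e (bs k) (sc0 k) K0 mA AK).
rewrite -(fineK f) lee_fin -/(block_ecc k) => h'.
have l0 := lt0r_neq0 (L0 k); have n0 := lt0r_neq0 (expn_gt0R n2 (J k) : 0 < _ :> R).
have scE : sc k = (L k)%:R * (n ^ J k)%:R by rewrite (level_size n Jk k) natrM.
have alg (x y z : R) : x != 0 -> y != 0 -> y * (3 * K / (x * y) * z) = 3 * K * z / x.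
  by move=> x1 y1; field; rewrite x1 y1.
have E : (n ^ J k)%:R * (3 * K / sc k * (M * pi)) = 3 * K * (M * pi) / (L k)%:R by rewrite scE alg.
rewrite E expr_div_n -/c in h'.
apply: le_trans; first by apply: ler_wpM2l h'; exact: ltW.
have -> : (L k)%:R * (c / (L k)%:R ^+ 2) = c * ((L k)%:R)^-1.
  by move: ((L k)%:R : R) l0 => y y0; field.
exact: lexx.
Unshelve. all: by end_near. Qed.

Lemma block_first_moment k s :
  `|fine (level_nu Q n p e J k (A s)) - (L k)%:R * block_prob k (Some s)| <= (L k)%:R * block_ecc k.
Proof.
have [f h] : let E1 := (\int[Q]_w ((cntA (blk k) (sc k) e (A s) w)%:R)%:E)%E in
  E1 \is a fin_num /\ `|fine E1 - block_prob k (Some s)| <= block_ecc k.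
  exact: (first_moment muT HQ M0 muM e (bs k) (sc0 k) K0 mA AK dA s).
have lE : level_nu Q n p e J k (A s) =
    ((L k)%:R%:E * \int[Q]_w ((cntA (blk k) (sc k) e (A s) w)%:R)%:E)%E by apply: level_nuE; exact: mA.
rewrite lE fineM// -mulrBr normrM (ger0_norm (ltW (L0 k))).
by apply: ler_wpM2l => //; exact: ltW.
Qed.

Lemma block_prob_cvg s : (L k)%:R * block_prob k (Some s) @[k --> \oo] --> ee * fine (lebesgue_measure (A s)).
Proof.
apply: (@cvg_of_dist R (fun k => fine (level_nu Q n p e J k (A s))) _ (fun k => (L k)%:R * block_ecc k)).
- by move=> k; exact: block_first_moment.
- exact: block_ecc_cvg0.
- exact: intens.
Qed.

Lemma block_bad_le k : fine (Q (bad (blk k) (sc k) e A)) <= block_ecc k.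
Proof. exact: (Q_bad_le muT HQ M0 muM e (bs k) (sc0 k) K0 mA AK). Qed.

Lemma block_none k : block_prob k None <= 1 /\
  0 <= (1 - block_prob k None) - \sum_s block_prob k (Some s) <= fine (Q (bad (blk k) (sc k) e A)).
Proof. by apply: none_prob => //; exact: bs. Qed.

Lemma block_none_cvg : (L k)%:R * (1 - block_prob k None) @[k --> \oo] -->
  \sum_s ee * fine (lebesgue_measure (A s)).
Proof.
have h : \sum_(s <- index_enum 'I_m) (L k)%:R * block_prob k (Some s) @[k --> \oo] -->
    \sum_(s <- index_enum 'I_m) ee * fine (lebesgue_measure (A s)).
  by apply: cvg_bigsum => s; exact: block_prob_cvg.
apply: cvg_of_dist block_ecc_cvg0 h => k.
have [_ /andP[h1 h2]] := block_none k; have h3 := block_bad_le k.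
rewrite -mulr_sumr -mulrBr normrM (ger0_norm (ltW (L0 k))); apply: ler_wpM2l; first exact: ltW.
by rewrite distrC ger0_norm//; exact: le_trans h2 h3.
Qed.

Local Notation limit := (\prod_(s < m) (expR (- (ee * fine (lebesgue_measure (A s)))) *
         (ee * fine (lebesgue_measure (A s))) ^+ rr s / (rr s)`!%:R)).

Lemma pattern_cvg :
  fine (Q (pattern (n ^ J k) (state (blk k) (sc k) e A) (L k) rr)) @[k --> \oo] --> limit.
Proof.
have E k : Q (pattern (n ^ J k) (state (blk k) (sc k) e A) (L k) rr) =
    (multinomial_term (L k) rr (block_prob k))%:E.
  apply: (Q_pattern muT HQ).
  - by move=> o; apply: measurable_state => //; exact: bs.
  - by move=> o o'; exact: state_disjoint.
  - by move=> o w w'; exact: state_local.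
rewrite (_ : (fun k => _) = (fun k => multinomial_term (L k) rr (block_prob k))); last first.
  by apply/funext => k; rewrite E.
apply: poisson_limit => //.
- by move=> k; rewrite expn_gt0 (leq_trans _ n2).
- by move=> k; rewrite fine_ge0//=; have [] := block_none k.
- by move=> s; exact: block_prob_cvg.
- exact: block_none_cvg.
Qed.

Let mcount k r : measurable [set w : @seqR R | forall s, cntA (Amx n p (n ^ k) r) (sc k) e (A s) w = rr s].
Proof.
rewrite (_ : [set _ | _] = \big[setI/setT]_(s <- enum 'I_m)
    [set w : seqR | cntA (Amx n p (n ^ k) r) (sc k) e (A s) w = rr s]).
  by apply: bigsetI_measurable => s _; apply: measurable_cntA_eq; [exact: Amx_sym|exact: mA].
rewrite -bigcap_seq; apply/seteqP; split => w /= h s; first by move=> _; exact: h.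
by apply: h; rewrite /= mem_enum.
Qed.

Lemma cJ_blocks k s (w : nat -> R) : cJ n p e J k (A s) w =
  (\sum_(l < L k) cntA (blk k) (sc k) e (A s) (sh (n ^ J k) l w))%N.
Proof. by rewrite /cJ /cntA (count_blocks p n2 (L := L k))//; exact: level_size. Qed.

(** Unless some block is bad, prescribing the total counts is the same as prescribing the pattern of
    states; a union bound over the blocks controls the exception. *)
Lemma cJ_cvg : fine (Q [set w | forall s, cJ n p e J k (A s) w = rr s]) @[k --> \oo] --> limit.
Proof.
apply: cvg_of_dist block_ecc_cvg0 pattern_cvg => k.
pose F l : set (@seqR R) := sh (n ^ J k) l @^-1` bad (blk k) (sc k) e A.
have mb : measurable (bad (blk k) (sc k) e A) by apply: measurable_bad => //; exact: bs.
have mF l : measurable (F l).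
  by rewrite -[X in measurable X]setTI; exact: (measurable_sh (n ^ J k) l).
have QF l : Q (F l) = Q (bad (blk k) (sc k) e A) by exact: (Q_sh HQ (n ^ J k) l mb).
apply: (@le_trans _ _ (fine (Q (\big[setU/set0]_(l <- index_iota 0 (L k)) F l)))); last first.
  apply: (le_trans (fine_bigsetU_le Q _ mF)).
  under eq_bigr do rewrite QF.
  rewrite sumr_const_nat subn0 -[leLHS]mulr_natl; apply: ler_wpM2l; first exact: ltW.
  exact: block_bad_le.
apply: prob_diff_le.
- apply: measurable_pattern => o; apply: measurable_state => //; exact: bs.
- exact: mcount.
- by apply: bigsetU_measurable.
move=> w; rewrite -bigcup_seq => nb.
have good l : (l < L k)%N -> exists o, state (blk k) (sc k) e A o (sh (n ^ J k) l w).
  move=> lL; apply: state_good => //; rewrite leqNgt; apply/negP => b; apply: nb.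
  by exists l => //=; rewrite mem_index_iota.
apply: (iff_trans (B := forall s, (\sum_(l < L k) cntA (blk k) (sc k) e (A s) (sh (n ^ J k) l w))%N = rr s)).
  by apply: pattern_iff.
by split => h s; have := h s; rewrite /= cJ_blocks.
Qed.

Lemma cK_cvg : fine (Q [set w | forall s, cK n p e k (A s) w = rr s]) @[k --> \oo] --> limit.
Proof.
pose F k s : set (@seqR R) := [set w | cK n p e k (A s) w <> cJ n p e J k (A s) w].
have h : \sum_(s <- enum 'I_m) fine (Q (F k s)) @[k --> \oo] --> \sum_(s <- enum 'I_m) (0 : R).
  apply: (@cvg_bigsum R _ (enum 'I_m) (fun k s => fine (Q (F k s))) (fun=> 0)) => s.
  exact: (transfer muT HQ M0 muM n2 p0 tlP tlp e Jk small (mA s) K0 (@AK s)).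
rewrite big1 in h; last by [].
apply: cvg_of_dist h cJ_cvg => k.
have mF s : measurable (F k s).
  have m1 := measurable_cntA (sc k) e (Amx_sym n p (n ^ k) k) (mA s).
  have m2 := measurable_cntA (sc k) e (Amx_sym n p (n ^ k) (J k)) (mA s).
  rewrite (_ : F k s = ~` ((fun w : seqR => (cK n p e k (A s) w)%:R - (cJ n p e J k (A s) w)%:R : R) @^-1` [set 0])).
    apply: measurableC; rewrite -[X in measurable X]setTI.
    suff hm : measurable_fun setT (fun w : seqR => (cK n p e k (A s) w)%:R - (cJ n p e J k (A s) w)%:R : R) by exact: hm.
    by apply: measurable_funB; [exact: m1|exact: m2].
  apply/seteqP; split => w /= h1 h2; apply: h1.
    by move/eqP: h2; rewrite subr_eq0 eqr_nat => /eqP.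
  by rewrite h2 subrr.
apply: le_trans (fine_bigsetU_le Q (enum 'I_m) mF); apply: prob_diff_le.
- exact: mcount.
- exact: mcount.
- by apply: bigsetU_measurable.
move=> w; rewrite -bigcup_seq => nb.
have E s : cK n p e k (A s) w = cJ n p e J k (A s) w.
  by apply: contrapT => ne; apply: nb; exists s => //=; rewrite mem_enum.
by split => /= hs s; have := hs s; rewrite E.
Qed.

End PoissonAssembly.

(** * The eigenvalue event in terms of sorted lists *)

Section EigenvalueEvent.
Context {R : realType}.

Lemma eigenvalue_event n p (e : R) k x0 m (A : 'I_m -> set R) (rr : 'I_m -> nat) (w : nat -> R) :
  (x0 < n ^ k)%N ->
  (exists l : seq R, eigenvalue_list (Hk_mx n p w x0 k) l /\
     forall s, count (fun lam => ((n ^ k)%:R * (lam - e)) \in A s) l = rr s) <->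
  (forall s, cK n p e k (A s) w = rr s).
Proof.
move=> h; have Hs := Hw_sym (Amx_sym n p (n ^ k) k) w; split.
  move=> [l [hl hc]] s; rewrite Hk_mxE// in hl.
  by have /permP E := eigenvalue_list_evs Hs hl; rewrite -(hc s) /cK /cntA E.
move=> hc; exists (evs (Hw (Amx n p (n ^ k) k) w)); split; last exact: hc.
by rewrite Hk_mxE//; exact: (evsP Hs).1.
Qed.

Lemma measurable_cK_event n p (e : R) k m (A : 'I_m -> set R) (rr : 'I_m -> nat) :
  (forall s, measurable (A s)) ->
  measurable [set w : @seqR R | forall s, cK n p e k (A s) w = rr s].
Proof.
move=> mA; rewrite (_ : [set _ | _] = \big[setI/setT]_(s <- enum 'I_m)
    [set w : seqR | cK n p e k (A s) w = rr s]).
  by apply: bigsetI_measurable => s _; apply: measurable_cntA_eq; [exact: Amx_sym|exact: mA].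
rewrite -bigcap_seq; apply/seteqP; split => w /= h s; first by move=> _; exact: h.
by apply: h; rewrite /= mem_enum.
Qed.

End EigenvalueEvent.

(** * The averaged resolvent along the scales n^-k *)

Section AveragedResolvent.
Context {R : realType} (d : measure_display) (Omega : measurableType d) (P : probability Omega R).
Variables (omega : nat -> Omega -> R).
Hypothesis mom : forall x, measurable_fun setT (omega x).
Variables (n : nat) (p tl : nat -> R) (x0 : nat) (e : R) (eta : R -> R).
Hypotheses (n2 : (2 <= n)%N) (p0 : forall r, (1 <= r)%N -> 0 < p r)
  (tlP : forall j l, (j <= l)%N -> \sum_(j.+1 <= s < l.+1) p s <= tl j)
  (tl0 : tl k @[k --> \oo] --> 0).
Hypothesis hres : forall (a b : R) (U V : Omega -> nat -> R), 0 < b ->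
   (forall om, resolvent_sol n p (fun x => omega x om) x0 a b (U om) (V om)) ->
   (\int[P]_om (V om x0)%:E =
      \int[lebesgue_measure]_t ((b / ((t - a) ^+ 2 + b ^+ 2)) * eta t)%:E)%E.

Lemma expn_inv_cvg0 : ((n ^ k)%:R : R)^-1 @[k --> \oo] --> 0.
Proof.
have z1 : `|(n%:R : R)^-1| < 1.
  by rewrite ger0_norm ?invr_ge0// invf_lt1 ?ltr1n// ltr0n (leq_trans _ n2).
rewrite (_ : (fun k => _) = (fun k => (n%:R : R)^-1 ^+ k)); first exact: cvg_expr.
by apply/funext => k; rewrite natrX exprVn.
Qed.

Lemma expn_inv_at_right : ((n ^ k)%:R : R)^-1 @[k --> \oo] --> 0^'+.
Proof.
move=> X X0.
have h : \forall k \near \oo, 0 < ((n ^ k)%:R : R)^-1 -> X ((n ^ k)%:R)^-1 by exact: (expn_inv_cvg0 X0).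
change (\forall k \near \oo, X ((n ^ k)%:R)^-1).
by apply: filterS h => k; apply; rewrite invr_gt0 expn_gt0R.
Qed.

(** [hres] speaks only of given families of solutions; [Ulim] and [Vlim] supply one for every sample
    point. *)
Lemma integral_Vlim a b : 0 < b ->
  (\int[path_law P mom]_w (Vlim n p w a b x0 x0)%:E =
   \int[lebesgue_measure]_t ((b / ((t - a) ^+ 2 + b ^+ 2)) * eta t)%:E)%E.
Proof.
move=> b0.
have sol om : resolvent_sol n p (fun x => omega x om) x0 a b
    (Ulim n p (fun x => omega x om) a b x0) (Vlim n p (fun x => omega x om) a b x0).
  by apply: (resolvent_solP n2 p0 tlP tl0).
rewrite -(hres b0 sol) path_integral//.
- by apply/measurable_EFinP; apply: (measurable_Vlim _ n2 p0 tlP tl0).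
- by move=> w; rewrite lee_fin; apply: (Vlim_ge0 _ n2 p0 tlP tl0).
Qed.

Lemma averaged_resolvent_limit a b :
  0 < b -> (fun eps : R =>
        (\int[lebesgue_measure]_t
           (((eps * b) / ((t - e - eps * a) ^+ 2 + (eps * b) ^+ 2)) * eta t)%:E)%E)
       @ 0^'+ --> ((pi * eta e)%:E)%E ->
  (fun k => \int[path_law P mom]_w (Vlim n p w (e + a / (n ^ k)%:R) (b / (n ^ k)%:R) x0 x0)%:E)%E
    @ \oo --> (pi * eta e)%:E.
Proof.
move=> b0 hlim; have h := cvg_comp _ _ expn_inv_at_right hlim.
rewrite (_ : (fun k => _) = (fun eps : R => (\int[lebesgue_measure]_t
   (((eps * b) / ((t - e - eps * a) ^+ 2 + (eps * b) ^+ 2)) * eta t)%:E)%E) \o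
   (fun k => ((n ^ k)%:R)^-1)); first exact: h.
apply/funext => k /=; rewrite integral_Vlim ?divr_gt0 ?expn_gt0R//.
by apply: eq_integral => t _; rewrite opprD addrA (mulrC a) (mulrC b).
Qed.

End AveragedResolvent.

Theorem theorem3p7
  (R : realType) (n : nat) (rho : R) (p : nat -> R) (C1 C2 : R)
  (d : measure_display) (Omega : measurableType d) (P : probability Omega R)
  (omega : nat -> Omega -> R) (gamma : R -> R) (x0 : nat)
  (eta : R -> R) (e : R) :
  (2 <= n)%N ->
  1 < rho ->
  (forall r, (1 <= r)%N -> 0 < p r) ->
  (fun N : nat => \sum_(1 <= r < N) p r) @ \oo --> (1 : R) ->
  0 < C1 -> 0 < C2 ->
  (forall r, (1 <= r)%N -> C1 * rho ^- r <= p r /\ p r <= C2 * rho ^- r) ->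
  (* spectral dimension d = 2 log n / log rho < 1 *)
  2 * ln (n%:R) / ln rho < 1 ->
  (* (omega x)_x i.i.d. with bounded probability density gamma *)
  (forall x, measurable_fun setT (omega x)) ->
  mutually_independent P omega ->
  measurable_fun setT gamma ->
  (forall t, 0 <= gamma t) ->
  (exists M : R, forall t, gamma t <= M) ->
  (forall x (A : set R), measurable A ->
     P (omega x @^-1` A) = (\int[lebesgue_measure]_(t in A) (gamma t)%:E)%E) ->
  (* eta is the density of the averaged spectral measure mu^av at x0:
     for every z = a + i b with b > 0,
     E <delta_x0, (H_omega - z)^{-1} delta_x0> = int (t - z)^{-1} eta(t) dt *)
  measurable_fun setT eta ->
  (forall t, 0 <= eta t) ->
  (forall (a b : R) (U V : Omega -> nat -> R), 0 < b ->
     (forall om, resolvent_sol n p (fun x => omega x om) x0 a b (U om) (V om)) ->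
     (\int[P]_om (U om x0)%:E =
        \int[lebesgue_measure]_t (((t - a) / ((t - a) ^+ 2 + b ^+ 2)) * eta t)%:E
      /\ \int[P]_om (V om x0)%:E =
        \int[lebesgue_measure]_t ((b / ((t - a) ^+ 2 + b ^+ 2)) * eta t)%:E)%E) ->
  (* hypotheses on the energy e *)
  0 < eta e ->
  (forall a b : R, 0 < b ->
     (fun eps : R =>
        (\int[lebesgue_measure]_t
           (((eps * b) / ((t - e - eps * a) ^+ 2 + (eps * b) ^+ 2)) * eta t)%:E)%E)
       @ 0^'+ --> ((pi * eta e)%:E)%E) ->
  (* conclusion: Poisson convergence of the rescaled eigenvalue process *)
  forall (m : nat) (A : 'I_m -> set R) (rr : 'I_m -> nat),
    (forall s, measurable (A s)) ->
    (forall s, exists M : R, forall t, A s t -> `|t| <= M) ->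
    (forall s s', s != s' -> A s `&` A s' = set0) ->
    (fun k : nat =>
       P [set om | exists l : seq R,
            eigenvalue_list (Hk_mx n p (fun x => omega x om) x0 k) l /\
            forall s, count (fun lam => ((n ^ k)%:R * (lam - e)) \in A s) l
                      = rr s])
    @ \oo -->
    ((\prod_(s < m)
        (expR (- (eta e * fine (lebesgue_measure (A s)))) *
         (eta e * fine (lebesgue_measure (A s))) ^+ rr s / (rr s)`!%:R))%:E)%E.
Proof.
move=> n2 rho1 p0 _ _ C20 pb sdim mom ind mg g0 [Mg gM] law meta eta0 hres e0 hlim m A rr mA bA dA.
(* The estimates want a strictly positive density bound. *)
have M0 : 0 < Num.max Mg 1 by rewrite lt_max ltr01 orbT.
have gM' t : gamma t <= Num.max Mg 1 by rewrite le_max gM.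
have muT := dens_setT law; have HQ := iid_path_law mom ind law.
have muM := dens_le mg g0 gM'.
set Q := path_law P mom in HQ.
have tlP := tailc_sum rho1 C20 (fun r h => (pb r h).2).
have tl0 := tailc_cvg0 C2 rho1.
have tlp := tailc_gt0 rho1 C20.
have nr := spectral_dimension_lt n2 rho1 sdim.
have small : (n ^ k)%:R * tailc rho C2 (uphalf k) @[k --> \oo] --> 0.
  rewrite (_ : (fun k => _) = (fun k => tailc rho C2 (uphalf k) * (n ^ k)%:R)).
    exact: tailc_small.
  by apply/funext => k; rewrite mulrC.
have Jk k : (uphalf k <= k)%N by rewrite uphalf_half; have := odd_double_half k; case: (odd k); lia.
have Jx : \forall k \near \oo, (x0 <= uphalf k)%N.
  exists (x0 * 2)%N => // k /=; rewrite uphalf_half; have := odd_double_half k; lia.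
have [Kf hK] := choice bA.
(* Adding 1 makes [K] positive and keeps every [A s] off the excluded endpoint -K. *)
pose K := \sum_s `|Kf s| + 1.
have K0 : 0 < K by rewrite ltr_wpDl// sumr_ge0.
have AK s : A s `<=` `]- K, K]%classic.
  move=> t /hK; rewrite /= in_itv /= ler_norml => /andP[t1 t2].
  have : `|Kf s| <= \sum_s `|Kf s| by rewrite (bigD1 s)//= lerDl sumr_ge0.
  by have := ler_norm (Kf s); rewrite /K => ? ?; apply/andP; split; lra.
have hV a b (U V : Omega -> nat -> R) (b0 : 0 < b) sol := (hres a b U V b0 sol).2.
have EV a b (b0 : 0 < b) := averaged_resolvent_limit mom n2 p0 tlP tl0 hV b0 (hlim a b b0).
have intens s := level_intensity muT HQ M0 muM n2 p0 tlP tl0 tlp Jk Jx small (ltW e0) EV (mA s) K0 (AK s).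
have C : fine (Q [set w | forall s, cK n p e k (A s) w = rr s]) @[k --> \oo] -->
    \prod_(s < m) (expR (- (eta e * fine (lebesgue_measure (A s)))) *
         (eta e * fine (lebesgue_measure (A s))) ^+ rr s / (rr s)`!%:R).
  by apply: (cK_cvg muT HQ M0 muM n2 p0 tlP tlp Jk small (blocks_inv_cvg0 n2 rho1 C20) K0 mA AK dA intens).
have ev k : (x0 <= k)%N ->
    P [set om | exists l : seq R, eigenvalue_list (Hk_mx n p (fun x => omega x om) x0 k) l /\
       forall s, count (fun lam => ((n ^ k)%:R * (lam - e)) \in A s) l = rr s] =
    Q [set w | forall s, cK n p e k (A s) w = rr s].
  move=> xk; rewrite /Q path_lawE; congr (P _).
  have EE om : (exists l : seq R, eigenvalue_list (Hk_mx n p (fun x => omega x om) x0 k) l /\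
       forall s, count (fun lam => ((n ^ k)%:R * (lam - e)) \in A s) l = rr s) <->
      (forall s, cK n p e k (A s) (fun x => omega x om) = rr s).
    by apply: eigenvalue_event; exact: ltn_level.
  by apply/seteqP; split => om h; [exact: ((EE om).1 h)|exact: ((EE om).2 h)].
apply/fine_cvgP; split.
  near=> k; rewrite ev; last by near: k; exists x0.
  by apply: fin_num_measure; exact: measurable_cK_event.
apply: cvg_near_eq C _; near=> k.
by rewrite /= ev//; near: k; exists x0.
Unshelve. all: by end_near. Qed.
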